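(* There is $q_0$ such that for every prime power $q\ge q_0$ and every non-archimedean local field $F$ with residue field of order $q$, letting $\mathcal{B}=\tilde A_3(F)$ be the Bruhat–Tits building associated with $PGL_4(F)$, there exist $\eta_0,\eta_1,\eta_2,\epsilon_0,\epsilon_1,\epsilon_2>0$ such that: if $X$ is a non-partite Ramanujan quotient of $\mathcal{B}$, $0\le i\le 2$, and $\alpha\in C^i(X,\mathbb{F}_2)$ is a locally minimal cochain with $\|\alpha\|\le\eta_i$, then $\|\delta_i(\alpha)\|\ge\epsilon_i\|\alpha\|$.
   Context: Building and Ramanujan quotients: $\tilde A_3(F)$ has vertices the homothety classes of $\mathcal{O}$-lattices in $F^4$ ($\mathcal{O}$ the valuation ring, $\pi$ a uniformizer), with $[L_0],\dots,[L_i]$ an $i$-cell iff representatives satisfy $\pi L_0'\subsetneq L_i'\subsetneq\cdots\subsetneq L_0'$. A quotient is $X=\Gamma\backslash\tilde A_3(F)$, $\Gamma\le G=PGL_4(F)$ cocompact discrete with $\mathrm{dist}(\gamma x,x)>2$ for all vertices $x$, $1\ne\gamma\in\Gamma$. It is non-partite if $\Gamma G_0=G$, $G_0=PSL_4(F)\cdot PGL_4(\mathcal{O})$. With vertex colors $\tau([L])=\mathrm{val}\det(\text{basis})\bmod 4$, edge colors $\tau(x,y)=\tau(x)-\tau(y)$ and Hecke operators $A_jf(x)=\sum_{\tau(x,y)=j}f(y)$ ($j=1,2,3$), a non-partite $X$ is Ramanujan if every joint eigenvalue of $(A_1,A_2,A_3)$ on functions on $X(0)$ orthogonal to constants lies in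 the joint spectrum of $(A_1,A_2,A_3)$ on $L^2$ of the building's vertices. Cochains and norms: for a finite pure $d$-dimensional complex $X$ and $\sigma\in X(i)$, $c(\sigma)$ is the number of $d$-cells containing $\sigma$ and $w(\sigma)=c(\sigma)/(\binom{d+1}{i+1}|X(d)|)$. $C^i(X,\mathbb{F}_2)$ is the space of functions $X(i)\to\mathbb{F}_2$, identified with subsets of $X(i)$, and $\|\alpha\|=\sum_{\sigma\in\alpha}w(\sigma)$. $\delta_i:C^i\to C^{i+1}$, $\delta_i(\alpha)(\sigma)=\sum_{\tau\subset\sigma,\dim\tau=i}\alpha(\tau)$; $\delta_{-1}$ maps $1\in\mathbb{F}_2=C^{-1}$ to the constant function $1$. $B^i=\mathrm{Im}\,\delta_{i-1}$. A cochain $\alpha\in C^i$ is minimal if $\|\alpha\|\le\|\alpha+\beta\|$ for all $\beta\in B^i$. The link of a vertex $v$ is $X_v=\{\sigma\setminus\{v\}: v\in\sigma\in X\}$, a pure $(d-1)$-dimensional complex with its own weights and norms; $\alpha\in C^i(X)$ induces $\alpha_v\in C^{i-1}(X_v)$, $\alpha_v(\sigma\setminus\{v\})=\alpha(\sigma)$. A $0$-cochain is locally minimal if it is minimal; for $i\ge1$, $\alpha\in C^i(X,\mathbb{F}_2)$ is locally minimal if $\alpha_v$ is minimal in $C^{i-1}(X_v,\mathbb{F}_2)$ for every vertex $v$. *)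

(* Defs.v *)
From HB Require Import structures.
From mathcomp Require Import all_boot all_order all_algebra.
From mathcomp Require Import all_classical all_reals.
From mathcomp Require Import ereal topology normedtype sequences esum.
From mathcomp.real_closed Require Import complex.

Set Implicit Arguments.
Unset Strict Implicit.
Unset Printing Implicit Defensive.

Import Order.TTheory GRing.Theory Num.Theory.

Local Open Scope classical_set_scope.
Local Open Scope ring_scope.

(******************************************************************************)
(* Simplicial cochains with F_2 coefficients.                                 *)
(*                                                                            *)
(* A finite complex on the vertex type V is a set X of subsets of V, the      *)
(* empty cell included.  Cells and cochains are indexed by their number k of  *)
(* vertices rather than by their dimension i = k - 1, so that C^{-1} is the   *)
(* case k = 0 and delta_{-1} is an instance of the general formula.  The      *)
(* dimension of the ambient complex is the parameter d.                       *)
(******************************************************************************)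

Section Cochains.
Variables (R : realType) (V : finType).
Implicit Types (X : {set {set V}}) (d k : nat).

Definition cells X k : {set {set V}} := [set s in X | #|s| == k]%SET.

Definition ccount X d (s : {set V}) : nat :=
  #|[set t in cells X d.+1 | s \subset t]%SET|.

Definition weight X d (s : {set V}) : R :=
  (ccount X d s)%:R / ('C(d.+1, #|s|) * #|cells X d.+1|)%N%:R.

Definition cochain X k (a : {ffun {set V} -> 'F_2}) : Prop :=
  forall s, s \notin cells X k -> a s = 0.

Definition cnorm X d k (a : {ffun {set V} -> 'F_2}) : R :=
  \sum_(s in cells X k | a s != 0) weight X d s.

(* The coboundary from C(X, k) to C(X, k.+1), i.e. delta_{k-1}. *)
Definition coboundary X k (a : {ffun {set V} -> 'F_2}) :
    {ffun {set V} -> 'F_2} :=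
  [ffun s => if s \in cells X k.+1
             then \sum_(t in cells X k | t \subset s) a t else 0].

Definition is_coboundary X k (b : {ffun {set V} -> 'F_2}) : Prop :=
  if k is k'.+1 then exists2 a, cochain X k' a & b = coboundary X k' a
  else b = 0.

Definition minimal X d k (a : {ffun {set V} -> 'F_2}) : Prop :=
  forall b, is_coboundary X k b -> cnorm X d k a <= cnorm X d k (a + b).

Definition link X (v : V) : {set {set V}} :=
  [set s :\ v | s in [set s in X | v \in s]]%SET.

(* The element a_v of C(link X v, k) induced by a in C(X, k.+1). *)
Definition localize X k (v : V) (a : {ffun {set V} -> 'F_2}) :
    {ffun {set V} -> 'F_2} :=
  [ffun s => if s \in cells (link X v) k then a (v |: s)%SET else 0].

Definition locally_minimal X d k (a : {ffun {set V} -> 'F_2}) : Prop :=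
  if k is k'.+2 then
    forall v, [set v]%SET \in X ->
      minimal (link X v) d.-1 k'.+1 (localize X k'.+1 v a)
  else minimal X d k a.

End Cochains.

(******************************************************************************)
(* Non-archimedean local fields: complete for a normalized discrete valuation *)
(* v, with residue field of order q.  The value v 0 is irrelevant.            *)
(******************************************************************************)

Definition prime_power (q : nat) : Prop :=
  exists p n : nat, prime p /\ q = (p ^ n.+1)%N.

Section LocalField.
Variables (F : fieldType) (v : F -> int).

Definition val_ge (n : int) : {pred F} := [pred x | (x == 0) || (n <= v x)].

Definition valring : {pred F} := val_ge 0.

Definition uniformizer (pi : F) : Prop := pi != 0 /\ v pi = 1.

Definition residue_class (x : F) : set F := [set y | y - x \in val_ge 1].

Definition residue_field : set (set F) :=
  [set residue_class x | x in [set x | x \in valring]].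

Record local_field (q : nat) : Prop := LocalField {
  val_mul : forall x y : F, x != 0 -> y != 0 -> v (x * y) = v x + v y;
  val_add : forall x y : F, x != 0 -> y != 0 -> x + y != 0 ->
    Num.min (v x) (v y) <= v (x + y);
  val_normalized : exists pi, uniformizer pi;
  val_complete : forall u : nat -> F,
    (forall N : int, exists n0, forall m n, (n0 <= m)%N -> (n0 <= n)%N ->
       u m - u n \in val_ge N) ->
    exists l, forall N : int, exists n0, forall n, (n0 <= n)%N ->
      u n - l \in val_ge N;
  residue_card : (residue_field #= `I_q)%card
}.

(******************************************************************************)
(* The building of PGL_4(F), on which GL_4(F) acts by left multiplication of  *)
(* column vectors.                                                            *)
(******************************************************************************)

(* The O-span of the columns of g. *)
Definition lattice_of (g : 'M[F]_4) : set 'cV[F]_4 :=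
  [set g *m u | u in [set u | u \is a mxOver valring]].

Definition lattice (L : set 'cV[F]_4) : Prop :=
  exists2 g, g \in unitmx & L = lattice_of g.

Definition scale_lattice (c : F) (L : set 'cV[F]_4) : set 'cV[F]_4 :=
  [set c *: u | u in L].

Definition homothety_class (L : set 'cV[F]_4) : set (set 'cV[F]_4) :=
  [set scale_lattice c L | c in [set c : F | c != 0]].

Definition bvertices : set (set (set 'cV[F]_4)) :=
  [set homothety_class L | L in [set L | lattice L]].

Definition bvertex : Type := set_type bvertices.

Definition bcell (i : nat) (S : set bvertex) : Prop :=
  exists (pi : F) (L : nat -> set 'cV[F]_4),
  [/\ uniformizer pi,
      forall j, (j <= i)%N -> lattice (L j),
      scale_lattice pi (L 0%N) `<` L i,
      forall j, (j < i)%N -> L j.+1 `<` L j &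
      S = [set x | exists2 j, (j <= i)%N & set_val x = homothety_class (L j)]].

Definition badj (x y : bvertex) : Prop := bcell 1 [set x; y].

Fixpoint bdist_le (n : nat) (x y : bvertex) : Prop :=
  if n is n'.+1 then exists2 z, x = z \/ badj x z & bdist_le n' z y
  else x = y.

(* translate g x y means y = g x. *)
Definition translate (g : 'M[F]_4) (x y : bvertex) : Prop :=
  set_val y = [set [set g *m u | u in L] | L in set_val x].

Definition bbasis (x : bvertex) : 'M[F]_4 :=
  xget 1%:M [set g | g \in unitmx /\ set_val x = homothety_class (lattice_of g)].

Definition bcolor (x : bvertex) : int := (v (\det (bbasis x)) %% 4)%Z.

Definition bedge (j : nat) (x y : bvertex) : Prop :=
  badj x y /\ (bcolor x - bcolor y = j%:Z %[mod 4])%Z.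

(******************************************************************************)
(* Subgroups of PGL_4(F).  A subset of PGL_4(F) is represented by its         *)
(* preimage in GL_4(F), which contains every nonzero multiple of each of its  *)
(* elements; the identity of PGL_4(F) corresponds to the scalar matrices.     *)
(******************************************************************************)

Definition pgl_subgroup (Gam : set 'M[F]_4) : Prop :=
  [/\ forall g, Gam g -> g \in unitmx,
      forall c : F, c != 0 -> Gam c%:M,
      forall g h, Gam g -> Gam h -> Gam (g *m h) &
      forall g, Gam g -> Gam (invmx g)].

Definition mx_close (n : int) (g h : 'M[F]_4) : Prop :=
  h - g \is a mxOver (val_ge n).

Definition gl_open (U : set 'M[F]_4) : Prop :=
  forall g, g \in unitmx -> U g ->
    exists n : int, forall h, h \in unitmx -> mx_close n g h -> U h.

Definition pgl_discrete (Gam : set 'M[F]_4) : Prop :=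
  exists n : int, forall g, Gam g -> mx_close n 1%:M g -> is_scalar_mx g.

(* Compactness of Gam \ PGL_4(F) for the quotient topology, whose open sets   *)
(* are the open subsets of GL_4(F) stable under left translation by Gam.      *)
Definition cocompact (Gam : set 'M[F]_4) : Prop :=
  forall W : set (set 'M[F]_4),
    (forall U, W U -> gl_open U) ->
    (forall U c g, W U -> Gam c -> U g -> U (c *m g)) ->
    (forall g, g \in unitmx -> exists2 U, W U & U g) ->
    exists W', [/\ finite_set W', W' `<=` W &
      forall g, g \in unitmx -> exists2 U, W' U & U g].

Definition moves_far (Gam : set 'M[F]_4) : Prop :=
  forall g x y, Gam g -> ~~ is_scalar_mx g -> translate g x y ->
    ~ bdist_le 2 y x.

(* Gam G_0 = G with G_0 = PSL_4(F) PGL_4(O). *)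
Definition nonpartite (Gam : set 'M[F]_4) : Prop :=
  forall g, g \in unitmx ->
    exists c s k : 'M[F]_4,
      [/\ Gam c, \det s = 1,
          [/\ k \in unitmx, k \is a mxOver valring
            & invmx k \is a mxOver valring] &
          g = c *m s *m k].

(* The complex X is the quotient of the building by Gam, with quotient map p  *)
(* on vertices.  Because of moves_far, the Gam-orbits of building cells are   *)
(* determined by the images of their sets of vertices.                        *)
Record quotient_complex (Gam : set 'M[F]_4) (V : finType) (p : bvertex -> V)
    (X : {set {set V}}) : Prop := QuotientComplex {
  quo_subgroup : pgl_subgroup Gam;
  quo_discrete : pgl_discrete Gam;
  quo_cocompact : cocompact Gam;
  quo_far : moves_far Gam;
  quo_surj : forall u, exists x, p x = u;
  quo_orbit : forall x y, p x = p y <-> exists2 g, Gam g & translate g x y;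
  quo_cells : forall s : {set V}, s \in X <->
    s = finset.set0 \/
    exists i (S : set bvertex), bcell i S /\ [set` s] = p @` S
}.

(******************************************************************************)
(* Hecke operators, on the building and on a quotient.                        *)
(******************************************************************************)

Section Hecke.
Variable R : realType.

Definition bhecke (j : nat) (f : bvertex -> R[i]) (x : bvertex) : R[i] :=
  \sum_(y \in [set y | bedge j x y]) f y.

Definition l2norm2 (f : bvertex -> R[i]) : \bar R :=
  \esum_(x in [set: bvertex]) (Normc.normc (f x) ^+ 2)%:E.

(* The A_j are commuting normal operators, so their joint spectrum consists   *)
(* of the joint approximate eigenvalues.                                      *)
Definition joint_spectrum (lam : nat -> R[i]) : Prop :=
  forall e : R, 0 < e ->
    exists2 f, l2norm2 f = 1%:E &
      forall j, (0 < j < 4)%N ->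
        (l2norm2 (fun x => bhecke j f x - lam j * f x)%R <= (e ^+ 2)%:E)%E.

Section Quotient.
Variables (V : finType) (p : bvertex -> V).

Definition qedge (j : nat) (u w : V) : Prop :=
  exists x y, [/\ p x = u, p y = w & bedge j x y].

Definition qhecke (j : nat) (f : V -> R[i]) (u : V) : R[i] :=
  \sum_(w | `[< qedge j u w >]) f w.

Definition joint_eigenvalue (lam : nat -> R[i]) : Prop :=
  exists f : V -> R[i],
    [/\ exists u, f u != 0, \sum_u f u = 0 &
        forall j, (0 < j < 4)%N -> forall u, qhecke j f u = lam j * f u].

Definition ramanujan : Prop :=
  forall lam, joint_eigenvalue lam -> joint_spectrum lam.

End Quotient.
End Hecke.
End LocalField.

(* Main.v *)
(* The local structure of the building suffices: the Hecke eigenvalue bounds are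
   replaced by Oppenheim's trickling down. The link of an edge is a complete
   bipartite graph or the incidence graph of a projective plane of order q,
   whose normalised second eigenvalue is at most sqrt q / (q + 1). Since the
   quotient and its vertex links are connected, this one-sided gap propagates to
   the vertex links and to the 1-skeleton of the quotient.

   Small locally minimal cochains then expand as in Kaufman, Kazhdan and
   Lubotzky. For a 2-cochain a, call an edge thick if a has density at least eta
   around it, and a vertex thick if many of its edges are thick. Mixing shows
   that two thick vertices are rarely adjacent, and that two thick edges rarely
   meet at a thin vertex. Counting pairs of triangles of a sharing an edge in a
   tetrahedron handles all triangles with at most one thick edge; the others
   contain a thick vertex, where the coboundary expansion of the vertex link is
   used. The vertex link is the flag complex of F_q^4, for which cones over a
   point fill every edge with at most 12 flags; averaging over GL_4(F_q), which
   is transitive on flags, gives the expansion constant 1/12. *)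
From HB Require Import structures.
From mathcomp Require Import all_boot all_order all_algebra all_fingroup all_field.
From mathcomp Require Import reals.
From mathcomp Require Import ring lra zify.
Require Import Defs.

Set Implicit Arguments.
Unset Strict Implicit.
Unset Printing Implicit Defensive.

Import Order.TTheory GRing.Theory Num.Theory.

Local Open Scope ring_scope.

(** * Weighted graphs and trickling down *)

(** Everything is expressed through one symmetric weight [T], the indicator of ordered tetrahedra:
    its slices and marginals are the edge weights of all links and of the 1-skeleton, and a norm
    times 24 |X(3)| is a sum against [T]. Cochains become Boolean functions, so the combinatorial
    inequalities reduce to finite checks on a single simplex. The obstacle is that local minimality
    only bounds the density around a cell by 1/2. If A is the mass of the cochain and P the mass of
    pairs of its cells sharing a face, this gives P <= A / 2 up to small errors; then the lower
    bound 3 A - 6 P for odd triangles vanishes, and 4 A - 12 P for odd tetrahedra is negative. Hence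
    the separate treatment of thick cells. For triangles even that is tight when two of them share a
    thick vertex, and the margin comes from the vertex links alone. What counts there is a constant
    independent of q, so the cone fillings need not be economical. Powers of [eta] are set by the
    losses: a factor 1/eta from triangles to thick edges and 1/eta^2 from thick edges to thick
    vertices. *)

Section WeightedGraph.
Variables (R : realType) (I : finType) (w : I -> I -> R).
Implicit Types (f g : I -> R) (lam mu : R).

Definition wdeg x : R := \sum_y w x y.
Definition wtot : R := \sum_x wdeg x.
Definition wform f g : R := \sum_x \sum_y w x y * f x * g y.
Definition wip f g : R := \sum_x wdeg x * f x * g x.
(** The random walk operator M. Division by zero gives 0 at a vertex of degree 0, so [wavgE] holds
    without a side condition. *)
Definition wavg f x : R := (\sum_y w x y * f y) / wdeg x.
Definition wsum f : R := \sum_x wdeg x * f x.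

(** The term [wsum f ^+ 2 / wtot] is the squared norm of the projection of [f] on constants, so this
    bounds the second largest eigenvalue of the walk. Negative eigenvalues are unrestricted, as
    bipartite links have the eigenvalue -1. *)
Definition spectral_gap lam : Prop := forall f,
  wform f f <= lam * wip f f + (1 - lam) * (wsum f ^+ 2 / wtot).

(** An induction principle instead of paths: in use, [P] is the property that has to spread.
    Vertices of degree 0 are left out. *)
Definition wconnected : Prop := forall P : I -> Prop,
  (forall x y, w x y != 0 -> P x -> P y) ->
  forall x y, wdeg x != 0 -> wdeg y != 0 -> P x -> P y.

Hypothesis w_ge0 : forall x y, 0 <= w x y.
Hypothesis w_sym : forall x y, w x y = w y x.

Lemma wdeg_ge0 x : 0 <= wdeg x.
Proof. by apply: sumr_ge0 => y _. Qed.

Lemma wdeg0 x y : wdeg x = 0 -> w x y = 0.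
Proof.
by move=> h; apply/eqP; move: (eqxx (wdeg x)); rewrite {2}h /wdeg psumr_eq0 => [/allP/(_ y)|//]; rewrite mem_index_enum => /(_ isT).
Qed.

Lemma wavgE f x : wdeg x * wavg f x = \sum_y w x y * f y.
Proof.
rewrite /wavg; have [h|h] := eqVneq (wdeg x) 0; last by rewrite mulrC divfK.
by rewrite h mul0r big1 // => y _; rewrite (wdeg0 y h) mul0r.
Qed.

Lemma wform_sym f g : wform f g = wform g f.
Proof.
rewrite /wform exchange_big; apply: eq_bigr => x _; apply: eq_bigr => y _.
by rewrite w_sym mulrAC.
Qed.

Lemma wip_sym f g : wip f g = wip g f.
Proof. by apply: eq_bigr => x _; rewrite mulrAC. Qed.

Lemma wform_avg f g : wform f g = wip f (wavg g).
Proof.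
apply: eq_bigr => x _; rewrite mulrAC wavgE big_distrl /=.
by apply: eq_bigr => y _; rewrite mulrAC.
Qed.

Lemma wip_lin f g h (a b : R) :
  wip (fun x => a * f x + b * g x) h = a * wip f h + b * wip g h.
Proof.
rewrite /wip !mulr_sumr -big_split; apply: eq_bigr => x _ /=; ring.
Qed.

Lemma wform_lin f g h (a b : R) :
  wform (fun x => a * f x + b * g x) h = a * wform f h + b * wform g h.
Proof.
rewrite /wform !mulr_sumr -big_split; apply: eq_bigr => x _ /=.
rewrite !mulr_sumr -big_split; apply: eq_bigr => y _ /=; ring.
Qed.

Lemma wip_sqr f g (a b : R) (h := fun x => a * f x + b * g x) :
  wip h h = a ^+ 2 * wip f f + 2 * a * b * wip f g + b ^+ 2 * wip g g.
Proof.
rewrite wip_lin ![wip _ h]wip_sym !wip_lin (wip_sym g f); ring.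
Qed.

Lemma wform_sqr f g (a b : R) (h := fun x => a * f x + b * g x) :
  wform h h = a ^+ 2 * wform f f + 2 * a * b * wform f g + b ^+ 2 * wform g g.
Proof.
rewrite wform_lin ![wform _ h]wform_sym !wform_lin (wform_sym g f); ring.
Qed.

Lemma wip_ge0 f : 0 <= wip f f.
Proof.
apply: sumr_ge0 => x _; rewrite -mulrA mulr_ge0 ?wdeg_ge0 //.
by rewrite -expr2 sqr_ge0.
Qed.

Definition wenergy f : R := \sum_x \sum_y w x y * (f x - f y) ^+ 2.

Lemma sum_wip1 f : \sum_x \sum_y w x y * f x ^+ 2 = wip f f.
Proof.
by apply: eq_bigr => x _; rewrite -mulr_suml -/(wdeg x) expr2 mulrA.
Qed.

Lemma wenergyE f : wenergy f = 2 * (wip f f - wform f f).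
Proof.
have -> : wenergy f = \sum_x \sum_y w x y * f x ^+ 2
    + \sum_x \sum_y w x y * f y ^+ 2 - 2 * wform f f.
  rewrite /wenergy /wform mulr_sumr -big_split -sumrB; apply: eq_bigr => x _ /=.
  rewrite mulr_sumr -big_split -sumrB; apply: eq_bigr => y _ /=; ring.
rewrite [X in _ + X - _]exchange_big /=.
under [X in _ + X - _]eq_bigr do under eq_bigr do rewrite w_sym.
rewrite !sum_wip1; ring.
Qed.

Lemma wform_le f : wform f f <= wip f f.
Proof.
have: 0 <= wenergy f.
  by apply: sumr_ge0 => x _; apply: sumr_ge0 => y _; rewrite mulr_ge0 ?sqr_ge0.
rewrite wenergyE; lra.
Qed.

Lemma wform_ge f : - wip f f <= wform f f.
Proof.
have -> : wform f f = (\sum_x \sum_y w x y * (f x + f y) ^+ 2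
    - \sum_x \sum_y w x y * f x ^+ 2
    - \sum_x \sum_y w x y * f y ^+ 2) / 2.
  rewrite /wform -!sumrB mulr_suml; apply: eq_bigr => x _ /=.
  rewrite -!sumrB mulr_suml; apply: eq_bigr => y _ /=; by field.
have h : 0 <= \sum_x \sum_y w x y * (f x + f y) ^+ 2.
  by apply: sumr_ge0 => x _; apply: sumr_ge0 => y _; rewrite mulr_ge0 ?sqr_ge0.
rewrite [X in _ - X]exchange_big /=.
under [X in _ - X]eq_bigr do under eq_bigr do rewrite w_sym.
rewrite !sum_wip1; lra.
Qed.

Lemma wsum_wip f : wsum f = wip f (fun=> 1).
Proof. by apply: eq_bigr => x _; rewrite mulr1. Qed.

Lemma wsum_lin f g (a b : R) :
  wsum (fun x => a * f x + b * g x) = a * wsum f + b * wsum g.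
Proof. by rewrite !wsum_wip wip_lin. Qed.

Lemma wsum_avg f : wsum (wavg f) = wsum f.
Proof.
rewrite /wsum; under eq_bigr do rewrite wavgE.
rewrite exchange_big; apply: eq_bigr => x _ /=.
by rewrite -mulr_suml; congr (_ * _); apply: eq_bigr => y _.
Qed.

Definition rayleigh_bound mu : Prop :=
  forall f, wsum f = 0 -> wform f f <= mu * wip f f.

(** Along a path, (f x - f y)^2 is at most a constant times the energy, and for mean-zero [f] the
    average of (f x - f y)^2 over all pairs is a multiple of the norm. The bound depends on the
    graph; it only provides the [mu < 1] from which [trickling_down] starts. *)
Lemma poincare : wconnected -> exists2 mu, mu < 1 & rayleigh_bound mu.
Proof.
move=> conn.
have /fin_all_exists[K hK] (x : I) : exists K : I -> R, forall y, 0 <= K y /\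
    (wdeg x != 0 -> wdeg y != 0 -> forall f, (f x - f y) ^+ 2 <= K y * wenergy f).
  have en0 f : 0 <= wenergy f.
    by apply: sumr_ge0 => z _; apply: sumr_ge0 => y _; rewrite mulr_ge0 ?sqr_ge0.
  apply: (fin_all_exists (U := fun=> R) (P := fun y K => 0 <= K /\
    (wdeg x != 0 -> wdeg y != 0 -> forall f, (f x - f y) ^+ 2 <= K * wenergy f))) => y.
  have [hx|hx] := eqVneq (wdeg x) 0; first by exists 0; rewrite lexx.
  have [hy|hy] := eqVneq (wdeg y) 0; first by exists 0; rewrite lexx.
  suff [K [K0 hK]] : exists K, 0 <= K /\ forall f, (f x - f y) ^+ 2 <= K * wenergy f.
    by exists K; split.
  apply: (conn (fun y => exists K, 0 <= K /\ forall f, (f x - f y) ^+ 2 <= K * wenergy f)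
     _ _ _ hx hy); last first.
    by exists 0; split=> // f; rewrite subrr expr0n mul0r.
  move=> a b wab [K [K0 hK]]; exists (2 * K + 2 / w a b); split.
    by apply: addr_ge0; [apply: mulr_ge0|apply: divr_ge0].
  move=> f; rewrite mulrDl.
  have h1 : (f x - f b) ^+ 2 <= 2 * (f x - f a) ^+ 2 + 2 * (f a - f b) ^+ 2.
    have := sqr_ge0 ((f x - f a) - (f a - f b)); nra.
  have h2 : (f a - f b) ^+ 2 <= wenergy f / w a b.
    rewrite ler_pdivlMr ?lt_def ?wab ?w_ge0 // mulrC.
    rewrite /wenergy (bigD1 a) //= (bigD1 b) //= -addrA lerDl addr_ge0 //.
      by apply: sumr_ge0 => z _; rewrite mulr_ge0 ?sqr_ge0.
    by apply: sumr_ge0 => z _; apply: sumr_ge0 => y' _; rewrite mulr_ge0 ?sqr_ge0.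
  apply: le_trans h1 _; rewrite -mulrA lerD //.
    by rewrite ler_pM2l.
  by rewrite -mulrA ler_pM2l // mulrC.
have tot0 : 0 <= wtot by apply: sumr_ge0 => x _; exact: wdeg_ge0.
have [t0|t0] := eqVneq wtot 0.
  exists 0 => // f _; rewrite mul0r.
  have d0 x : wdeg x = 0.
    by apply/eqP; move: t0 => /eqP; rewrite psumr_eq0 => [/allP/(_ x)|? _];
      [rewrite mem_index_enum => /(_ isT)|exact: wdeg_ge0].
  by rewrite /wform big1 // => x _; rewrite big1 // => y _; rewrite (wdeg0 y (d0 x)) !mul0r.
pose C := \sum_x \sum_y wdeg x * wdeg y * K x y.
have C0 : 0 <= C.
  by apply: sumr_ge0 => x _; apply: sumr_ge0 => y _; rewrite !mulr_ge0 ?wdeg_ge0 //; case: (hK x y).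
exists (1 - wtot / (C + 1)).
  by rewrite ltrBlDr ltrDl divr_gt0 // ?lt_def ?t0 //; lra.
move=> f f0.
have key : 2 * wtot * wip f f <= C * wenergy f.
  have -> : 2 * wtot * wip f f = \sum_x \sum_y wdeg x * wdeg y * (f x - f y) ^+ 2.
    have -> : \sum_x \sum_y wdeg x * wdeg y * (f x - f y) ^+ 2
      = \sum_x \sum_y ((wdeg x * f x * f x) * wdeg y)
        + \sum_x \sum_y (wdeg x * (wdeg y * f y * f y))
        - 2 * \sum_x \sum_y (wdeg x * f x) * (wdeg y * f y).
      rewrite mulr_sumr -big_split -sumrB; apply: eq_bigr => x _ /=.
      rewrite mulr_sumr -big_split -sumrB; apply: eq_bigr => y _ /=; ring.
    rewrite -!big_distrlr /= -/(wip f f) -/wtot -/(wsum f) f0; ring.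
  rewrite /C mulr_suml; apply: ler_sum => x _; rewrite mulr_suml; apply: ler_sum => y _.
  have [hx|hx] := eqVneq (wdeg x) 0; first by rewrite hx !mul0r.
  have [hy|hy] := eqVneq (wdeg y) 0; first by rewrite hy !(mul0r,mulr0).
  rewrite -[X in _ <= X]mulrA ler_wpM2l ?mulr_ge0 ?wdeg_ge0 //.
  by case: (hK x y) => _; apply.
rewrite wenergyE in key.
have := wform_le f; have := wip_ge0 f => i0 hle.
have C1 : 0 < C + 1 by lra.
have key2 : wtot * wip f f <= (C + 1) * (wip f f - wform f f) by nra.
have : wtot / (C + 1) * wip f f <= wip f f - wform f f.
  by rewrite mulrAC ler_pdivrMr // [X in _ <= X]mulrC.
lra.
Qed.

(** The least Rayleigh bound replaces the second eigenvalue, which avoids diagonalisation. The floor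
    [lam0] keeps the set of bounds bounded below even when every mean-zero function has norm 0. *)
Lemma rayleigh_bound_inf lam0 : (exists2 mu, lam0 <= mu & rayleigh_bound mu) ->
  exists2 mu, lam0 <= mu & rayleigh_bound mu /\ forall nu, lam0 <= nu -> rayleigh_bound nu -> mu <= nu.
Proof.
move=> [mu0 h0 b0].
pose E : classical_sets.set R := fun mu : R => (lam0 <= mu) /\ rayleigh_bound mu.
have hE : classical_sets.has_inf E by split; [exists mu0 | exists lam0 => x []].
have lb nu : lam0 <= nu -> rayleigh_bound nu -> inf E <= nu.
  by move=> h1 h2; apply: ge_inf; [case: hE | split].
exists (inf E).
  by apply: lb_le_inf; [case: hE | move=> x []].
split=> // f f0; apply/ler_addgt0Pr => e e0.
have i0 := wip_ge0 f.
have d0 : 0 < e / (wip f f + 1) by rewrite divr_gt0 //; lra.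
have [mu [_ bmu] hmu] := inf_adherent d0 hE.
apply: le_trans (bmu f f0) _.
apply: le_trans (_ : (inf E + e / (wip f f + 1)) * wip f f <= _).
  by rewrite ler_wpM2r // ltW.
rewrite mulrDl lerD2l mulrAC ler_pdivrMr; last by lra.
by rewrite ler_wpM2l ?(ltW e0) //; lra.
Qed.

(* With mu the best Rayleigh bound, Q f = mu |f|^2 - <Mf, f> is nonnegative on
   mean-zero f; testing it at f - g / 2 for g = mu f - M f gives |g|^2 <= 2 Q f,
   so that f is an approximate eigenvector when Q f is small. *)
Lemma rayleigh_residual mu f : mu <= 1 -> rayleigh_bound mu -> wsum f = 0 ->
  let Q := mu * wip f f - wform f f in
  0 <= Q /\ wip (wavg f) (wavg f) <= mu ^+ 2 * wip f f - 2 * mu * Q + 2 * Q.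
Proof.
move=> mu1 bmu f0 Q.
have Q0 : 0 <= Q by rewrite subr_ge0 bmu.
split=> //; pose M := wavg f.
pose g x := mu * f x + (-1) * M x.
have g0 : wsum g = 0 by rewrite /g wsum_lin wsum_avg f0 !mulr0 addr0.
pose h x := 1 * f x + (- (1/2)) * g x.
have h0 : wsum h = 0 by rewrite /h wsum_lin f0 g0 !mulr0 addr0.
have := bmu h h0.
have iMf : wip M f = wform f f by rewrite wform_avg wip_sym.
have ifM : wip f M = wform f f by rewrite wip_sym.
have igf : wip g f = Q by rewrite /g wip_lin iMf /Q; ring.
have igM : wip g M = mu * wform f f - wip M M by rewrite /g wip_lin ifM; ring.
have igg : wip g g = mu * Q - mu * wform f f + wip M M.
  by rewrite /g wip_sqr ifM /Q; ring.
have fgf : wform f g = mu * wform f f - wip M M.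
  by rewrite wform_sym wform_avg igM.
have fhh : wform h h = wform f f - wform f g + 1/4 * wform g g.
  by rewrite /h wform_sqr; field.
have ihh : wip h h = wip f f - wip g f + 1/4 * wip g g.
  by rewrite /h wip_sqr (wip_sym g f); field.
have := wform_ge g; have := wip_ge0 g.
rewrite fhh ihh fgf igf => gg0 gge hh.
(* With Q(u) = mu |u|^2 - <Mu, u>, the bound at [h] reads 0 <= Q - |g|^2 + Q(g) / 4, and Q(g) <= (mu
   + 1) |g|^2 <= 2 |g|^2 by [wform_ge]. *)
have : wip g g <= 2 * Q.
  have : mu * wip g g <= wip g g by rewrite ler_piMl.
  rewrite /Q in igf igg *.
  move: hh; rewrite igg /Q; nra.
rewrite igg -/M /Q; lra.
Qed.

Lemma spectral_gap_rayleigh lam : rayleigh_bound lam -> spectral_gap lam.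
Proof.
move=> bl f.
have tot0 : 0 <= wtot by apply: sumr_ge0 => x _; exact: wdeg_ge0.
have s1 : wsum (fun=> 1) = wtot by apply: eq_bigr => x _; rewrite mulr1.
have [t0|t0] := eqVneq wtot 0.
  have d0 x : wdeg x = 0.
    by apply/eqP; move: t0 => /eqP; rewrite psumr_eq0 => [/allP/(_ x)|? _];
      [rewrite mem_index_enum => /(_ isT)|exact: wdeg_ge0].
  have -> : wform f f = 0.
    by rewrite /wform big1 // => x _; rewrite big1 // => y _; rewrite (wdeg0 y (d0 x)) !mul0r.
  have -> : wip f f = 0 by rewrite /wip big1 // => x _; rewrite d0 !mul0r.
  by rewrite t0 invr0 !mulr0 addr0.
pose c := wsum f / wtot.
pose g x := 1 * f x + (- c) * (fun=> 1) x.
have g0 : wsum g = 0 by rewrite /g wsum_lin s1 /c; field.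
have f1 : wform f (fun=> 1) = wsum f.
  by rewrite wform_sym wform_avg wip_sym -wsum_wip wsum_avg.
have f11 : wform (fun=> 1) (fun=> 1) = wtot.
  by rewrite wform_avg wip_sym -wsum_wip wsum_avg s1.
have := bl g g0.
rewrite /g wip_sqr wform_sqr f1 f11 -!wsum_wip s1.
suff -> : wsum f ^+ 2 / wtot = c * wsum f.
  have : c * wtot = wsum f by rewrite /c; field.
  nra.
by rewrite /c; field.
Qed.

(** For an eigenfunction of eigenvalue mu the hypothesis reads mu <= lam + (1 - lam) mu^2, that is
    (1 - mu) ((1 - lam) mu - lam) <= 0; as mu < 1, this forces mu <= lam / (1 - lam). Near-extremal
    functions replace eigenfunctions, through [rayleigh_residual]. *)
Theorem trickling_down lam : 0 <= lam -> lam < 1 / 2 -> wconnected ->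
  (forall f, wform f f <= lam * wip f f + (1 - lam) * wip (wavg f) (wavg f)) ->
  spectral_gap (lam / (1 - lam)).
Proof.
move=> l0 l1 conn H; apply: spectral_gap_rayleigh.
set lam' := lam / (1 - lam).
have l'E : lam' * (1 - lam) = lam by rewrite /lam' divfK //; lra.
have l'0 : 0 <= lam' by rewrite divr_ge0 //; lra.
have l'1 : lam' < 1 by nra.
have mono mu nu : mu <= nu -> rayleigh_bound mu -> rayleigh_bound nu.
  by move=> h b f f0; apply: le_trans (b f f0) _; rewrite ler_wpM2r ?wip_ge0.
have [mu0 mu01 b0] := poincare conn.
have [|mu l'mu [bmu mu_min]] := @rayleigh_bound_inf lam'.
  exists (Num.max lam' mu0); first by rewrite le_max lexx.
  by apply: mono b0; rewrite le_max lexx orbT.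
have mu1 : mu < 1.
  apply: le_lt_trans (mu_min (Num.max lam' mu0) _ _) _; rewrite ?le_max ?lexx //.
    by apply: mono b0; rewrite le_max lexx orbT.
  by rewrite gt_max l'1.
suff /le_anti -> : lam' <= mu <= lam' by [].
rewrite l'mu leNgt; apply/negP => lt.
(* If the claim fails then [c] is positive, and the best bound could be lowered by [c / 3]. The 3
   comes from Q + 2 (1 - lam) (1 - mu) Q <= 3 Q. *)
pose c := (1 - mu) * ((1 - lam) * mu - lam).
have c0 : 0 < c by rewrite mulr_gt0; nra.
have key : rayleigh_bound (mu - c / 3).
  move=> f f0; have [] := rayleigh_residual (ltW mu1) bmu f0.
  set Q := _ - wform f f => Q0 hM.
  have := H f; have i0 := wip_ge0 f.
  have -> : wform f f = mu * wip f f - Q by rewrite /Q; ring.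
  move=> h1.
  have h2 : mu * wip f f - Q <= lam * wip f f
     + (1 - lam) * (mu ^+ 2 * wip f f - 2 * mu * Q + 2 * Q).
    by apply: le_trans h1 _; rewrite lerD2l ler_wpM2l //; lra.
  have h3 : (1 - lam) * (1 - mu) * Q <= Q.
    by rewrite ler_piMl //; nra.
  have : c * wip f f <= 3 * Q by rewrite /c; nra.
  lra.
have : mu <= Num.max lam' (mu - c / 3).
  apply: mu_min; first by rewrite le_max lexx.
  by apply: mono key; rewrite le_max lexx orbT.
rewrite le_max => /orP[|]; lra.
Qed.

End WeightedGraph.

(** Garland's localisation: form and norm of [w2] are sums of those of the links [w3 z], and the
    mean of [f] over the link of [z] is the walk average of [f] at [z]. The local projections on
    constants thus add up to |Mf|^2. *)
Theorem trickling_down_links (R : realType) (I : finType) (w3 : I -> I -> I -> R)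
    (w2 := fun x y => \sum_z w3 x y z) (lam : R) :
  (forall x y z, 0 <= w3 x y z) ->
  (forall x y z, w3 x y z = w3 y x z) -> (forall x y z, w3 x y z = w3 x z y) ->
  0 <= lam -> lam < 1 / 2 -> wconnected w2 ->
  (forall z, spectral_gap (w3 z) lam) -> spectral_gap w2 (lam / (1 - lam)).
Proof.
move=> w0 s01 s12 l0 l1 conn gap.
have w20 x y : 0 <= w2 x y by exact: sumr_ge0.
have w2s x y : w2 x y = w2 y x by apply: eq_bigr => z _; rewrite s01.
apply: trickling_down => // f.
have -> : wform w2 f f = \sum_z wform (w3 z) f f.
  rewrite /wform exchange_big [RHS]exchange_big /=; apply: eq_bigr => y _.
  rewrite [RHS]exchange_big; apply: eq_bigr => x _ /=.
  by rewrite /w2 !mulr_suml; apply: eq_bigr => z _; rewrite s01 s12 s01 mulrAC.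
have -> : wip w2 f f = \sum_z wip (w3 z) f f.
  rewrite /wip [RHS]exchange_big; apply: eq_bigr => x _ /=.
  rewrite /wdeg !mulr_suml; apply: eq_bigr => z _.
  by rewrite w2s.
rewrite !mulr_sumr -big_split; apply: ler_sum => z _ /=.
apply: le_trans (gap z f) _; rewrite lerD2l ler_wpM2l //; first by lra.
have -> : wsum (w3 z) f = wdeg w2 z * wavg w2 f z by rewrite wavgE.
have -> : wtot (w3 z) = wdeg w2 z by [].
have [->|d0] := eqVneq (wdeg w2 z) 0; first by rewrite invr0 !(mulr0, mul0r).
by rewrite [leLHS](_ : _ = wdeg w2 z * wavg w2 f z * wavg w2 f z) //; field.
Qed.

(** * Expansion of small cochains from spectral gaps *)

Lemma sqr_div_le (R : realFieldType) (e m t : R) :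
  0 <= e -> 0 <= m -> 0 <= t -> m <= e * t -> m ^+ 2 / t <= e * m.
Proof.
move=> e0 m0 t0 h; have [->|t1] := eqVneq t 0; first by rewrite invr0 mulr0 mulr_ge0.
by rewrite ler_pdivrMr ?lt_def ?t1 //; rewrite expr2; nra.
Qed.

Section Mixing.
Variables (R : realType) (I : finType) (w : I -> I -> R).
Hypothesis w_ge0 : forall x y, 0 <= w x y.

Lemma wtot_ge0 : 0 <= wtot w.
Proof. by apply: sumr_ge0 => x _; exact: wdeg_ge0. Qed.

(** Upper half of the expander mixing lemma: for a set of density at most [e], the projection of its
    indicator on constants has squared norm m^2 / wtot <= e m. *)
Lemma mixing lam e (h : pred I) (m := \sum_x wdeg w x * (h x)%:R) :
  0 <= lam -> 0 <= e -> spectral_gap w lam -> m <= e * wtot w ->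
  \sum_x \sum_y w x y * ((h x)%:R * (h y)%:R) <= (lam + e) * m.
Proof.
move=> l0 e0 /(_ (fun x => (h x)%:R)) gap hm.
have m0 : 0 <= m by apply: sumr_ge0 => x _; rewrite mulr_ge0 ?wdeg_ge0.
have hE : wip w (fun x => (h x)%:R) (fun x => (h x)%:R) = m.
  by apply: eq_bigr => x _; case: (h x); rewrite ?mulr1 ?mulr0.
have := sqr_div_le e0 m0 wtot_ge0 hm.
have d0 : 0 <= m ^+ 2 / wtot w by rewrite divr_ge0 ?sqr_ge0 ?wtot_ge0.
move: gap; rewrite hE -[wsum _ _]/m => gap h2.
have -> : \sum_x \sum_y w x y * ((h x)%:R * (h y)%:R)
    = wform w (fun x => (h x)%:R) (fun x => (h x)%:R).
  by apply: eq_bigr => x _; apply: eq_bigr => y _; rewrite mulrA.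
nra.
Qed.

End Mixing.

(** * Expansion estimates for a symmetric weight on ordered 4-tuples *)

Section Expansion.
Variables (R : realType) (V : finType) (T : V -> V -> V -> V -> R).
Hypothesis T_ge0 : forall x y z t, 0 <= T x y z t.
Hypothesis T01 : forall x y z t, T x y z t = T y x z t.
Hypothesis T12 : forall x y z t, T x y z t = T x z y t.
Hypothesis T23 : forall x y z t, T x y z t = T x y t z.

(** For the weight of ordered tetrahedra, [T u w] is the edge weight of the link of an edge,
    [marg3 u] that of the link of a vertex, and [marg2] that of the 1-skeleton. *)
Definition marg3 x y z : R := \sum_t T x y z t.
Definition marg2 x y : R := \sum_z marg3 x y z.
Definition marg1 x : R := \sum_y marg2 x y.
Definition total4 : R := \sum_x marg1 x.

Definition tsum (F : V -> V -> V -> V -> R) : R :=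
  \sum_x \sum_y \sum_z \sum_t T x y z t * F x y z t.

Lemma marg3_ge0 x y z : 0 <= marg3 x y z.
Proof. exact: sumr_ge0. Qed.
Lemma marg2_ge0 x y : 0 <= marg2 x y.
Proof. by apply: sumr_ge0 => z _; exact: marg3_ge0. Qed.
Lemma tsum_le F G : (forall x y z t, F x y z t <= G x y z t) -> tsum F <= tsum G.
Proof. by move=> h; do 4! (apply: ler_sum => ? _); rewrite ler_wpM2l. Qed.

Lemma tsum_ge0 F : (forall x y z t, 0 <= F x y z t) -> 0 <= tsum F.
Proof. by move=> h; do 4! (apply: sumr_ge0 => ? _); rewrite mulr_ge0. Qed.

Lemma eq_tsum F G : (forall x y z t, F x y z t = G x y z t) -> tsum F = tsum G.
Proof. by move=> h; do 4! (apply: eq_bigr => ? _); rewrite h. Qed.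

Lemma tsumD F G : tsum (fun x y z t => F x y z t + G x y z t) = tsum F + tsum G.
Proof.
rewrite /tsum -big_split; do 3! (apply: eq_bigr => ? _; rewrite -big_split /=).
by apply: eq_bigr => ? _; rewrite mulrDr.
Qed.

Lemma tsumZ c F : tsum (fun x y z t => c * F x y z t) = c * tsum F.
Proof.
rewrite /tsum mulr_sumr; do 3! (apply: eq_bigr => ? _; rewrite mulr_sumr /=).
by apply: eq_bigr => ? _; rewrite mulrCA.
Qed.

Lemma tsumB F G : tsum (fun x y z t => F x y z t - G x y z t) = tsum F - tsum G.
Proof.
rewrite -mulN1r -tsumZ -tsumD; apply: eq_tsum => x y z t; by rewrite mulN1r.
Qed.

Lemma tsum01 F : tsum F = tsum (fun x y z t => F y x z t).
Proof.
rewrite {1}/tsum exchange_big /=; do 4! (apply: eq_bigr => ? _); by rewrite T01.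
Qed.

Lemma tsum12 F : tsum F = tsum (fun x y z t => F x z y t).
Proof.
apply: eq_bigr => x _; rewrite exchange_big /=; do 3! (apply: eq_bigr => ? _).
by rewrite T12.
Qed.

Lemma tsum23 F : tsum F = tsum (fun x y z t => F x y t z).
Proof.
apply: eq_bigr => x _; apply: eq_bigr => y _; rewrite exchange_big /=.
by do 2! (apply: eq_bigr => ? _); rewrite T23.
Qed.

Lemma tsum_marg3 (F : V -> V -> V -> R) :
  tsum (fun x y z _ => F x y z) = \sum_x \sum_y \sum_z marg3 x y z * F x y z.
Proof. by do 3! (apply: eq_bigr => ? _); rewrite mulr_suml. Qed.

Lemma tsum_marg2 (F : V -> V -> R) :
  tsum (fun x y _ _ => F x y) = \sum_x \sum_y marg2 x y * F x y.
Proof.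
rewrite tsum_marg3; do 2! (apply: eq_bigr => ? _); by rewrite mulr_suml.
Qed.

Lemma tsum_marg1 (F : V -> R) :
  tsum (fun x _ _ _ => F x) = \sum_x marg1 x * F x.
Proof. by rewrite tsum_marg2; apply: eq_bigr => ? _; rewrite mulr_suml. Qed.

Variable lam : R.
Hypothesis lam_ge0 : 0 <= lam.
Hypothesis gap2 : spectral_gap marg2 lam.
Hypothesis gap1 : forall v, spectral_gap (marg3 v) lam.
Hypothesis gap0 : forall u v, spectral_gap (T u v) lam.

Lemma mixing_vertices e (h : pred V) (m := tsum (fun x _ _ _ => (h x)%:R)) :
  0 <= e -> m <= e * total4 ->
  tsum (fun x y _ _ => (h x)%:R * (h y)%:R) <= (lam + e) * m.
Proof.
move=> e0; rewrite /m tsum_marg1 tsum_marg2 => hm.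
by apply: (@mixing _ _ marg2) => // x y; exact: marg2_ge0.
Qed.

(** With P the mass of the edges inside the set, the boundary is 2 A - 2 P, and mixing gives P <= A
    / 2. *)
Lemma expansion0 (a : pred V) (A := tsum (fun x _ _ _ => (a x)%:R)) :
  lam <= 1 / 4 -> A <= 1 / 4 * total4 ->
  A <= tsum (fun x y _ _ => (a x (+) a y)%:R).
Proof.
move=> l1 hA; have A0 : 0 <= A by exact: tsum_ge0.
have := mixing_vertices (e := 1/4) ltac:(lra) hA; rewrite -/A.
set P := tsum _ => hP.
have -> : tsum (fun x y _ _ => (a x (+) a y)%:R) = A + A - 2 * P.
  have A2 : A = tsum (fun _ y _ _ => (a y)%:R) by rewrite /A tsum01.
  rewrite -tsumZ [X in _ + X - _]A2 -tsumD -tsumB; apply: eq_tsum => x y _ _.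
  by case: (a x); case: (a y) => /=; rewrite ?mulr1n ?mulr0n; lra.
nra.
Qed.

(** Around a thin cell the density is below [eta] and mixing wins; around a thick one only
    minimality bounds it, by 1/2. The Boolean [thick] merges both cases into one inequality that can
    be summed over cells. *)
Lemma local_pairs (I : finType) (w : I -> I -> R) (eta : R) (b : pred I)
    (m := \sum_x wdeg w x * (b x)%:R) (thick := eta * wtot w <= m) :
  (forall x y, 0 <= w x y) -> spectral_gap w lam ->
  0 <= eta -> m <= 1 / 2 * wtot w ->
  \sum_x \sum_y w x y * ((b x)%:R * (b y)%:R)
    <= (lam + eta) * m + 1 / 2 * (thick%:R * m).
Proof.
move=> w0 gap e0 hm; have m0 : 0 <= m.
  by apply: sumr_ge0 => x _; rewrite mulr_ge0 ?wdeg_ge0.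
case: (boolP thick) => [_|]; rewrite ?mul1r ?mul0r ?mulr0 ?addr0.
  by have := mixing w0 lam_ge0 (e := 1/2) ltac:(lra) gap hm; rewrite -/m; nra.
by rewrite -ltNge => /ltW /(mixing w0 lam_ge0 e0 gap).
Qed.

Lemma tsum_thick eta (b : V -> V -> bool)
    (h := fun v => eta * marg1 v <= \sum_x marg2 v x * (b v x)%:R) :
  eta * tsum (fun x _ _ _ => (h x)%:R)
    <= tsum (fun x y _ _ => (h x)%:R * (b x y)%:R).
Proof.
rewrite tsum_marg1 tsum_marg2 mulr_sumr; apply: ler_sum => v _.
have -> : \sum_y marg2 v y * ((h v)%:R * (b v y)%:R)
    = (h v)%:R * \sum_y marg2 v y * (b v y)%:R.
  by rewrite mulr_sumr; apply: eq_bigr => y _; rewrite mulrCA.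
case: (boolP (h v)) => hv; last by rewrite !mul0r !mulr0.
by rewrite mulr1 mul1r.
Qed.

(** Pairs of edges cost the factor 1/2 only at thick vertices. Since these are rarely adjacent, an
    edge of [a] mostly has at most one thick end, so [Y] is at most about A / 2 and 3 A - 6 P stays
    above A. *)
Lemma expansion1 (a : V -> V -> bool) (A := tsum (fun x y _ _ => (a x y)%:R)) :
  (forall x y, a x y = a y x) -> lam <= (1 / 100) ^+ 2 ->
  (forall v, \sum_x marg2 v x * (a v x)%:R <= 1 / 2 * marg1 v) ->
  A <= (1 / 100) ^+ 3 * total4 ->
  A <= tsum (fun x y z _ => (a x y (+) a x z (+) a y z)%:R).
Proof.
move=> asym l1 amin hA; have A0 : 0 <= A by exact: tsum_ge0.
pose eta : R := 1 / 100.
pose h v := eta * marg1 v <= \sum_x marg2 v x * (a v x)%:R.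
pose P := tsum (fun x y z _ => (a x y)%:R * (a x z)%:R).
pose Y := tsum (fun x y _ _ => (h x)%:R * (a x y)%:R).
have hP : P <= (lam + eta) * A + 1/2 * Y.
  rewrite /A /Y /P tsum_marg3 !tsum_marg2 !mulr_sumr -big_split.
  apply: ler_sum => v _ /=.
  have := local_pairs (w := marg3 v) (eta := eta) (b := a v) (marg3_ge0 v) (gap1 v)
    ltac:(rewrite /eta; lra) (amin v).
  move/le_trans; apply; rewrite lerD2l ler_wpM2l //; last first.
    rewrite mulr_sumr; apply: ler_sum => y _.
    by rewrite mulrCA.
  lra.
pose H := tsum (fun x _ _ _ => (h x)%:R).
have H0 : 0 <= H by exact: tsum_ge0.
have YA : Y <= A.
  by apply: tsum_le => x y _ _; case: (h x); rewrite ?mul1r ?mul0r.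
have HA : H <= 100 * A.
  have : eta * H <= Y := tsum_thick eta a; rewrite /eta; lra.
(* Thick vertices have mass at most 100 A, so the bound (1/100)^3 on the density of [a] leaves them
   density (1/100)^2. *)
have hH : H <= 1/100 * (1/100) * total4 by lra.
have HH := mixing_vertices (e := 1/100 * (1/100)) ltac:(lra) hH.
have Ysym : Y = tsum (fun x y _ _ => (h y)%:R * (a x y)%:R).
  by rewrite /Y tsum01; apply: eq_tsum => x y _ _; rewrite asym.
have h2Y : 2 * Y <= A + tsum (fun x y _ _ => (h x)%:R * (h y)%:R).
  have -> : 2 * Y = Y + Y by ring.
  rewrite {2}Ysym -!tsumD; apply: tsum_le => x y _ _.
  by case: (h x); case: (h y); case: (a x y) => /=; rewrite ?mulr1n ?mulr0n; lra.
(* On a triangle with k edges in [a], k - 2 C(k, 2) takes the values 0, 1, 0, -3 and never exceeds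
   the parity of k. *)
have hD : 3 * A - 6 * P <= tsum (fun x y z _ => (a x y (+) a x z (+) a y z)%:R).
  have -> : 3 * A = A + A + A by ring.
  have -> : 6 * P = 2 * P + 2 * P + 2 * P by ring.
  have P2 : P = tsum (fun x y z _ => (a x y)%:R * (a y z)%:R).
    by rewrite /P tsum01; apply: eq_tsum => x y z _; rewrite asym.
  have P3 : P = tsum (fun x y z _ => (a x z)%:R * (a y z)%:R).
    rewrite P2 tsum12; apply: eq_tsum => x y z _; by rewrite (asym y z).
  rewrite {2}P2 {2}P3 -!tsumZ.
  have A2 : A = tsum (fun x y z _ => (a x z)%:R) by rewrite /A tsum12.
  have A3 : A = tsum (fun x y z _ => (a y z)%:R) by rewrite A2 tsum01.
  rewrite {2}A2 {2}A3 -!tsumD -tsumB; apply: tsum_le => x y z _.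
  by case: (a x y); case: (a x z); case: (a y z) => /=; rewrite ?mulr1n ?mulr0n; lra.
rewrite -/H in HH.
apply: le_trans hD; rewrite /eta in hP; nra.
Qed.

Lemma marg2_sym x y : marg2 x y = marg2 y x.
Proof. by do 2! (apply: eq_bigr => ? _); rewrite T01. Qed.

Lemma marg3_sym x y z : marg3 x y z = marg3 y x z.
Proof. by apply: eq_bigr => ? _; rewrite T01. Qed.

(** Averages over the vertex placed first. The sums of [expansion2], which single out a vertex,
    become symmetric sums over a tetrahedron that can be compared pointwise. *)
Lemma tsum_rot4 F : 4 * tsum F =
  tsum (fun x y z t => F x y z t + F y x z t + F z x y t + F t x y z).
Proof.
rewrite !tsumD.
have h1 : tsum F = tsum (fun x y z t => F y x z t) by rewrite {1}tsum01.
have h2 : tsum F = tsum (fun x y z t => F z x y t) by rewrite h1 {1}tsum12.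
have h3 : tsum F = tsum (fun x y z t => F t x y z) by rewrite h2 {1}tsum23.
rewrite -h1 -h2 -h3; ring.
Qed.

Lemma tsum_rot3 F : 3 * tsum F =
  tsum (fun x y z t => F x y z t + F x z y t + F x t y z).
Proof.
rewrite !tsumD.
have h1 : tsum F = tsum (fun x y z t => F x z y t) by rewrite {1}tsum12.
have h2 : tsum F = tsum (fun x y z t => F x t y z) by rewrite h1 {1}tsum23.
rewrite -h1 -h2; ring.
Qed.

(* Pointwise form, on a tetrahedron, of the inequality
     A + 3 y - 6 P + Q / 2 - y / 24 <= 2 D - A / 72 + 24 EHH
   between the sums of expansion2, a_i being the triangle opposite to the vertex i and h_i the
   indicator of thickness. The case of two triangles sharing a thick vertex is
   the tight one; it is saved by the term y / 24 = (1 / 2) (1 / 12) y coming from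
   the expansion 1/12 of the vertex links. *)
Lemma tetrahedron_count (a0 a1 a2 a3 h0 h1 h2 h3 : bool) :
  let SA := a0%:R + a1%:R + a2%:R + a3%:R : R in
  let Sy := h0%:R * (a1%:R + a2%:R + a3%:R) + h1%:R * (a0%:R + a2%:R + a3%:R)
          + h2%:R * (a0%:R + a1%:R + a3%:R) + h3%:R * (a0%:R + a1%:R + a2%:R) : R in
  let SP := a0%:R * a1%:R + a0%:R * a2%:R + a0%:R * a3%:R
          + a1%:R * a2%:R + a1%:R * a3%:R + a2%:R * a3%:R : R in
  let SQ := h0%:R * (a1 (+) a2 (+) a3)%:R + h1%:R * (a0 (+) a2 (+) a3)%:R
          + h2%:R * (a0 (+) a1 (+) a3)%:R + h3%:R * (a0 (+) a1 (+) a2)%:R : R in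
  let SH := h0%:R * h1%:R + h0%:R * h2%:R + h0%:R * h3%:R
          + h1%:R * h2%:R + h1%:R * h3%:R + h2%:R * h3%:R : R in
  1/4 * SA + 1/4 * Sy - SP + 1/8 * SQ - 1/288 * Sy
    <= 2 * (a0 (+) a1 (+) a2 (+) a3)%:R - 1/288 * SA + 4 * SH.
Proof.
case: a0; case: a1; case: a2; case: a3; case: h0; case: h1; case: h2; case: h3 => /=;
  rewrite ?(mulr1n, mulr0n); lra.
Qed.

(** One thick edge is paid for by the triangle itself; with more of them, any two meet in a vertex
    that is either thick (middle term) or thin (last term, estimated by mixing in its link). *)
Lemma triangle_count (a h01 h02 h12 H0 H1 H2 : bool) :
  (h01%:R + h02%:R + h12%:R) * a%:R <= a%:R + (H0%:R + H1%:R + H2%:R) * a%:R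
    + ((~~ H0)%:R * (h01%:R * h02%:R) + (~~ H1)%:R * (h01%:R * h12%:R)
      + (~~ H2)%:R * (h02%:R * h12%:R)) :> R.
Proof.
case: h01; case: h02; case: h12; case: H0; case: H1; case: H2; case: a => /=;
  rewrite ?(mulr1n, mulr0n); lra.
Qed.

Lemma tsum_tetrahedron_count (fA fy fP fQ fD fH : V -> V -> V -> V -> R) :
  (forall x y z t, 1/4 * fA x y z t + 1/4 * fy x y z t - fP x y z t
     + 1/8 * fQ x y z t - 1/288 * fy x y z t
     <= 2 * fD x y z t - 1/288 * fA x y z t + 4 * fH x y z t) ->
  1/4 * tsum fA + 1/4 * tsum fy - tsum fP + 1/8 * tsum fQ - 1/288 * tsum fy
     <= 2 * tsum fD - 1/288 * tsum fA + 4 * tsum fH.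
Proof.
move=> /tsum_le; apply: etrans; congr (_ <= _).
  by rewrite tsumB tsumD tsumB tsumD !tsumZ.
by rewrite tsumD tsumB !tsumZ.
Qed.

(** The quantity A + 3 y - 6 P is squeezed: [tetrahedron_count] bounds it above by the coboundary,
    while 6 P is at most about 3 Y and 3 Y <= A + 3 y + 3 B by [triangle_count], so it is at least
    -O(eta) A. The margin is the term A / 72. *)
Lemma expansion2 (a : V -> V -> V -> bool)
    (A := tsum (fun x y z _ => (a x y z)%:R)) (eta := (1 / 100) * (1 / 20) : R) :
  (forall x y z, a x y z = a y x z) -> (forall x y z, a x y z = a x z y) ->
  lam <= eta ^+ 5 ->
  (forall u v, \sum_z marg3 u v z * (a u v z)%:R <= 1 / 2 * marg2 u v) ->
  (forall v, \sum_x \sum_y marg3 v x y * (a v x y)%:R <=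
     12 * \sum_x \sum_y \sum_z T v x y z * (a v x y (+) a v x z (+) a v y z)%:R) ->
  A <= eta ^+ 8 * total4 ->
  1 / 1000 * A <=
    tsum (fun x y z t => (a x y z (+) a x y t (+) a x z t (+) a y z t)%:R).
Proof.
move=> as1 as2 lam_le amin acob hA.
have eta0 : 0 < eta by rewrite /eta; lra.
have eta_le : eta <= 1 / 100 * (1/20) by [].
have A0 : 0 <= A by exact: tsum_ge0.
(* A thick edge has density eta of triangles and a thick vertex density eta^2 of thick edges, hence
   EH <= eta^-3 A. With lam <= eta^5 and A <= eta^8 [total4], mixing then gives EHH <= 2 eta^2 A and
   B <= 2 eta A. *)
pose eta' := eta ^+ 2.
pose h u v := eta * marg2 u v <= \sum_z marg3 u v z * (a u v z)%:R.
pose H v := eta' * marg1 v <= \sum_x marg2 v x * (h v x)%:R.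
have hsym u v : h u v = h v u.
  rewrite /h marg2_sym; congr (_ <= _).
  by apply: eq_bigr => z _; rewrite marg3_sym as1.
pose Y := tsum (fun x y z _ => (h x y)%:R * (a x y z)%:R).
pose y := tsum (fun x y z _ => (H x)%:R * (a x y z)%:R).
pose P := tsum (fun x y z t => (a x y z)%:R * (a x y t)%:R).
pose Eh := tsum (fun x y _ _ => (h x y)%:R).
pose EH := tsum (fun x _ _ _ => (H x)%:R).
pose EHH := tsum (fun x y _ _ => (H x)%:R * (H y)%:R).
pose B := tsum (fun x y z _ => (~~ H x)%:R * ((h x y)%:R * (h x z)%:R)).
pose Q := tsum (fun x y z t => (H x)%:R * (a x y z (+) a x y t (+) a x z t)%:R).
have Eh0 : 0 <= Eh by exact: tsum_ge0.
have EH0 : 0 <= EH by exact: tsum_ge0.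
have hP : P <= (lam + eta) * A + 1/2 * Y.
  rewrite /A /Y !tsum_marg3 !mulr_sumr -big_split; apply: ler_sum => u _ /=.
  rewrite !mulr_sumr -big_split; apply: ler_sum => v _ /=.
  have := local_pairs (w := T u v) (eta := eta) (b := a u v) (T_ge0 u v) (gap0 u v)
    (ltW eta0) (amin u v).
  move/le_trans; apply; rewrite lerD2l ler_wpM2l //; last first.
    rewrite mulr_sumr; apply: ler_sum => z _.
    by rewrite mulrCA.
  lra.
have YA : Y <= A.
  by apply: tsum_le => u v z _; case: (h u v); rewrite ?mul1r ?mul0r.
have EhY : eta * Eh <= Y.
  rewrite /Eh tsum_marg2 /Y tsum_marg3 mulr_sumr; apply: ler_sum => u _.
  rewrite mulr_sumr; apply: ler_sum => v _.
  have -> : \sum_z marg3 u v z * ((h u v)%:R * (a u v z)%:R)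
      = (h u v)%:R * \sum_z marg3 u v z * (a u v z)%:R.
    by rewrite mulr_sumr; apply: eq_bigr => z _; rewrite mulrCA.
  case: (boolP (h u v)) => huv; last by rewrite !mul0r !mulr0.
  by rewrite mulr1 mul1r.
have EHEh : eta' * EH <= Eh.
  apply: le_trans (_ : _ <= tsum (fun x y _ _ => (H x)%:R * (h x y)%:R)) _.
    exact: tsum_thick.
  by apply: tsum_le => u v _ _; case: (H u); rewrite ?mul1r ?mul0r.
have EhA : Eh <= eta^-1 * A.
  by rewrite mulrC ler_pdivlMr // mulrC; lra.
have EHA : EH <= eta^-1 ^+ 3 * A.
  have e2 : 0 < eta' by rewrite exprn_gt0.
  have : EH <= eta'^-1 * Eh by rewrite mulrC ler_pdivlMr // mulrC.
  move/le_trans; apply; rewrite exprS -mulrA exprVn -/eta' mulrCA.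
  by rewrite ler_wpM2l // invr_ge0 ltW.
have e5 : eta^-1 ^+ 3 * eta ^+ 5 = eta ^+ 2 by field; rewrite gt_eqF.
have e8 : eta^-1 ^+ 3 * eta ^+ 8 = eta ^+ 5 by field; rewrite gt_eqF.
have hEHH : EHH <= 2 * eta ^+ 2 * A.
  have hEH : EH <= eta ^+ 5 * total4.
    apply: le_trans EHA _; rewrite -e8 -[X in _ <= X]mulrA ler_wpM2l //.
    by rewrite exprn_ge0 // invr_ge0 ltW.
  have e50 : 0 <= eta ^+ 5 by rewrite exprn_ge0 // ltW.
  apply: le_trans (mixing_vertices e50 hEH) _; rewrite -/EH.
  apply: le_trans (_ : (2 * eta ^+ 5) * (eta^-1 ^+ 3 * A) <= _).
    apply: ler_pM => //; first by rewrite addr_ge0.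
    lra.
  by rewrite -e5; lra.
have hB : B <= 2 * eta * A.
  have : B <= (lam + eta') * Eh.
    rewrite /Eh tsum_marg2 /B tsum_marg3 mulr_sumr; apply: ler_sum => v _.
    have -> : \sum_x \sum_z marg3 v x z * ((~~ H v)%:R * ((h v x)%:R * (h v z)%:R))
       = (~~ H v)%:R * \sum_x \sum_z marg3 v x z * ((h v x)%:R * (h v z)%:R).
      rewrite mulr_sumr; apply: eq_bigr => x _; rewrite mulr_sumr.
      by apply: eq_bigr => z _; rewrite mulrCA.
    have m0 : 0 <= \sum_x marg2 v x * (h v x)%:R.
      by apply: sumr_ge0 => x _; rewrite mulr_ge0 ?marg2_ge0.
    have l0 : 0 <= lam + eta' by rewrite addr_ge0 // exprn_ge0 // ltW.
    case: (boolP (H v)) => /= Hv; first by rewrite mul0r mulr_ge0.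
    rewrite mul1r; apply: (mixing (w := marg3 v)) => //; first exact: marg3_ge0.
      by rewrite exprn_ge0 // ltW.
    by move: Hv; rewrite -ltNge => /ltW.
  move/le_trans; apply.
  apply: le_trans (_ : (2 * eta ^+ 2) * (eta^-1 * A) <= _); last first.
    by rewrite mulrA -[_ * _ * eta^-1]mulrA expr2 mulfK ?gt_eqF.
  apply: ler_pM => //; first by rewrite addr_ge0 // exprn_ge0 // ltW.
  have e3 : eta ^+ 3 <= 1 by rewrite exprn_ile1 // ?ltW //; lra.
  have : eta ^+ 5 <= eta ^+ 2.
    by rewrite -[5%N]/(2 + 3)%N exprD ler_piMr // exprn_ge0 // ltW.
  by rewrite /eta'; lra.
have hY : 3 * Y <= A + 3 * y + 3 * B.
  have -> : 3 * Y = tsum (fun x y z t => ((h x y)%:R + (h x z)%:R + (h y z)%:R) * (a x y z)%:R).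
    have Y2 : Y = tsum (fun x y z _ => (h x z)%:R * (a x y z)%:R).
      by rewrite /Y tsum12; apply: eq_tsum => u v w _; rewrite as2.
    have Y3 : Y = tsum (fun x y z _ => (h y z)%:R * (a x y z)%:R).
      by rewrite Y2 tsum01; apply: eq_tsum => u v w _; rewrite as1.
    have -> : 3 * Y = Y + Y + Y by ring.
    rewrite [X in _ + X + _]Y2 [X in _ + X]Y3 -!tsumD.
    by apply: eq_tsum => u v w _; ring.
  have -> : 3 * y = tsum (fun x y z t => ((H x)%:R + (H y)%:R + (H z)%:R) * (a x y z)%:R).
    have y2 : y = tsum (fun x y z _ => (H y)%:R * (a x y z)%:R).
      by rewrite /y tsum01; apply: eq_tsum => u v w _; rewrite as1.
    have y3 : y = tsum (fun x y z _ => (H z)%:R * (a x y z)%:R).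
      by rewrite y2 tsum12; apply: eq_tsum => u v w _; rewrite as2.
    have -> : 3 * y = y + y + y by ring.
    rewrite [X in _ + X + _]y2 [X in _ + X]y3 -!tsumD.
    by apply: eq_tsum => u v w _; ring.
  have -> : 3 * B = tsum (fun x y z t => (~~ H x)%:R * ((h x y)%:R * (h x z)%:R)
      + (~~ H y)%:R * ((h x y)%:R * (h y z)%:R) + (~~ H z)%:R * ((h x z)%:R * (h y z)%:R)).
    have B2 : B = tsum (fun x y z _ => (~~ H y)%:R * ((h x y)%:R * (h y z)%:R)).
      by rewrite /B tsum01; apply: eq_tsum => u v w _; rewrite (hsym v u).
    have B3 : B = tsum (fun x y z _ => (~~ H z)%:R * ((h x z)%:R * (h y z)%:R)).
      by rewrite B2 tsum12; apply: eq_tsum => u v w _; rewrite (hsym w v).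
    have -> : 3 * B = B + B + B by ring.
    rewrite [X in _ + X + _]B2 [X in _ + X]B3 -!tsumD.
    by apply: eq_tsum => u v w _; ring.
  rewrite /A -!tsumD; apply: tsum_le => u v w _.
  exact: triangle_count.
(* The link expansion [acob], multiplied by the indicator of thick vertices. It turns the term Q / 2
   of the count into at least y / 24. *)
have hQ : y <= 12 * Q.
  rewrite /y tsum_marg3 /Q /tsum mulr_sumr; apply: ler_sum => v _.
  have -> : \sum_x \sum_z marg3 v x z * ((H v)%:R * (a v x z)%:R)
      = (H v)%:R * \sum_x \sum_z marg3 v x z * (a v x z)%:R.
    rewrite mulr_sumr; apply: eq_bigr => x _; rewrite mulr_sumr.
    by apply: eq_bigr => z _; rewrite mulrCA.
  have -> : \sum_x \sum_z \sum_t T v x z t * ((H v)%:R * (a v x z (+) a v x t (+) a v z t)%:R)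
      = (H v)%:R * \sum_x \sum_z \sum_t T v x z t * (a v x z (+) a v x t (+) a v z t)%:R.
    rewrite mulr_sumr; apply: eq_bigr => x _; rewrite mulr_sumr.
    apply: eq_bigr => z _; rewrite mulr_sumr; by apply: eq_bigr => t _; rewrite mulrCA.
  by rewrite mulrCA ler_wpM2l.
set D := tsum (fun x y z t => (a x y z (+) a x y t (+) a x z t (+) a y z t)%:R).
have A4 : 4 * A = tsum (fun x y z t => (a y z t)%:R + (a x z t)%:R + (a x y t)%:R + (a x y z)%:R).
  have -> : A = tsum (fun x y z t => (a y z t)%:R).
    by rewrite /A [LHS]tsum23 [LHS]tsum12 [LHS]tsum01.
  by rewrite tsum_rot4.
have y12 : 4 * (3 * y) = tsum (fun x y z t =>
      (H x)%:R * ((a x z t)%:R + (a x y t)%:R + (a x y z)%:R)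
    + (H y)%:R * ((a y z t)%:R + (a x y t)%:R + (a x y z)%:R)
    + (H z)%:R * ((a y z t)%:R + (a x z t)%:R + (a x y z)%:R)
    + (H t)%:R * ((a y z t)%:R + (a x z t)%:R + (a x y t)%:R)).
  have -> : 3 * y = tsum (fun x y z t => (H x)%:R * ((a x z t)%:R + (a x y t)%:R + (a x y z)%:R)).
    have e1 : y = tsum (fun x y z t => (H x)%:R * (a x y t)%:R) by rewrite /y [LHS]tsum23.
    have e2 : y = tsum (fun x y z t => (H x)%:R * (a x z t)%:R) by rewrite e1 [LHS]tsum12.
    have -> : 3 * y = y + y + y by ring.
    rewrite [X in _ + X + _]e1 [X in _ + X]e2 -!tsumD.
    by apply: eq_tsum => u v w t; ring.
  rewrite tsum_rot4; apply: eq_tsum => u v w t.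
  (* Brings the arguments of every [a] into the order u, v, w, t, so that the two sides can be
     matched term by term. *)
  have canon1 := (as1 v u, as1 w u, as1 t u, as1 w v, as1 t v, as1 t w).
  have canon2 := (as2 w v u, as2 t v u, as2 v w u, as2 t w u, as2 v t u, as2 w t u, as2 u w v, as2 t w v, as2 u t v, as2 w t v, as2 u t w, as2 v t w).
  rewrite ?canon1 ?canon2 ?canon1.
  by [].
have P12 : 4 * (3 * P) = tsum (fun x y z t =>
   2 * ((a y z t)%:R * (a x z t)%:R + (a y z t)%:R * (a x y t)%:R + (a y z t)%:R * (a x y z)%:R
     + (a x z t)%:R * (a x y t)%:R + (a x z t)%:R * (a x y z)%:R + (a x y t)%:R * (a x y z)%:R)).
  rewrite tsum_rot3 tsum_rot4; apply: eq_tsum => u v w t.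
  have canon1 := (as1 v u, as1 w u, as1 t u, as1 w v, as1 t v, as1 t w).
  have canon2 := (as2 w v u, as2 t v u, as2 v w u, as2 t w u, as2 v t u, as2 w t u, as2 u w v, as2 t w v, as2 u t v, as2 w t v, as2 u t w, as2 v t w).
  rewrite ?canon1 ?canon2 ?canon1.
  ring.
have Q4 : 4 * Q = tsum (fun x y z t => (H x)%:R * (a x z t (+) a x y t (+) a x y z)%:R
    + (H y)%:R * (a y z t (+) a x y t (+) a x y z)%:R
    + (H z)%:R * (a y z t (+) a x z t (+) a x y z)%:R
    + (H t)%:R * (a y z t (+) a x z t (+) a x y t)%:R).
  rewrite tsum_rot4; apply: eq_tsum => u v w t.
  have canon1 := (as1 v u, as1 w u, as1 t u, as1 w v, as1 t v, as1 t w).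
  have canon2 := (as2 w v u, as2 t v u, as2 v w u, as2 t w u, as2 v t u, as2 w t u, as2 u w v, as2 t w v, as2 u t v, as2 w t v, as2 u t w, as2 v t w).
  rewrite ?canon1 ?canon2 ?canon1.
  by case: (a u v w); case: (a u v t); case: (a u w t); case: (a v w t).
have H12 : 4 * (3 * EHH) = tsum (fun x y z t => 2 * ((H x)%:R * (H y)%:R + (H x)%:R * (H z)%:R
    + (H x)%:R * (H t)%:R + (H y)%:R * (H z)%:R + (H y)%:R * (H t)%:R + (H z)%:R * (H t)%:R)).
  rewrite tsum_rot3 tsum_rot4; apply: eq_tsum => u v w t.
  ring.
have := tsum_tetrahedron_count (fun x y z t =>
  tetrahedron_count (a y z t) (a x z t) (a x y t) (a x y z) (H x) (H y) (H z) (H t)).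
rewrite tsumZ in P12; rewrite tsumZ in H12.
rewrite -A4 -y12 -Q4.
set SP := tsum _ in P12 *; set SH := tsum _ in H12 *.
have -> : tsum (fun x y z t => (a y z t (+) a x z t (+) a x y t (+) a x y z)%:R) = D.
  apply: eq_tsum => x1 y1 z t; congr (_%:R).
  by case: (a x1 y1 z); case: (a x1 y1 t); case: (a x1 z t); case: (a y1 z t).
have e52 : eta ^+ 5 <= eta * eta.
  by rewrite -expr2 -[5%N]/(2 + 3)%N exprD ler_piMr ?exprn_ge0 ?exprn_ile1 // ?ltW //; lra.
have hlam : (lam + eta) * A <= 6 / 100 * (1 / 100) * A.
  rewrite ler_wpM2r //; apply: le_trans (_ : eta * eta + eta <= _); first lra.
  by rewrite /eta; lra.
have hB2 : B <= 1 / 100 * (1 / 10) * A.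
  by apply: le_trans hB _; rewrite ler_wpM2r // /eta; lra.
have hH2 : EHH <= 1 / 100 * (1 / 100) * A.
  by apply: le_trans hEHH _; rewrite ler_wpM2r // expr2 /eta; lra.
(* With SP = 6 P, SH = 6 EHH and y <= 12 Q there remains 2 D >= A / 72 - 6 (lam + eta) A - 3 B - 24
   EHH. The errors total at most 9/1000 A, which leaves more than 2/1000 A. *)
move: A0 hP hY hQ P12 H12 hlam hB2 hH2.
clearbody A Y y P B Q D SP SH EHH; clear; clearbody eta; move: (lam + eta) => le.
lra.
Qed.

End Expansion.

(** * Cochain norms as sums over ordered cells *)

Section CellSums.
Variables (R : realType) (V : finType).
Implicit Types (Y : {set {set V}}) (s t : {set V}) (d k : nat).

(** Double counting of the pairs (s, x) with x in s. Iterated, it yields the factorials 2, 6, 24 by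
    which ordered cells outnumber cells. *)
Lemma sum_set_ext k (G : {set V} -> R) :
  \sum_x \sum_(s : {set V} | (#|s| == k) && (x \notin s)) G (x |: s)%SET
    = k.+1%:R * \sum_(s : {set V} | #|s| == k.+1) G s.
Proof.
transitivity (\sum_x \sum_(s : {set V} | (#|s| == k.+1) && (x \in s)) G s).
  apply: eq_bigr => x _; apply/esym.
  rewrite (reindex_onto (fun s : {set V} => x |: s)%SET (fun s => s :\ x)%SET) /=; last first.
    by move=> s /andP[_ xs]; rewrite setD1K.
  apply: eq_bigl => s; rewrite setU11 andbT cardsU1.
  case: (boolP (x \in s)) => xs /=.
    by rewrite (setUidPr _) ?sub1set // andbF; apply/andP => -[_ /eqP e]; move: xs; rewrite -e !inE eqxx.
  by rewrite setU1K // eqxx !andbT add1n eqSS.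
rewrite (exchange_big_dep (fun s : {set V} => #|s| == k.+1)) /= => [|x s _ /andP[]//].
rewrite mulr_sumr; apply: eq_bigr => s /eqP cs.
under eq_bigl do rewrite cs eqxx.
by rewrite sumr_const cs mulr_natl.
Qed.

Lemma sum_sets1 (G : {set V} -> R) : \sum_x G [set x]%SET = \sum_(s : {set V} | #|s| == 1%N) G s.
Proof.
rewrite -[RHS]mul1r -(sum_set_ext 0); apply: eq_bigr => x _.
rewrite (big_pred1 finset.set0) ?setU0 // => s; rewrite cards_eq0.
by case: eqVneq => [->|/negPf] /=; rewrite ?in_set0 ?eqxx //= => ->.
Qed.

Lemma sum_sets2 (G : {set V} -> R) :
  \sum_x \sum_y (if x != y then G [set x; y]%SET else 0) = 2 * \sum_(s : {set V} | #|s| == 2%N) G s.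
Proof.
rewrite -sum_set_ext; apply: eq_bigr => x _.
transitivity (\sum_y (if x \notin [set y]%SET then G (x |: [set y])%SET else 0)).
  by apply: eq_bigr => y _; rewrite inE.
by rewrite (sum_sets1 (fun s => if x \notin s then G (x |: s)%SET else 0)) -big_mkcondr.
Qed.

Lemma sum_sets3 (G : {set V} -> R) :
  \sum_x \sum_y \sum_z (if uniq [:: x; y; z] then G [set x; y; z]%SET else 0)
    = 6 * \sum_(s : {set V} | #|s| == 3%N) G s.
Proof.
have -> : 6 = 2 * 3%:R :> R by rewrite -natrM.
rewrite -mulrA -sum_set_ext mulr_sumr; apply: eq_bigr => x _.
transitivity (\sum_y \sum_z (if y != z then
   (if x \notin [set y; z]%SET then G (x |: [set y; z])%SET else 0) else 0)).
  apply: eq_bigr => y _; apply: eq_bigr => z _; rewrite /= !inE setUA.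
  by case: (x == y); case: (x == z); case: (y == z).
by rewrite (sum_sets2 (fun s => if x \notin s then G (x |: s)%SET else 0)) big_mkcondr.
Qed.

Lemma sum_sets4 (G : {set V} -> R) :
  \sum_x \sum_y \sum_z \sum_t (if uniq [:: x; y; z; t] then G [set x; y; z; t]%SET else 0)
    = 24 * \sum_(s : {set V} | #|s| == 4%N) G s.
Proof.
have -> : 24 = 6 * 4%:R :> R by rewrite -natrM.
rewrite -mulrA -sum_set_ext mulr_sumr; apply: eq_bigr => x _.
transitivity (\sum_y \sum_z \sum_t (if uniq [:: y; z; t] then
   (if x \notin [set y; z; t]%SET then G (x |: [set y; z; t])%SET else 0) else 0)).
  apply: eq_bigr => y _; apply: eq_bigr => z _; apply: eq_bigr => t _.
  rewrite /= !inE !setUA !negb_or.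
  by case: (x == y); case: (x == z); case: (x == t); case: (y == z); case: (y == t); case: (z == t).
by rewrite (sum_sets3 (fun s => if x \notin s then G (x |: s)%SET else 0)) big_mkcondr.
Qed.

(** Every top cell over [s] has d + 1 - k vertices outside [s]. This is why the cell weights are
    marginals of one another. *)
Lemma ccount_ext Y d s k : #|s| = k ->
  \sum_(x | x \notin s) (ccount Y d (x |: s)%SET)%:R = (d.+1 - k)%N%:R * (ccount Y d s)%:R :> R.
Proof.
move=> cs.
have cE r : (ccount Y d r)%:R = \sum_(t in cells Y d.+1 | r \subset t) 1 :> R.
  by rewrite /ccount -sum1_card natr_sum; apply: eq_bigl => t; rewrite !inE.
rewrite (eq_bigr _ (fun x _ => cE _)) cE mulr_sumr.
rewrite (exchange_big_dep (fun t => (t \in cells Y d.+1) && (s \subset t))) /=; last first.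
  by move=> x t _ /andP[-> ]; rewrite subUset => /andP[].
apply: eq_bigr => t /andP[tY st].
transitivity (\sum_(x in t :\: s) 1 : R).
  by apply: eq_bigl => x; rewrite in_setD subUset st sub1set tY andbT.
rewrite sumr_const mulr1 cardsD (setIidPr st) cs.
by move: tY; rewrite inE => /andP[_ /eqP ->].
Qed.

Variables (Y : {set {set V}}) (d : nat).
Hypothesis Ydown : forall s t, s \in Y -> t \subset s -> t \in Y.

(** Clears the denominator of the norm. Closure under faces makes [ccount] vanish off the complex,
    so the sum may run over all sets; when the denominator is 0, all counts are 0 too. *)
Lemma cnormE k (a : {ffun {set V} -> 'F_2}) :
  ('C(d.+1, k) * #|cells Y d.+1|)%N%:R * cnorm R Y d k a
   = \sum_(s : {set V} | #|s| == k) (ccount Y d s)%:R * (a s != 0)%:R.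
Proof.
have c0 s : s \notin Y -> ccount Y d s = 0%N.
  move=> sY; apply: eq_card0 => t; rewrite !inE; apply/negP => /andP[/andP[tY _] st].
  by move: sY; rewrite (Ydown tY st).
set n := (_ * _)%N.
have [n0|n0] := eqVneq n 0%N.
  rewrite n0 mul0r; apply/esym; apply: big1 => s /eqP cs.
  move/eqP: n0; rewrite muln_eq0 => /orP[|].
    rewrite eqn0Ngt bin_gt0 -ltnNge => kd.
    rewrite (_ : ccount Y d s = 0%N) ?mul0r //; apply: eq_card0 => t; rewrite !inE.
    apply/negP => /andP[/andP[_ /eqP ct] /subset_leq_card]; rewrite ct cs; lia.
  move=> /eqP c; rewrite (_ : ccount Y d s = 0%N) ?mul0r //; apply/eqP.
  by rewrite -leqn0 -c; apply: subset_leq_card; apply/fintype.subsetP => t; rewrite !inE => /andP[].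
rewrite /cnorm mulr_sumr [LHS]big_mkcond [RHS]big_mkcond; apply: eq_bigr => s _.
rewrite inE; have [sY|sY] /= := boolP (s \in Y); last first.
  by rewrite c0 // mul0r; case: ifP.
case: eqP => [cs|] //=; case: (a s != 0) => /=; last by rewrite mulr0.
by rewrite mulr1 /weight cs -/n mulrC divfK // pnatr_eq0.
Qed.

End CellSums.

(** Passage to Booleans: a cochain is replaced by its support, and addition in F_2 by exclusive
    or. *)
Lemma F2_add_neq0 (x y : 'F_2) : (x + y != 0) = (x != 0) (+) (y != 0).
Proof. by case: x y => -[|[|//]] ? [[|[|//]] ?]. Qed.

Section Down.
Variables (R : realType) (V : finType) (Y : {set {set V}}).
Hypothesis Ydown : forall s t : {set V}, s \in Y -> t \subset s -> t \in Y.
Implicit Types (a : {ffun {set V} -> 'F_2}) (s : {set V}).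

Lemma coboundaryE k a s : s \in cells Y k.+1 ->
  coboundary Y k a s = \sum_(x in s) a (s :\ x)%SET.
Proof.
move=> sY; rewrite ffunE sY; move: sY; rewrite inE => /andP[sY /eqP cs].
have inj : {in s &, injective (fun x => s :\ x)}%SET.
  move=> x y xs ys /setP/(_ x); rewrite !inE eqxx xs andbT /=.
  by case: (eqVneq x y).
rewrite -(big_imset (fun t => a t) inj) /=; apply: eq_bigl => t; rewrite inE.
apply/idP/imsetP => [/andP[/andP[tY /eqP ct] ts]|[x xs ->]].
  have /cards1P[x xE] : #|s :\: t| == 1%N by rewrite cardsD (setIidPr ts) cs ct subSnn.
  have xs : x \in s by have := set11 x; rewrite -xE inE => /andP[].
  have := set11 x; rewrite -xE inE => /andP[xt _].
  exists x => //; apply/eqP; rewrite eqEcard subsetD1 ts xt ct /=.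
  by move: cs; rewrite (cardsD1 x s) xs add1n => -[->].
by rewrite (Ydown sY (subD1set _ _)) subD1set andbT /=; move: cs; rewrite (cardsD1 x s) xs add1n => -[->].
Qed.

Lemma cobound1 a x y : x != y -> [set x; y]%SET \in Y ->
  coboundary Y 1 a [set x; y]%SET = a [set y]%SET + a [set x]%SET.
Proof.
move=> xy sY; rewrite coboundaryE; last by rewrite inE sY cards2 xy.
rewrite big_setU1 ?inE //= big_set1.
have -> : [set x; y] :\ x = [set y].
  by apply/setP => w; rewrite !inE; case: (eqVneq w x) => [->|]; rewrite ?(negPf xy).
have -> : [set x; y] :\ y = [set x].
  by apply/setP => w; rewrite !inE; case: (eqVneq w y) => [->|]; rewrite ?orbF // eq_sym (negPf xy).
by [].
Qed.

Lemma cobound2 a x y z : uniq [:: x; y; z] -> [set x; y; z]%SET \in Y ->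
  coboundary Y 2 a [set x; y; z]%SET
    = a [set y; z]%SET + a [set x; z]%SET + a [set x; y]%SET.
Proof.
rewrite /= !inE negb_or andbT => /andP[/andP[xy xz] yz] sY.
have c3 : #|[set x; y; z]| = 3%N by rewrite -setUA !cardsU1 cards1 !inE negb_or xy xz yz.
rewrite coboundaryE; last by rewrite inE sY c3.
have d w : (w \in [set x; y; z]) = (w \in x |: (y |: [set z])) by rewrite !inE orbA.
rewrite (eq_bigl _ _ d) !big_setU1 ?inE ?negb_or ?xy ?xz ?yz //= big_set1 addrA.
congr (_ + _ + _); congr (a _); apply/setP => w; rewrite !inE.
- case: (eqVneq w x) => [->|//]; by rewrite (negPf xy) (negPf xz).
- case: (eqVneq w y) => [->|]; last by rewrite orbF.
  by rewrite eq_sym (negPf xy) (negPf yz).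
- case: (eqVneq w z) => [->|]; last by rewrite orbF.
  by rewrite eq_sym (negPf xz) eq_sym (negPf yz).
Qed.

Lemma cobound3 a x y z t : uniq [:: x; y; z; t] -> [set x; y; z; t]%SET \in Y ->
  coboundary Y 3 a [set x; y; z; t]%SET
    = a [set y; z; t]%SET + a [set x; z; t]%SET + a [set x; y; t]%SET + a [set x; y; z]%SET.
Proof.
rewrite /= !inE !negb_or andbT => /and3P[/and3P[xy xz xt] /andP[yz yt] zt] sY.
have c4 : #|[set x; y; z; t]| = 4%N.
  by rewrite -!setUA !cardsU1 cards1 !inE !negb_or xy xz yz xt yt zt.
rewrite coboundaryE; last by rewrite inE sY c4.
have d w : (w \in [set x; y; z; t]) = (w \in x |: (y |: (z |: [set t]))).
  by rewrite !inE -!orbA.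
rewrite (eq_bigl _ _ d) !big_setU1 ?inE ?negb_or ?xy ?xz ?yz ?xt ?yt ?zt //= big_set1 !addrA.
congr (_ + _ + _ + _); congr (a _); apply/setP => w; rewrite !inE.
- case: (eqVneq w x) => [->|//]; by rewrite (negPf xy) (negPf xz) (negPf xt).
- case: (eqVneq w y) => [->|]; last by rewrite orbF.
  by rewrite [y == x]eq_sym (negPf xy) (negPf yz) (negPf yt).
- case: (eqVneq w z) => [->|]; last by rewrite orbF.
  by rewrite [z == x]eq_sym (negPf xz) [z == y]eq_sym (negPf yz) (negPf zt).
- case: (eqVneq w t) => [->|]; last by rewrite orbF.
  by rewrite [t == x]eq_sym (negPf xt) [t == y]eq_sym (negPf yt) [t == z]eq_sym (negPf zt).
Qed.

(** Weight of ordered triangles, for the two-dimensional vertex links. *)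
Definition cell3w x y z : R := (uniq [:: x; y; z] && ([set x; y; z]%SET \in Y))%:R.

Lemma ccount_top d s : #|s| = d.+1 -> ccount Y d s = (s \in Y).
Proof.
move=> cs; rewrite /ccount; case: (boolP (s \in Y)) => sY.
  transitivity #|[set s]|; last exact: cards1.
  apply: eq_card => t; rewrite !inE; apply/andP/eqP => [[/andP[_ /eqP ct] st]|->].
    by apply/esym/eqP; rewrite eqEcard st ct cs leqnn.
  by rewrite sY cs eqxx.
apply: eq_card0 => t; rewrite !inE; apply/negP => /andP[/andP[tY _] st].
by move: sY; rewrite (Ydown tY st).
Qed.

Lemma cell3w_marg2 x y : \sum_z cell3w x y z
   = if x != y then (ccount Y 2 [set x; y])%:R else 0.
Proof.
rewrite /cell3w; case: (boolP (x != y)) => xy; last first.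
  by rewrite big1 // => z _; rewrite /= inE negb_or (negPf xy).
have c2 : #|[set x; y]| = 2%N by rewrite cards2 xy.
have := ccount_ext R Y 2 c2; rewrite mul1r => <-.
rewrite [RHS]big_mkcond; apply: eq_bigr => z _.
rewrite /= !inE !negb_or xy /= andbT !(eq_sym _ z) -negb_or.
case: ifP => zn //; have c3 : #|z |: [set x; y]| = 3%N by rewrite cardsU1 c2 !inE zn.
by rewrite (ccount_top c3) setUC.
Qed.

Lemma cell3w_marg1 x : \sum_y \sum_z cell3w x y z = 2 * (ccount Y 2 [set x])%:R.
Proof.
under eq_bigr do rewrite cell3w_marg2.
rewrite -(ccount_ext R Y 2 (cards1 x)) [RHS]big_mkcond; apply: eq_bigr => y _.
by rewrite inE eq_sym setUC.
Qed.

Lemma cell3w_cnorm1 a : (6 * #|cells Y 3|)%N%:R * cnorm R Y 2 1 a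
  = \sum_x \sum_y \sum_z cell3w x y z * (a [set x] != 0)%:R.
Proof.
have := cnormE R 2 Ydown 1 a; rewrite bin1 => e.
rewrite -[6%N]/(2 * 3)%N -mulnA natrM -mulrA e.
rewrite -(sum_sets1 (fun s => (ccount Y 2 s)%:R * (a s != 0)%:R : R)) mulr_sumr.
apply: eq_bigr => x _; rewrite mulrA -cell3w_marg1 mulr_suml.
by apply: eq_bigr => y _; rewrite mulr_suml.
Qed.

Lemma cell3w_cnorm2 a : (6 * #|cells Y 3|)%N%:R * cnorm R Y 2 2 a
  = \sum_x \sum_y \sum_z cell3w x y z * (a [set x; y] != 0)%:R.
Proof.
have := cnormE R 2 Ydown 2 a; rewrite -[binomial _ _]/3%N => e.
rewrite -[6%N]/(2 * 3)%N -mulnA natrM -mulrA e.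
rewrite -(sum_sets2 (fun s => (ccount Y 2 s)%:R * (a s != 0)%:R : R)).
apply: eq_bigr => x _; apply: eq_bigr => y _; rewrite -mulr_suml cell3w_marg2.
by case: ifP; rewrite ?mul0r.
Qed.

(** The weight [T] to which the expansion estimates are applied. Its marginals are the numbers
    [ccount] up to factorials, so it encodes the norms in all dimensions. *)
Definition cell4w x y z t : R := (uniq [:: x; y; z; t] && ([set x; y; z; t]%SET \in Y))%:R.

Lemma cell4w_marg3 x y z : marg3 cell4w x y z
   = if uniq [:: x; y; z] then (ccount Y 3 [set x; y; z])%:R else 0.
Proof.
rewrite /marg3 /cell4w; case: (boolP (uniq [:: x; y; z])) => u3; last first.
  rewrite big1 // => t _; rewrite (_ : uniq [:: x; y; z; t] = false) //.
  by apply: contraNF u3; rewrite (cat_uniq [:: x; y; z] [:: t]) => /and3P[].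
have c3 : #|[set x; y; z]| = 3%N.
  move: u3; rewrite /= !inE negb_or andbT => /andP[/andP[xy xz] yz].
  by rewrite -setUA !cardsU1 cards1 !inE negb_or xy xz yz.
have := ccount_ext R Y 3 c3; rewrite mul1r => <-.
rewrite [RHS]big_mkcond; apply: eq_bigr => t _.
rewrite (cat_uniq [:: x; y; z] [:: t]) u3 /= orbF andbT.
have -> : (t \in [:: x; y; z]) = (t \in [set x; y; z]) by rewrite !inE orbA.
case: ifP => zn //; have c4 : #|t |: [set x; y; z]| = 4%N by rewrite cardsU1 c3 zn.
by rewrite (ccount_top c4) setUC.
Qed.

Lemma cell4w_marg2 x y : marg2 cell4w x y
   = if x != y then 2 * (ccount Y 3 [set x; y])%:R else 0.
Proof.
rewrite /marg2; under eq_bigr do rewrite cell4w_marg3.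
case: (boolP (x != y)) => xy; last first.
  by rewrite big1 // => z _; rewrite /= inE negb_or (negPf xy).
have c2 : #|[set x; y]| = 2%N by rewrite cards2 xy.
rewrite -(ccount_ext R Y 3 c2) [RHS]big_mkcond; apply: eq_bigr => z _.
rewrite /= !inE !negb_or xy /= andbT !(eq_sym _ z) -negb_or setUC.
by case: ifP => zn.
Qed.

Lemma cell4w_marg1 x : marg1 cell4w x = 6 * (ccount Y 3 [set x])%:R.
Proof.
rewrite /marg1; under eq_bigr do rewrite cell4w_marg2.
have -> : 6 = 2 * 3%:R :> R by rewrite -natrM.
rewrite -mulrA -(ccount_ext R Y 3 (cards1 x)) mulr_sumr [RHS]big_mkcond; apply: eq_bigr => y _.
by rewrite inE eq_sym setUC.
Qed.

Local Notation n24 := ((24 * #|cells Y 4|)%N%:R : R).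

Lemma cell4w_total : total4 cell4w = n24.
Proof.
rewrite /total4; under eq_bigr do rewrite cell4w_marg1.
rewrite -mulr_sumr.
have -> : \sum_x (ccount Y 3 [set x])%:R = \sum_(x | x \notin finset.set0) (ccount Y 3 (x |: finset.set0))%:R :> R.
  by apply: eq_big => x; rewrite ?in_set0 // setU0.
rewrite (ccount_ext R Y 3 (cards0 V)) mulrA -natrM -natrM; congr (_%:R).
congr (_ * _)%N; rewrite /ccount; apply: eq_card => t; rewrite !inE sub0set andbT //.
Qed.

Lemma cell4w_cnorm1 a : n24 * cnorm R Y 3 1 a
  = tsum cell4w (fun x _ _ _ => (a [set x] != 0)%:R).
Proof.
have := cnormE R 3 Ydown 1 a; rewrite bin1 => e.
rewrite -[24%N]/(6 * 4)%N -mulnA natrM -mulrA e tsum_marg1.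
rewrite -(sum_sets1 (fun s => (ccount Y 3 s)%:R * (a s != 0)%:R : R)) mulr_sumr.
by apply: eq_bigr => x _; rewrite mulrA -cell4w_marg1.
Qed.

Lemma cell4w_cnorm2 a : n24 * cnorm R Y 3 2 a
  = tsum cell4w (fun x y _ _ => (a [set x; y] != 0)%:R).
Proof.
have := cnormE R 3 Ydown 2 a; rewrite -[binomial _ _]/6%N => e.
have -> : n24 = 2 * 2 * (6 * #|cells Y 4|)%N%:R by rewrite -!natrM; congr (_%:R); lia.
rewrite -!mulrA e tsum_marg2.
rewrite -(sum_sets2 (fun s => (ccount Y 3 s)%:R * (a s != 0)%:R : R)) mulr_sumr.
apply: eq_bigr => x _; rewrite mulr_sumr; apply: eq_bigr => y _; rewrite cell4w_marg2.
by case: ifP; rewrite ?mul0r ?mulr0 ?mulrA.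
Qed.

Lemma cell4w_cnorm3 a : n24 * cnorm R Y 3 3 a
  = tsum cell4w (fun x y z _ => (a [set x; y; z] != 0)%:R).
Proof.
have := cnormE R 3 Ydown 3 a; rewrite -[binomial _ _]/4%N => e.
rewrite -[24%N]/(6 * 4)%N -mulnA natrM -mulrA e tsum_marg3.
rewrite -(sum_sets3 (fun s => (ccount Y 3 s)%:R * (a s != 0)%:R : R)).
apply: eq_bigr => x _; apply: eq_bigr => y _; apply: eq_bigr => z _; rewrite cell4w_marg3.
by case: ifP; rewrite ?mul0r.
Qed.

Lemma cell4w_cnorm4 a : n24 * cnorm R Y 3 4 a
  = tsum cell4w (fun x y z t => (a [set x; y; z; t] != 0)%:R).
Proof.
have := cnormE R 3 Ydown 4 a; rewrite binn mul1n => e.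
rewrite natrM -mulrA e.
rewrite -(sum_sets4 (fun s => (ccount Y 3 s)%:R * (a s != 0)%:R : R)).
apply: eq_bigr => x _; apply: eq_bigr => y _; apply: eq_bigr => z _; apply: eq_bigr => t _.
rewrite /cell4w; case: ifP => u4; last by rewrite mul0r.
rewrite ccount_top //; move: u4; rewrite /= !inE !negb_or andbT => /and3P[/and3P[xy xz xt] /andP[yz yt] zt].
by rewrite -!setUA !cardsU1 cards1 !inE !negb_or xy xz yz xt yt zt.
Qed.

End Down.

(** * Vertex links and the consequences of local minimality *)

Section Links.
Variables (R : realType) (V : finType) (X : {set {set V}}).
Hypothesis Xdown : forall s t : {set V}, s \in X -> t \subset s -> t \in X.
Implicit Types (a : {ffun {set V} -> 'F_2}) (s : {set V}) (v x y z t : V).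
Local Notation T := (cell4w R X).

Lemma in_link v s : (s \in link X v) = (v \notin s) && ((v |: s)%SET \in X).
Proof.
apply/imsetP/andP => [[t]|[vs sX]]; last first.
  by exists (v |: s)%SET; rewrite ?inE ?setU1K ?eqxx ?sX.
by rewrite inE => /andP[tX vt] ->; rewrite setD1K // setD11.
Qed.

Lemma link_down v s (t : {set V}) : s \in link X v -> t \subset s -> t \in link X v.
Proof.
rewrite !in_link => /andP[vs sX] ts; rewrite (Xdown sX) ?setUS // andbT.
by apply: contra vs; apply: (subsetP ts).
Qed.

(** The weight of a link is a slice of the weight of the complex, so norms in links are partial sums
    of the same [T]. *)
Lemma link_cell3w v x y z : cell3w R (link X v) x y z = T v x y z.
Proof.
rewrite /cell3w /cell4w in_link; congr (nat_of_bool _)%:R.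
have -> : (v \in [set x; y; z]%SET) = (v \in [:: x; y; z]) by rewrite !inE orbA.
by rewrite !setUA andbCA andbA.
Qed.

Lemma eq_tsum_cells (F G : V -> V -> V -> V -> R) :
  (forall x y z t, uniq [:: x; y; z; t] -> [set x; y; z; t]%SET \in X ->
     F x y z t = G x y z t) -> tsum T F = tsum T G.
Proof.
move=> h; do 4! (apply: eq_bigr => ? _); rewrite /cell4w.
by case: andP => [[u4 sX]|_]; rewrite ?mul0r // h.
Qed.

Lemma T_ge0 x y z t : 0 <= T x y z t. Proof. exact: ler0n. Qed.

Lemma T01 x y z t : T x y z t = T y x z t.
Proof.
rewrite /cell4w (_ : [set x; y; z; t] = [set y; x; z; t])%SET; last first.
  by apply/setP => w; rewrite !inE (orbC (w == x)).
congr (nat_of_bool (_ && _))%:R; rewrite /= !inE (eq_sym y x).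
by case: (x == y); case: (x == z); case: (x == t); case: (y == z); case: (y == t).
Qed.

Lemma T12 x y z t : T x y z t = T x z y t.
Proof.
rewrite /cell4w (_ : [set x; y; z; t] = [set x; z; y; t])%SET; last first.
  by apply/setP => w; rewrite !inE (orbAC (w == x)).
congr (nat_of_bool (_ && _))%:R; rewrite /= !inE (eq_sym z y).
by case: (x == y); case: (x == z); case: (x == t); case: (y == z); case: (y == t); case: (z == t).
Qed.

Lemma T23 x y z t : T x y z t = T x y t z.
Proof.
rewrite /cell4w (_ : [set x; y; z; t] = [set x; y; t; z])%SET; last first.
  by apply/setP => w; rewrite !inE -orbA (orbC (w == z)) orbA.
congr (nat_of_bool (_ && _))%:R; rewrite /= !inE (eq_sym t z).
by case: (x == y); case: (x == z); case: (x == t); case: (y == z); case: (y == t); case: (z == t).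
Qed.

Lemma T_vertex v x y z : [set v]%SET \notin X -> T v x y z = 0.
Proof.
move=> nv; rewrite /cell4w; case: andP => // -[_ sX]; case/negP: nv.
by apply: (Xdown sX); rewrite sub1set !inE eqxx.
Qed.

Lemma T_sub v x y z : T v x y z != 0 ->
  [/\ uniq [:: v; x; y; z], [set v; x; y; z]%SET \in X, [set x]%SET \in link X v,
    [set x; y]%SET \in link X v & [set v]%SET \in X].
Proof.
rewrite /cell4w; case: andP => [[u4 sX] _|]; last by rewrite eqxx.
have [vx vy] : v != x /\ v != y.
  by move: u4; rewrite /= !inE !negb_or => /and4P[/and3P[]].
split=> //.
- rewrite in_link !inE vx /=; apply: (Xdown sX); apply/subsetP => w; rewrite !inE.
  by move=> /orP[] ->; rewrite ?orbT.
- rewrite in_link !inE negb_or vx vy /=; apply: (Xdown sX); apply/subsetP => w; rewrite !inE.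
  by move=> /or3P[] ->; rewrite ?orbT.
- by apply: (Xdown sX); rewrite sub1set !inE eqxx.
Qed.

(** Compare with the coboundary of 1 in C^{-1} of the link: adding it complements the set of edges
    of [a] at [v]. *)
Lemma link_min1 a v : locally_minimal R X 3 2 a ->
  \sum_x marg2 T v x * (a [set v; x]%SET != 0)%:R <= 1 / 2 * marg1 T v.
Proof.
move=> /(_ v) amin; have [vX|nvX] := boolP ([set v]%SET \in X); last first.
  have m2 x : marg2 T v x = 0.
    by rewrite /marg2 big1 // => y _; rewrite /marg3 big1 // => z _; rewrite T_vertex.
  by rewrite /marg1 !big1 ?mulr0 // => x _; rewrite m2 ?mul0r.
pose e : {ffun {set V} -> 'F_2} := [ffun s => if s == finset.set0 then 1 else 0].
have l0 : finset.set0 \in link X v by rewrite in_link in_set0 setU0.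
have := amin vX (coboundary (link X v) 0 e).
have ce : cochain (link X v) 0 e.
  by move=> s; rewrite inE cards_eq0 ffunE; case: eqP => // ->; rewrite l0.
move=> /(_ (ex_intro2 _ _ e ce erefl)).
have ld := @link_down v.
move/(ler_wpM2l (ler0n R (6 * #|cells (link X v) 3|))).
rewrite !(cell3w_cnorm1 R ld).
have l1 : \sum_x \sum_y \sum_z cell3w R (link X v) x y z *
      (localize X 1 v a [set x]%SET != 0)%:R = \sum_x marg2 T v x * (a [set v; x]%SET != 0)%:R.
  apply: eq_bigr => x _; rewrite /marg2 mulr_suml; apply: eq_bigr => y _.
  rewrite /marg3 mulr_suml; apply: eq_bigr => z _; rewrite link_cell3w.
  have [->|/T_sub[_ _ xl _ _]] := eqVneq (T v x y z) 0; first by rewrite !mul0r.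
  by rewrite ffunE inE xl cards1.
have l2 : \sum_x \sum_y \sum_z cell3w R (link X v) x y z *
      ((localize X 1 v a + coboundary (link X v) 0 e) [set x]%SET != 0)%:R
    = marg1 T v - \sum_x marg2 T v x * (a [set v; x]%SET != 0)%:R.
  rewrite /marg1 -sumrB; apply: eq_bigr => x _; rewrite /marg2 mulr_suml -sumrB.
  apply: eq_bigr => y _; rewrite /marg3 mulr_suml -sumrB; apply: eq_bigr => z _.
  rewrite link_cell3w.
  have [->|/T_sub[_ _ xl _ _]] := eqVneq (T v x y z) 0; first by rewrite !mul0r subr0.
  rewrite ffunE (coboundaryE ld); last by rewrite inE xl cards1.
  rewrite big_set1 setDv [e _]ffunE eqxx ffunE inE xl cards1 /= F2_add_neq0.
  rewrite oner_neq0 addbT.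
  by case: (_ != 0); rewrite /= ?(mulr1, mulr0) ?subrr ?subr0.
by rewrite l1 l2; lra.
Qed.

(** [g] is cut down to a 0-cochain [e] of the link; on an edge its coboundary is the exclusive or of
    the two end values. *)
Lemma link_min2 a v (g : V -> bool) : locally_minimal R X 3 3 a ->
  \sum_x \sum_y marg3 T v x y * (a [set v; x; y]%SET != 0)%:R <=
  \sum_x \sum_y marg3 T v x y * ((a [set v; x; y]%SET != 0) (+) g x (+) g y)%:R.
Proof.
move=> /(_ v) amin; have [vX|nvX] := boolP ([set v]%SET \in X); last first.
  have m3 x y : marg3 T v x y = 0 by rewrite /marg3 big1 // => z _; rewrite T_vertex.
  by rewrite !big1 // => x _; rewrite big1 // => y _; rewrite m3 mul0r.
pose e : {ffun {set V} -> 'F_2} :=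
  [ffun s => if (s \in cells (link X v) 1) && [exists x in s, g x] then 1 else 0].
have ee x : [set x]%SET \in link X v -> (e [set x]%SET != 0) = g x.
  move=> xl; rewrite ffunE inE xl cards1 /=.
  have -> : [exists w in [set x]%SET, g w] = g x.
    by apply/exists_inP/idP => [[w]|gx]; [rewrite inE => /eqP ->|exists x; rewrite ?inE].
  by case: (g x); rewrite ?oner_neq0 ?eqxx.
have := amin vX (coboundary (link X v) 1 e).
have ce : cochain (link X v) 1 e by move=> s sn; rewrite ffunE (negPf sn).
move=> /(_ (ex_intro2 _ _ e ce erefl)).
have ld := @link_down v.
move/(ler_wpM2l (ler0n R (6 * #|cells (link X v) 3|))).
rewrite !(cell3w_cnorm2 R ld).
set l := (X in X <= _ -> _); set r := (X in _ <= X -> _).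
suff [-> ->] : l = \sum_x \sum_y marg3 T v x y * (a [set v; x; y]%SET != 0)%:R /\
  r = \sum_x \sum_y marg3 T v x y * ((a [set v; x; y]%SET != 0) (+) g x (+) g y)%:R by [].
split; apply: eq_bigr => x _; apply: eq_bigr => y _; rewrite /marg3 mulr_suml;
  apply: eq_bigr => z _; rewrite link_cell3w;
  have [->|/T_sub[u4 _ xl xyl _]] := eqVneq (T v x y z) 0; rewrite ?mul0r //;
  have xy : x != y by move: u4; rewrite /= !inE !negb_or => /and4P[_ /andP[]].
  by rewrite ffunE inE xyl cards2 xy setUA.
have yl : [set y]%SET \in link X v by apply: (ld _ _ xyl); rewrite sub1set !inE eqxx orbT.
rewrite ffunE (cobound1 ld) // ffunE inE xyl cards2 xy /= setUA !F2_add_neq0 !ee //.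
by rewrite -addbA (addbC (g x)).
Qed.

(** Compare with the coboundary of the single vertex [w] in the link of [u]. It alters exactly the
    edges at [w], so the difference [d] is supported there and complements the triangles of [a] on
    the edge u w. *)
Lemma edge_min a u w : locally_minimal R X 3 3 a ->
  \sum_z marg3 T u w z * (a [set u; w; z]%SET != 0)%:R <= 1 / 2 * marg2 T u w.
Proof.
move=> amin; have := link_min2 u (fun x => x == w) amin.
pose d := fun x y => (marg3 T u x y * ((a [set u; x; y]%SET != 0) (+) (x == w) (+) (y == w))%:R
   - marg3 T u x y * (a [set u; x; y]%SET != 0)%:R).
move=> h; have {h} : 0 <= \sum_x \sum_y d x y.
  by move: h; rewrite -subr_ge0 -sumrB; under eq_bigr do rewrite -sumrB.
have mww : marg3 T u w w = 0.
  by rewrite /marg3 big1 // => z _; rewrite /cell4w /= !inE eqxx /= andbF.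
have dsym x y : d x y = d y x.
  rewrite /d; have -> : marg3 T u x y = marg3 T u y x.
    by apply: eq_bigr => z _; rewrite T12.
  by rewrite setUAC -!addbA (addbC (x == w)).
have d0 x y : x != w -> y != w -> d x y = 0.
  by move=> /negPf xw /negPf yw; rewrite /d xw yw !addbF subrr.
have -> : \sum_x \sum_y d x y = 2 * \sum_y d w y.
  rewrite (bigD1 w) //= mulr_natl mulr2n; congr (_ + _).
  have dww : d w w = 0 by rewrite /d mww !mul0r subrr.
  rewrite [RHS](bigD1 w) //= dww add0r.
  apply: eq_bigr => x xw; rewrite (bigD1 w) //= big1 => [|y yw]; last exact: d0.
  by rewrite addr0 dsym.
have -> : \sum_y d w y = marg2 T u w - 2 * \sum_z marg3 T u w z * (a [set u; w; z]%SET != 0)%:R.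
  rewrite mulr_sumr /marg2 -sumrB; apply: eq_bigr => y _; rewrite /d eqxx.
  have [->|yw] := eqVneq y w; first by rewrite mww; ring.
  by case: (_ != 0) => /=; ring.
lra.
Qed.

End Links.

From mathcomp Require Import all_classical all_reals.

(** * The flag complex of a four-dimensional space *)

Section IncidenceGap.
Variables (R : realType) (I : finType) (P L : pred I) (inc : rel I) (r : nat).
Variable lam : R.

Definition incidence (x y : I) : R :=
  ([&& P x, L y & inc x y] || [&& P y, L x & inc y x])%:R.

Hypothesis PL : forall x, P x -> ~~ L x.
Hypothesis r0 : (0 < r)%N.
Hypothesis lam0 : 0 < lam.
Hypothesis degP : forall x, P x -> #|[pred y | L y && inc x y]| = r.
Hypothesis degL : forall y, L y -> #|[pred x | P x && inc x y]| = r.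
Hypothesis bound : forall f : I -> R, \sum_(x | P x) f x = 0 ->
  \sum_(y | L y) (\sum_(x | P x && inc x y) f x) ^+ 2
    <= (lam * r%:R) ^+ 2 * \sum_(x | P x) f x ^+ 2.

Lemma incidence_sum (F : I -> I -> R) :
  \sum_x \sum_y incidence x y * F x y =
  \sum_(y | L y) \sum_(x | P x && inc x y) (F x y + F y x).
Proof.
have e x y : incidence x y * F x y = (if [&& P x, L y & inc x y] then F x y else 0)
    + (if [&& P y, L x & inc y x] then F x y else 0).
  rewrite /incidence; case: (boolP [&& P x, _ & _]) => [/and3P[px ly _]|_] /=.
    by rewrite mul1r; case: ifP => [/and3P[py]|_]; [rewrite (negPf (PL px))|rewrite addr0].
  by case: ifP => _; rewrite ?mul1r ?mul0r add0r.
under eq_bigr do under eq_bigr do rewrite e.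
under eq_bigr do rewrite big_split.
rewrite big_split /= [X in X + _]exchange_big /= -big_split [RHS]big_mkcond /=.
apply: eq_bigr => y _; case: ifP => ly; last first.
  by rewrite !big1 ?addr0 // => x _; rewrite ?ly ?andbF.
rewrite big_split /= [X in _ = X + _]big_mkcond [X in _ = _ + X]big_mkcond.
by congr (_ + _); apply: eq_bigr => x _; rewrite ly.
Qed.

Lemma incidence_sum1 (F : I -> R) :
  \sum_x (wdeg incidence x) * F x = r%:R * (\sum_(x | P x) F x + \sum_(y | L y) F y).
Proof.
have -> : \sum_x (wdeg incidence x) * F x = \sum_x \sum_y incidence x y * F x.
  by apply: eq_bigr => x _; rewrite mulr_suml.
rewrite (incidence_sum (fun x _ => F x)).
under eq_bigr do rewrite big_split /=.
rewrite big_split /= mulrDr; congr (_ + _).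
  rewrite (exchange_big_dep P) /= => [|y x _ /andP[]//].
  rewrite mulr_sumr; apply: eq_bigr => x px.
  rewrite -(degP px) mulr_natl -sumr_const; apply: eq_bigl => y; by rewrite px.
rewrite mulr_sumr; apply: eq_bigr => y ly.
by rewrite -(degL ly) mulr_natl -sumr_const.
Qed.

Lemma incidence_card : #|P| = #|L|.
Proof.
apply/eqP; rewrite -(eqn_pmul2r r0); apply/eqP.
rewrite -!sum_nat_const.
have -> : (\sum_(i in P) r = \sum_(x | P x) \sum_(y | L y && inc x y) 1)%N.
  by apply: eq_bigr => x px; rewrite sum1_card -(degP px).
have -> : (\sum_(i in L) r = \sum_(y | L y) \sum_(x | P x && inc x y) 1)%N.
  by apply: eq_bigr => x px; rewrite sum1_card -(degL px).
rewrite (exchange_big_dep L) /= => [|x y _ /andP[]//].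
by apply: eq_bigr => y ly; apply: eq_bigl => x; rewrite ly.
Qed.

Lemma sumB_mean (Q : pred I) (f : I -> R) (n := #|Q|%:R : R) : n != 0 ->
  \sum_(x | Q x) (f x - (\sum_(x | Q x) f x) / n) = 0 /\
  \sum_(x | Q x) (f x - (\sum_(x | Q x) f x) / n) ^+ 2
    = \sum_(x | Q x) f x ^+ 2 - (\sum_(x | Q x) f x) ^+ 2 / n.
Proof.
move=> n0; set s := \sum_(x | Q x) f x.
have c (b : R) : \sum_(x | Q x) b = n * b by rewrite sumr_const mulr_natl.
split; first by rewrite sumrB c -/s; field.
under eq_bigr do rewrite sqrrB.
rewrite big_split sumrB /= c.
have -> : \sum_(x | Q x) f x * (s / n) *+ 2 = s * (s / n) * 2.
  by rewrite /s !mulr_suml; apply: eq_bigr => x _; rewrite mulr_natr.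
by field.
Qed.

(** Split [f] on each side into its mean and a mean-zero part. The mean-zero parts are controlled by
    [bound]; the means carry the eigenvalues 1 and -1, and the latter is on the favourable side of a
    one-sided gap, leaving the square [sq] as slack. *)
Lemma incidence_gap : spectral_gap incidence lam.
Proof.
move=> f.
have hip : wip incidence f f = r%:R * (\sum_(x | P x) f x ^+ 2 + \sum_(y | L y) f y ^+ 2).
  rewrite -(incidence_sum1 (fun x => f x ^+ 2)).
  by apply: eq_bigr => x _; rewrite expr2 mulrA.
have hsum : wsum incidence f = r%:R * (\sum_(x | P x) f x + \sum_(y | L y) f y).
  exact: incidence_sum1.
pose n : R := #|P|%:R.
have htot : wtot incidence = r%:R * (n + n).
  rewrite /wtot; under eq_bigr do rewrite -[wdeg _ _]mulr1.
  rewrite (incidence_sum1 (fun=> 1)) !sumr_const -/n; congr (_ * (_ + _)).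
  by rewrite /n incidence_card.
have hform : wform incidence f f
    = 2 * \sum_(y | L y) f y * (\sum_(x | P x && inc x y) f x).
  rewrite /wform.
  have -> : \sum_x \sum_y incidence x y * f x * f y
     = \sum_x \sum_y incidence x y * (f x * f y).
    by apply: eq_bigr => x _; apply: eq_bigr => y _; rewrite mulrA.
  rewrite incidence_sum mulr_sumr; apply: eq_bigr => y _.
  rewrite !mulr_sumr; apply: eq_bigr => x _; ring.
rewrite hform hip hsum htot.
have [n0|n0] := eqVneq n 0.
  have /eqP P0 : #|P| == 0%N by move: n0 => /eqP; rewrite pnatr_eq0.
  have L0 : #|L| = 0%N by rewrite -incidence_card.
  have eP F : \sum_(x | P x) F x = 0 :> R.
    by rewrite big_pred0 // => x; have /card0_eq/(_ x) := P0.
  have eL F : \sum_(x | L x) F x = 0 :> R.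
    by rewrite big_pred0 // => x; have /card0_eq/(_ x) := L0.
  by rewrite !eP !eL !(addr0, mulr0, expr0n, mul0r).
have nP : 0 < n by rewrite lt_def n0 /n ler0n.
have [p0 p2] := sumB_mean f n0.
have nL : (#|L|%:R : R) = n by rewrite /n incidence_card.
have nL0 : (#|L|%:R : R) != 0 by rewrite nL.
have [_ l2] := sumB_mean f nL0.
have r0' : 0 < r%:R :> R by rewrite ltr0n.
move: p0 p2 l2; rewrite nL -/n; set p := \sum_(x | P x) f x; set l := \sum_(x | L x) f x.
move=> p0 p2 l2.
pose g y := \sum_(x | P x && inc x y) (f x - p / n).
have gE y : L y -> \sum_(x | P x && inc x y) f x = g y + r%:R * (p / n).
  move=> ly; rewrite /g sumrB sumr_const mulr_natl.
  have -> : (p / n *+ #|[pred x | P x && inc x y]|) = p / n *+ r by rewrite (degL ly).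
  by rewrite subrK.
have g0 : \sum_(y | L y) g y = 0.
  rewrite /g (exchange_big_dep P) /= => [|y x _ /andP[]//].
  rewrite (eq_bigr (fun x => r%:R * (f x - p / n))) => [|x px].
    by rewrite -mulr_sumr p0 mulr0.
  rewrite mulr_natl -(degP px) -sumr_const; apply: eq_bigl => y; by rewrite px.
have -> : \sum_(y | L y) f y * (\sum_(x | P x && inc x y) f x)
    = \sum_(y | L y) (f y - l / n) * g y + r%:R * p * l / n.
  rewrite (eq_bigr (fun y => (f y - l / n) * g y + (l / n) * g y + r%:R * (p / n) * f y)); last first.
    by move=> y ly; rewrite gE //; ring.
  rewrite !big_split /= -!mulr_sumr g0 mulr0 addr0 -/l; congr (_ + _); by field.
pose c := lam * r%:R; have c0 : 0 < c by rewrite mulr_gt0.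
(* The weight [c] is the norm of the incidence operator allowed by [bound], which balances the two
   sides. *)
have amgm : 2 * \sum_(y | L y) (f y - l / n) * g y
   <= c * \sum_(y | L y) (f y - l / n) ^+ 2 + c^-1 * \sum_(y | L y) g y ^+ 2.
  rewrite !mulr_sumr -big_split; apply: ler_sum => y _ /=.
  have : 0 <= c^-1 * (c * (f y - l / n) - g y) ^+ 2.
    by rewrite mulr_ge0 ?sqr_ge0 // invr_ge0 ltW.
  have -> : c^-1 * (c * (f y - l / n) - g y) ^+ 2 =
    c * (f y - l / n) ^+ 2 + c^-1 * g y ^+ 2 - 2 * ((f y - l / n) * g y).
    by field; rewrite [c == 0]gt_eqF // andbT.
  by rewrite subr_ge0.
have hb : c^-1 * \sum_(y | L y) g y ^+ 2 <= c * \sum_(x | P x) (f x - p / n) ^+ 2.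
  apply: le_trans (_ : c^-1 * (c ^+ 2 * \sum_(x | P x) (f x - p / n) ^+ 2) <= _).
    by rewrite ler_wpM2l ?invr_ge0 ?(ltW c0) //; exact: (bound p0).
  by rewrite mulrA expr2 mulKf ?gt_eqF.
rewrite p2 in hb; rewrite l2 in amgm.
set SP := \sum_(x | P x) f x ^+ 2 in hb *; set SL := \sum_(x | L x) f x ^+ 2 in amgm *.
have -> : (r%:R * (p + l)) ^+ 2 / (r%:R * (n + n)) = r%:R * (p + l) ^+ 2 / n / 2.
  by field; rewrite -/n n0 [r%:R == 0]gt_eqF //= gt_eqF // addr_gt0.
have sq : 0 <= r%:R * (1 + lam) / 2 * (p - l) ^+ 2 / n.
  apply: divr_ge0 (ltW nP); apply: mulr_ge0 (sqr_ge0 _); apply: divr_ge0 => //.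
  by apply: mulr_ge0; rewrite ?addr_ge0 ?(ltW lam0) ?(ltW r0').
have -> : lam * (r%:R * (SP + SL)) + (1 - lam) * (r%:R * (p + l) ^+ 2 / n / 2)
  = c * (SP - p ^+ 2 / n) + c * (SL - l ^+ 2 / n) + 2 * (r%:R * p * l / n)
    + r%:R * (1 + lam) / 2 * (p - l) ^+ 2 / n.
  by rewrite /c; field.
lra.
Qed.

End IncidenceGap.

Section FiniteSubspaces.
Variables (F : finFieldType) (vT : vectType F).
(** Subspaces are the vertices of the model link, so sums over them require a finite type; it is
    inherited from the coding of a subspace by a matrix. *)
HB.instance Definition _ :=
  Countable.copy {vspace vT} (can_type (@VectorInternalTheory.vs2mxK F vT)).
HB.instance Definition _ := isFinite.Build {vspace vT}
  (pcan_enumP (can_pcan (@VectorInternalTheory.vs2mxK F vT))).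
End FiniteSubspaces.

Section Subspaces.
Variable k : finFieldType.
Local Notation vT := 'cV[k]_4.
Implicit Types U W X Y : {vspace vT}.
Local Notation q := #|k|.

Lemma q_gt1 : (1 < q)%N.
Proof. exact: finNzRing_gt1. Qed.

Lemma dim_lt_sub U W : (U <= W)%VS -> U != W -> (\dim U < \dim W)%N.
Proof.
move=> UW ne; rewrite ltn_neqAle dimvS // andbT.
by apply: contraNN ne => /eqP e; rewrite eqEdim UW e leqnn.
Qed.

Lemma sub_dim_eq U W : (U <= W)%VS -> (\dim W <= \dim U)%N -> U = W.
Proof. by move=> UW d; apply/eqP; rewrite eqEdim UW. Qed.

Lemma exists_notin U W : (\dim U < \dim W)%N -> exists2 x, x \in W & x \notin U.
Proof.
move=> d; have /subvPn[x xW xU] : ~~ (W <= U)%VS by apply: contraTN d => /dimvS; rewrite -leqNgt.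
by exists x.
Qed.

Lemma dim_add_line U x : x \notin U -> \dim (U + <[x]>) = (\dim U).+1.
Proof.
move=> xU; have x0 : x != 0 by apply: contraNneq xU => ->; rewrite mem0v.
rewrite dimv_disjoint_sum ?dim_vline ?x0 ?addn1 //.
apply/eqP; rewrite -subv0; apply/subvP => y; rewrite memv_cap => /andP[yU /vlineP[c yc]].
have [c0|c0] := eqVneq c 0; first by rewrite yc c0 scale0r mem0v.
by move: xU; rewrite -(scalerK c0 x) -yc memvZ.
Qed.

Definition between U W d := [pred X : {vspace vT} | [&& (U <= X)%VS, (X <= W)%VS & \dim X == d]].

Lemma card_subspace U : #|U| = (q ^ \dim U)%N.
Proof. exact: (@card_vspace k vT). Qed.

(** A vector of W outside U lies in exactly one intermediate X, namely U plus its line; so the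
    number is (q^(d+2) - q^d) / (q^(d+1) - q^d) = q + 1. *)
Lemma card_interval U W : (U <= W)%VS -> \dim W = (\dim U).+2 ->
  #|between U W (\dim U).+1| = q.+1.
Proof.
move=> UW dW; set d := \dim U; have q1 := q_gt1.
pose S := fun X : {vspace vT} => [pred x : vT | (x \in X) && (x \notin U)].
have cS X : (U <= X)%VS -> (#|S X| + q ^ d = q ^ \dim X)%N.
  move=> UX; rewrite -!card_subspace addnC.
  rewrite -(cardID (mem U) (mem X)); congr (_ + _)%N; apply: eq_card => x; rewrite !inE.
    by case: (boolP (x \in U)) => [/(subvP UX)->|]; rewrite ?andbF ?andbT.
  by rewrite andbC.
have sumS : (\sum_(X | between U W d.+1 X) #|S X| = #|S W|)%N.
  under eq_bigr do rewrite -sum1_card.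
  rewrite (exchange_big_dep (S W)) /=; last first.
    by move=> X x /and3P[_ XW _] /andP[xX xU]; rewrite (subvP XW).
  rewrite -sum1_card; apply: eq_big => // x /andP[xW xU].
  rewrite (big_pred1 (U + <[x]>)%VS) // => X; rewrite !inE xU andbT.
  apply/andP/eqP => [[/and3P[UX XW /eqP dX] xX]|->]; last first.
    rewrite addvSl subv_add UW /= dim_add_line // eqxx andbT; split=> //.
    by rewrite (subvP (addvSr _ _)) // memv_line.
  apply/esym/sub_dim_eq; first by rewrite subv_add UX -memvE.
  by rewrite dim_add_line // dX.
have := cS W UW; rewrite -sumS dW.
have -> : (\sum_(X | between U W d.+1 X) #|S X| = #|between U W d.+1| * (q ^ d * (q - 1)))%N.
  rewrite -sum_nat_const; apply: eq_bigr => X /and3P[UX XW /eqP dX].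
  by have := cS X UX; rewrite dX expnS mulnBr muln1; lia.
set n := #|_|; rewrite !expnS.
have : (0 < q ^ d)%N by rewrite expn_gt0; lia.
move: (q ^ d)%N => Q Q0 e.
have : ((n * (q - 1) + 1) * Q = q * q * Q)%N by nia.
move/eqP; rewrite eqn_pmul2r // => /eqP e2.
have e3 : (n * (q - 1) = (q.+1) * (q - 1))%N by nia.
by move/eqP: e3; rewrite eqn_pmul2r ?subn_gt0 // => /eqP.
Qed.

End Subspaces.

(** * The flag complex and the spectral gaps of its links *)

Section FlagComplex.
Variable k : finFieldType.
Local Notation vT := 'cV[k]_4.
Local Notation q := #|k|.
Implicit Types U W X Y A B C : {vspace vT}.

Definition proper A := (0 < \dim A < 4)%N.
Definition incident A B := (A != B) && ((A <= B)%VS || (B <= A)%VS).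
(** An ordered chamber: pairwise incident proper subspaces of k^4 have the dimensions 1, 2, 3 in
    some order. *)
Definition flag A B C := [&& proper A, proper B, proper C,
  incident A B, incident A C & incident B C].

Lemma dim_full : \dim {:vT} = 4%N.
Proof. by rewrite dimvf /dim /= muln1. Qed.

Lemma incidentE A B : incident A B =
  ((A <= B)%VS && (\dim A < \dim B)%N) || ((B <= A)%VS && (\dim B < \dim A)%N).
Proof.
rewrite /incident; have [->|ne] /= := eqVneq A B; first by rewrite ltnn !andbF.
have [AB|_] /= := boolP (A <= B)%VS; first by rewrite dim_lt_sub.
by have [BA|//] /= := boolP (B <= A)%VS; rewrite dim_lt_sub // eq_sym.
Qed.

Lemma incident_sym A B : incident A B = incident B A.
Proof. by rewrite /incident eq_sym orbC. Qed.

Lemma flag01 A B C : flag A B C = flag B A C.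
Proof.
rewrite /flag (incident_sym B A).
by do 3! case: (proper _); case: (incident A B); case: (incident A C); case: (incident B C).
Qed.

Lemma flag12 A B C : flag A B C = flag A C B.
Proof.
rewrite /flag (incident_sym C B).
by do 3! case: (proper _); case: (incident A B); case: (incident A C); case: (incident B C).
Qed.

Lemma flag_extend A B : proper A -> proper B -> incident A B -> exists C, flag A B C.
Proof.
wlog AB : A B / (A <= B)%VS && (\dim A < \dim B)%N => [th pA pB|].
  rewrite incidentE => /orP[] h; first by apply: th => //; rewrite incidentE h.
  have [|C hC] := th B A h pB pA; first by rewrite incidentE h.
  by exists C; rewrite flag01.
move: AB => /andP[AB dAB] pA pB _.
have int U W : (U <= W)%VS -> \dim W = (\dim U).+2 ->
    exists X, [&& (U <= X)%VS, (X <= W)%VS & \dim X == (\dim U).+1].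
  move=> UW dW; have : (0 < #|between U W (\dim U).+1|)%N by rewrite card_interval.
  by case/card_gt0P => X; exists X.
have [[dA dB]|[[dA dB]|[dA dB]]] : (\dim A = 1 /\ \dim B = 2)%N \/
   (\dim A = 1 /\ \dim B = 3)%N \/ (\dim A = 2 /\ \dim B = 3)%N.
- by move: pA pB; rewrite /proper; lia.
- have [||X /and3P[BX _ dX]] := int B {:vT}%VS; rewrite ?subvf ?dim_full ?dB //.
  exists X; rewrite /flag !incidentE /proper (eqP dX) dA dB AB BX (subv_trans AB BX) //.
- have [||X /and3P[AX XB dX]] := int A B; rewrite ?dA ?dB //.
  by exists X; rewrite /flag !incidentE /proper (eqP dX) dA dB AB AX XB !orbT.
- have [||X /and3P[_ XA dX]] := int 0%VS A; rewrite ?sub0v ?dimv0 ?dA //.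
  exists X; rewrite /flag !incidentE /proper (eqP dX) dA dB dimv0 AB XA (subv_trans XA AB).
  by rewrite !orbT.
Qed.

Lemma exists_point A : proper A -> exists2 X, (X <= A)%VS & \dim X = 1%N.
Proof.
move=> /andP[dA _]; exists <[vpick A]>%VS; first by rewrite -memvE memv_pick.
by rewrite dim_vline vpick0 -dimv_eq0 -lt0n dA.
Qed.

Variable R : realType.

Definition flagw A B C : R := (flag A B C)%:R.

Lemma sumf_sqr (P L : pred {vspace vT}) (inc : rel {vspace vT}) (f : {vspace vT} -> R) :
  \sum_(y | L y) (\sum_(x | P x && inc x y) f x) ^+ 2 =
  \sum_(x | P x) \sum_(x' | P x') f x * f x' * #|[pred y | [&& L y, inc x y & inc x' y]]|%:R.
Proof.
transitivity (\sum_(y | L y) \sum_(x | P x) \sum_(x' | P x')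
   (if inc x y && inc x' y then f x * f x' else 0)).
  apply: eq_bigr => y ly; rewrite expr2 big_distrlr /= big_mkcondr /=.
  apply: eq_bigr => x px; case: ifP => ixy /=; last by rewrite big1.
  by rewrite big_mkcondr.
rewrite exchange_big; apply: eq_bigr => x px; rewrite exchange_big; apply: eq_bigr => x' px' /=.
rewrite -big_mkcondr /= sumr_const mulr_natr; congr (_ *+ _).
Qed.

Variable lam : R.
Hypothesis lam0 : 0 < lam.
Hypothesis lam_q : q%:R <= (lam * q.+1%:R) ^+ 2.

(** Two distinct points lie on one line and a point lies on q + 1 lines, so the incidence operator N
    has N^T N = q + J, and J kills mean-zero functions. The interval form serves both the subspaces
    above a point and those below a 3-space. *)
Lemma plane_gap U W : (U <= W)%VS -> \dim W = (\dim U).+3 ->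
  spectral_gap (@incidence R _ (between U W (\dim U).+1) (between U W (\dim U).+2)
    (fun X Y => (X <= Y)%VS)) lam.
Proof.
move=> UW dW.
have degP x : between U W (\dim U).+1 x ->
    #|[pred y | between U W (\dim U).+2 y && (x <= y)%VS]| = q.+1.
  case/and3P => Ux xW /eqP dx; rewrite -(card_interval xW) ?dW ?dx //.
  apply: eq_card => y; rewrite !inE; apply/idP/idP => [/andP[/and3P[_ -> ->] ->]//|].
  by case/and3P => xy yW ->; rewrite yW xy (subv_trans Ux xy).
apply: (incidence_gap (r := q.+1)) => //.
- by move=> x /and3P[_ _ /eqP dx]; apply/negP => /and3P[_ _]; rewrite dx; lia.
- move=> y /and3P[Uy yW /eqP dy]; rewrite -(card_interval Uy) //.
  apply: eq_card => x; rewrite !inE; apply/idP/idP => [/andP[/and3P[-> _ ->] ->]//|].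
  by case/and3P => Ux xy ->; rewrite Ux xy (subv_trans xy yW).
move=> f f0; rewrite sumf_sqr.
rewrite (eq_bigr (fun x => f x * (\sum_(x' | between U W (\dim U).+1 x') f x') + q%:R * f x ^+ 2)).
  rewrite big_split /= -mulr_suml f0 mulr0 add0r -mulr_sumr ler_wpM2r //.
  by apply: sumr_ge0 => x _; rewrite sqr_ge0.
move=> x px; rewrite (bigD1 x px) [X in _ = f x * X + _](bigD1 x px) /=.
have -> : #|[pred y | [&& between U W (\dim U).+2 y, (x <= y)%VS & (x <= y)%VS]]| = q.+1.
  rewrite -(degP x px); apply: eq_card => y; by rewrite !inE andbb.
rewrite mulrDr -addrA [X in _ = _ + X]addrC addrA -[q.+1]addn1 natrD mulr_sumr.
congr (_ + _); first by rewrite expr2; ring.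
apply: eq_bigr => x' /andP[px' ne].
have -> : #|[pred y | [&& between U W (\dim U).+2 y, (x <= y)%VS & (x' <= y)%VS]]| = 1%N.
  transitivity #|pred1 (x + x')%VS|; last exact: card1.
  apply: eq_card => y; rewrite !inE.
  move: px px' => /and3P[Ux xW /eqP dx] /and3P[Ux' xW' /eqP dx'].
  have dxx : (\dim U).+2 = \dim (x + x').
    have dc : \dim (x :&: x') = \dim U.
      apply/eqP; rewrite eqn_leq (dimvS (_ : (U <= x :&: x')%VS)) ?subv_cap ?Ux // andbT -ltnS -dx.
      apply: dim_lt_sub; first exact: capvSl.
      apply: contraNneq ne => e; apply/eqP/esym/sub_dim_eq; last by rewrite dx dx'.
      by rewrite -e capvSr.
    by apply/eqP; rewrite -(eqn_add2r (\dim U)) -{3}dc dimv_sum_cap dx dx' addSnnS.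
  apply/and3P/eqP => [[/and3P[Uy yW /eqP dy] xy x'y]|->].
    by apply/esym/sub_dim_eq; rewrite ?subv_add ?xy // -dxx dy.
  by rewrite addvSl addvSr dxx eqxx subv_add xW xW' (subv_trans Ux (addvSl _ _)).
by rewrite mulr1.
Qed.

(** Everything below A is incident to everything above it, so the incidence operator kills mean-zero
    functions. *)
Lemma digon_gap A : \dim A = 2%N ->
  spectral_gap (@incidence R _ (between 0 A 1) (between A {:vT} 3) (fun _ _ => true)) lam.
Proof.
move=> dA.
have c1 : #|between 0 A 1| = q.+1.
  by have := @card_interval k 0 A (sub0v _); rewrite dimv0 dA => /(_ erefl).
have c2 : #|between A {:vT} 3| = q.+1.
  by have := @card_interval k A {:vT} (subvf _); rewrite dim_full dA => /(_ erefl).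
apply: (incidence_gap (r := q.+1)) => //.
- by move=> x /and3P[_ _ /eqP dx]; apply/negP => /and3P[_ _]; rewrite dx.
- by move=> x _; rewrite -[RHS]c2; apply: eq_card => y; rewrite !inE andbT.
- by move=> y _; rewrite -[RHS]c1; apply: eq_card => x; rewrite !inE andbT.
move=> f f0; rewrite big1 => [|y _].
  by rewrite mulr_ge0 ?sqr_ge0 // sumr_ge0 // => x _; rewrite sqr_ge0.
under eq_bigl do rewrite andbT.
by rewrite f0 expr0n.
Qed.

Lemma spectral_gap0 (I : finType) (w : I -> I -> R) :
  (forall x y, w x y = 0) -> spectral_gap w lam.
Proof.
move=> w0 f.
have d0 x : wdeg w x = 0 by rewrite /wdeg big1.
have -> : wform w f f = 0.
  by rewrite /wform big1 // => x _; rewrite big1 // => y _; rewrite w0 !mul0r.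
have -> : wip w f f = 0 by rewrite /wip big1 // => x _; rewrite d0 !mul0r.
have -> : wsum w f = 0 by rewrite /wsum big1 // => x _; rewrite d0 !mul0r.
by rewrite expr0n !mul0r !mulr0 addr0.
Qed.

Lemma flag_gap A : spectral_gap (flagw A) lam.
Proof.
have [pA|npA] := boolP (proper A); last first.
  by apply: spectral_gap0 => x y; rewrite /flagw /flag (negPf npA).
have dS X Y : (X <= Y)%VS -> (\dim X <= \dim Y)%N by apply: dimvS.
have tr X Y Z : (Y <= X)%VS -> (X <= Z)%VS -> (Y <= Z)%VS by apply: subv_trans.
have dS4 X : (\dim X <= 4)%N by have := dimvS (subvf X); rewrite dim_full.
have [d1|[d2|d3]] : \dim A = 1%N \/ \dim A = 2%N \/ \dim A = 3%N by move: pA; rewrite /proper; lia.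
- have <- : incidence R (between A {:vT} (\dim A).+1) (between A {:vT} (\dim A).+2)
     (fun X Y => (X <= Y)%VS) = flagw A; last by apply: plane_gap; rewrite ?subvf // d1 dim_full.
  apply/funext => B; apply/funext => C; congr ((nat_of_bool _)%:R).
  rewrite /flag !incidentE /proper /= !subvf d1.
  (* The rest is propositional: inclusions become Booleans tied together by transitivity and by
     monotonicity of the dimension. *)
  move: (tr A B C) (tr A C B) (dS A B) (dS A C) (dS B A) (dS C A) (dS B C) (dS C B) (dS4 B) (dS4 C).
  move: (A <= B)%VS (A <= C)%VS (B <= A)%VS (C <= A)%VS (B <= C)%VS (C <= B)%VS.
  move: (\dim B) (\dim C) => b c; do 6! case; rewrite ?d1 ?d2 ?d3; lia.
- have <- : incidence R (between 0 A 1) (between A {:vT} 3) (fun _ _ => true)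
     = flagw A; last exact: digon_gap.
  apply/funext => B; apply/funext => C; congr ((nat_of_bool _)%:R).
  rewrite /flag !incidentE /proper /= !subvf !sub0v d2.
  move: (tr A B C) (tr A C B) (dS A B) (dS A C) (dS B A) (dS C A) (dS B C) (dS C B) (dS4 B) (dS4 C).
  move: (A <= B)%VS (A <= C)%VS (B <= A)%VS (C <= A)%VS (B <= C)%VS (C <= B)%VS.
  move: (\dim B) (\dim C) => b c; do 6! case; rewrite ?d1 ?d2 ?d3; lia.
- have <- : incidence R (between 0 A 1) (between 0 A 2)
     (fun X Y => (X <= Y)%VS) = flagw A; last first.
    by have := @plane_gap 0 A (sub0v _); rewrite dimv0 d3; apply.
  apply/funext => B; apply/funext => C; congr ((nat_of_bool _)%:R).
  rewrite /flag !incidentE /proper /= !sub0v d3.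
  move: (tr A B C) (tr A C B) (dS A B) (dS A C) (dS B A) (dS C A) (dS B C) (dS C B) (dS4 B) (dS4 C).
  move: (A <= B)%VS (A <= C)%VS (B <= A)%VS (C <= A)%VS (B <= C)%VS (C <= B)%VS.
  move: (\dim B) (\dim C) => b c; do 6! case; rewrite ?d1 ?d2 ?d3; lia.
Qed.

Lemma flagw_ge0 A B C : 0 <= flagw A B C.
Proof. exact: ler0n. Qed.

Lemma flagw01 A B C : flagw A B C = flagw B A C.
Proof. by rewrite /flagw flag01. Qed.

Lemma flagw12 A B C : flagw A B C = flagw A C B.
Proof. by rewrite /flagw flag12. Qed.


Definition edgew A B : R := \sum_C flagw A B C.

Lemma edgew_neq0 A B : proper A -> proper B -> incident A B -> edgew A B != 0.
Proof.
move=> pA pB AB; have [C hC] := flag_extend pA pB AB.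
rewrite /edgew psumr_eq0 => [|X _]; last exact: flagw_ge0.
by apply/allPn; exists C; rewrite ?mem_index_enum // /flagw hC oner_neq0.
Qed.

(** Each subspace is joined to a point in it, and two points are joined through their span, whose
    dimension is at most 2. *)
Lemma edgew_connected : wconnected edgew.
Proof.
move=> P hP.
have step A B : proper A -> proper B -> (A <= B)%VS -> (P A <-> P B).
  move=> pA pB AB; have [->//|ne] := eqVneq A B.
  have iAB : incident A B by rewrite /incident ne AB.
  by split; apply: hP; apply: edgew_neq0; rewrite // incident_sym.
have prop A : wdeg edgew A != 0 -> proper A.
  apply: contraNT => npA; rewrite /wdeg big1 // => B _; rewrite /edgew big1 // => C _.
  by rewrite /flagw /flag (negPf npA).
move=> A B /prop pA /prop pB PA.
have [X XA dX] := exists_point pA; have [Y YB dY] := exists_point pB.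
have pX : proper X by rewrite /proper dX.
have pY : proper Y by rewrite /proper dY.
apply/(step _ _ pY pB YB).
have pXY : proper (X + Y)%VS.
  have := dimvS (addvSl X Y); have := leq_addr (\dim (X :&: Y)) (\dim (X + Y)).
  by rewrite dimv_sum_cap dX dY /proper => h ->; apply: leq_ltn_trans h _.
by apply/(step _ _ pY pXY (addvSr _ _))/(step _ _ pX pXY (addvSl _ _))/(step _ _ pX pA XA).
Qed.

Hypothesis lam12 : lam < 1 / 2.

Lemma edgew_gap : spectral_gap edgew (lam / (1 - lam)).
Proof.
exact: (trickling_down_links flagw_ge0 flagw01 flagw12 (ltW lam0) lam12
  edgew_connected flag_gap).
Qed.
End FlagComplex.

(** * Coboundary expansion of the flag complex *)

Section FlagExpansion.
Variable k : finFieldType.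
Local Notation vT := 'cV[k]_4.
Implicit Types U W X Y A B C : {vspace vT}.

(** The value 0 on equal arguments lets chains repeat a subspace, so special positions relative to
    the apex need no case distinction: a nested chain with a repetition has defect 0. *)
Definition degen (f : {vspace vT} -> {vspace vT} -> bool) X Y := (X != Y) && f X Y.
Definition chain_defect (f : {vspace vT} -> {vspace vT} -> bool) X Y Z :=
  degen f X Y (+) degen f Y Z (+) degen f X Z.

(* The potential of a cochain f along the cone with apex a point p0: points and
   lines are reached through their span with p0, planes through their trace on a
   fixed line l0 containing p0. Degenerate steps contribute 0. *)
Definition cone (p0 l0 : {vspace vT}) f A : bool :=
  if \dim A == 3%N then degen f p0 l0 (+) degen f l0 (l0 :&: A)%VS (+) degen f (l0 :&: A)%VS A
  else degen f p0 (p0 + A)%VS (+) degen f (p0 + A)%VS A.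

Definition chain X Y Z := [&& proper X, proper Y, proper Z, (X <= Y)%VS & (Y <= Z)%VS].

(** An implication rather than a chain identity: where [f] differs from the coboundary of the cone
    potential, some listed chain has odd defect. A union bound needs no more. *)
Definition cone_filling (p0 l0 A B : {vspace vT})
    (s : seq ({vspace vT} * {vspace vT} * {vspace vT})) : Prop :=
  all (fun t => chain t.1.1 t.1.2 t.2) s /\
  forall f, (forall X Y, f X Y = f Y X) ->
    all (fun t => ~~ chain_defect f t.1.1 t.1.2 t.2) s ->
    f A B (+) cone p0 l0 f A (+) cone p0 l0 f B = false.

(** For a 2-space and a 3-space in k^4, [a] is the dimension of the sum and [b] that of the
    intersection. *)
Lemma sum5_bound (a b : nat) : (a + b = 5 -> a <= 4 -> b <= 2 -> 0 < b < 4)%N.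
Proof. lia. Qed.

Section ConeFilling.
Variables (p0 l0 : {vspace vT}).
Hypotheses (dp : \dim p0 = 1%N) (dl : \dim l0 = 2%N) (pl : (p0 <= l0)%VS).

Let pp : proper p0. Proof. by rewrite /proper dp. Qed.
Let pl0 : proper l0. Proof. by rewrite /proper dl. Qed.

Lemma degen_sym f X Y : (forall X Y, f X Y = f Y X) -> degen f X Y = degen f Y X.
Proof. by move=> fs; rewrite /degen eq_sym fs. Qed.

Lemma dim_addv_point X Y : \dim X = 1%N -> (\dim (X + Y) <= (\dim Y).+1)%N.
Proof. move=> dX; have := leq_addr (\dim (X :&: Y)) (\dim (X + Y)).
by rewrite dimv_sum_cap dX add1n. Qed.

Lemma proper_sub X Y Z : proper X -> proper Z -> (X <= Y)%VS -> (Y <= Z)%VS -> proper Y.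
Proof.
move=> /andP[x0 _] /andP[_ z4] /dimvS h1 /dimvS h2.
by rewrite /proper (leq_trans x0 h1) (leq_ltn_trans h2 z4).
Qed.

Lemma degen_neq f X Y : X != Y -> degen f X Y = f X Y.
Proof. by rewrite /degen => ->. Qed.

(** The cycle to fill is A, B, p0 + B, p0, p0 + A. As p0 + B contains all the others, the three
    triangles are the fan at p0 + B. *)
Lemma fill_point_line A B : \dim A = 1%N -> \dim B = 2%N -> (A <= B)%VS ->
  cone_filling p0 l0 A B [:: (p0, p0 + A, p0 + B); (A, p0 + A, p0 + B); (A, B, p0 + B)]%VS.
Proof.
move=> dA dB AB.
have pA : proper A by rewrite /proper dA.
have pB : proper B by rewrite /proper dB.
have pPB : proper (p0 + B)%VS.
  have := dim_addv_point B dp; have := dimvS (addvSr p0 B); rewrite dB => /ltnW h1 h2.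
  by rewrite /proper h1.
have AP : (p0 + A <= p0 + B)%VS by rewrite addvS.
have pPA : proper (p0 + A)%VS by apply: proper_sub pp pPB (addvSl _ _) AP.
split; first by rewrite /= /chain pA pB pp pPA pPB AP AB !addvSl !addvSr.
move=> f fs /=; rewrite /chain_defect /cone dA dB /=.
rewrite -(@degen_neq f A B); last by apply/eqP => e; move: dA; rewrite e dB.
rewrite (degen_sym (p0 + A)%VS A fs) (degen_sym (p0 + B)%VS B fs).
move: (degen f p0 (p0 + A)%VS) (degen f A (p0 + A)%VS) (degen f (p0 + A)%VS (p0 + B)%VS)
  (degen f p0 (p0 + B)%VS) (degen f B (p0 + B)%VS) (degen f A (p0 + B)%VS) (degen f A B).
by do 7! case.
Qed.

(** The cycle to fill is A, B, y, l0, p0, p0 + A. All but B lie in Q, and four triangles at Q reduce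
    it to A, B, y, Q; the subspace n, contained in both B and Q, cuts that square into four more. *)
Lemma fill_point_plane A B : \dim A = 1%N -> \dim B = 3%N -> (A <= B)%VS ->
  let Q := (l0 + A)%VS in let y := (l0 :&: B)%VS in let n := (A + y)%VS in
  cone_filling p0 l0 A B [:: (p0, p0 + A, Q); (A, p0 + A, Q); (p0, l0, Q); (y, l0, Q);
    (A, n, B); (A, n, Q); (y, n, B); (y, n, Q)]%VS.
Proof.
move=> dA dB AB Q y n.
have pA : proper A by rewrite /proper dA.
have pB : proper B by rewrite /proper dB.
have lQ : (l0 <= Q)%VS := addvSl _ _.
have AQ : (A <= Q)%VS := addvSr _ _.
have pQ : proper Q.
  have := dim_addv_point l0 dA; rewrite addvC -/Q dl => h.
  by have := dimvS lQ; rewrite dl => /ltnW h2; rewrite /proper h2.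
have AP : (p0 + A <= Q)%VS by rewrite subv_add AQ (subv_trans pl lQ).
have pPA : proper (p0 + A)%VS by apply: proper_sub pp pQ (addvSl _ _) AP.
have yB : (y <= B)%VS := capvSr _ _.
have yl : (y <= l0)%VS := capvSl _ _.
have nB : (n <= B)%VS by rewrite subv_add AB yB.
have nQ : (n <= Q)%VS by rewrite subv_add AQ (subv_trans yl lQ).
have pn : proper n by apply: proper_sub pA pB (addvSl _ _) nB.
have py : proper y.
  apply: (@sum5_bound (\dim (l0 + B))); first by rewrite dimv_sum_cap dl dB.
    by have := dimvS (subvf (l0 + B)); rewrite dim_full.
  by have := dimvS yl; rewrite dl.
have An : (A <= n)%VS := addvSl _ _.
have yn : (y <= n)%VS := addvSr _ _.
split.
  by rewrite /= /chain pA pB pp pPA pQ py pn pl0 AP nB nQ An yn yl pl lQ !addvSl !addvSr.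
move=> f fs /=; rewrite /chain_defect /cone dA dB /= -/y.
rewrite -(@degen_neq f A B); last by apply/eqP => e; move: dA; rewrite e dB.
rewrite (degen_sym (p0 + A)%VS A fs) (degen_sym y l0 fs).
move: (degen f p0 (p0 + A)%VS) (degen f A (p0 + A)%VS) (degen f (p0 + A)%VS Q)
  (degen f p0 Q) (degen f A Q) (degen f p0 l0) (degen f l0 Q) (degen f l0 y)
  (degen f y Q) (degen f A n) (degen f n B) (degen f A B) (degen f n Q) (degen f y n) (degen f y B).
move=> b1 b2 b3 b4 b5 b6 b7 b8 b9 b10 b11 b12 b13 b14 b15.
have e1 u v w : ~~ (u (+) v (+) w) -> w = u (+) v by case: u v w => -[] [].
have e2 u v w : ~~ (u (+) v (+) w) -> u = w (+) v by case: u v w => -[] [].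
move=> /and5P[/e1 h1 /e1 h2 /e2 h3 /e1 h4 /and5P[/e1 h5 /e2 h6 /e1 h7 /e2 h8 _]].
rewrite h5 h7 h6 h8 h3 h4 h2 h1.
by clear; move: b1 b2 b3 b7 b8 b11 b13; do 7! case.
Qed.

(** Through a point x of A: one triangle x, A, B together with the fillings of x A and x B. The
    count 1 + 3 + 8 is the origin of the 12. *)
Lemma fill_line_plane A B : \dim A = 2%N -> \dim B = 3%N -> (A <= B)%VS ->
  exists2 s, (size s <= 12)%N & cone_filling p0 l0 A B s.
Proof.
move=> dA dB AB.
have pA : proper A by rewrite /proper dA.
have pB : proper B by rewrite /proper dB.
have [x xA dx] := exists_point pA; have px : proper x by rewrite /proper dx.
have xB := subv_trans xA AB.
have [c1 h1] := fill_point_line dx dA xA; have [c2 h2] := fill_point_plane dx dB xB.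
exists ([:: (x, A, B)] ++ ([:: (p0, p0 + x, p0 + A); (x, p0 + x, p0 + A); (x, A, p0 + A)] ++
   [:: (p0, p0 + x, l0 + x); (x, p0 + x, l0 + x); (p0, l0, l0 + x); (l0 :&: B, l0, l0 + x);
    (x, x + (l0 :&: B), B); (x, x + (l0 :&: B), l0 + x); (l0 :&: B, x + (l0 :&: B), B);
    (l0 :&: B, x + (l0 :&: B), l0 + x)]))%VS => //.
split.
  by rewrite !all_cat all_seq1 c1 c2 /chain /= px pA pB xA AB.
move=> f fs; rewrite !all_cat all_seq1.
move=> /andP[h /andP[/(h1 f fs) e1 /(h2 f fs) e2]].
move: h e1 e2; rewrite /chain_defect /=.
rewrite !degen_neq; first last.
- by apply/eqP => e; move: dx; rewrite e dA.
- by apply/eqP => e; move: dA; rewrite e dB.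
- by apply/eqP => e; move: dx; rewrite e dB.
case: (f A B) (f x B) (f x A) (cone p0 l0 f A) (cone p0 l0 f B) (cone p0 l0 f x).
  by do 5! case.
by do 5! case.
Qed.

Lemma cone_fill A B : proper A -> proper B -> (A <= B)%VS -> A != B ->
  exists2 s, (size s <= 12)%N & cone_filling p0 l0 A B s.
Proof.
move=> pA pB AB ne; have dAB := dim_lt_sub AB ne.
have [[dA dB]|[[dA dB]|[dA dB]]] : (\dim A = 1 /\ \dim B = 2)%N \/
   (\dim A = 1 /\ \dim B = 3)%N \/ (\dim A = 2 /\ \dim B = 3)%N.
- by move: pA pB dAB; rewrite /proper; move: (\dim A) (\dim B) => a b; clear; lia.
- by eexists; last exact: fill_point_line.
- by eexists; last exact: fill_point_plane.
- exact: fill_line_plane.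
Qed.

End ConeFilling.

Lemma cone_filling_sym p0 l0 A B s : cone_filling p0 l0 A B s -> cone_filling p0 l0 B A s.
Proof.
move=> [h1 h2]; split=> // f fs hf; rewrite -[RHS](h2 f fs hf) (fs B A).
by rewrite -!addbA; congr (_ (+) _); rewrite addbC.
Qed.

Lemma cone_fill_incident p0 l0 A B : \dim p0 = 1%N -> \dim l0 = 2%N -> (p0 <= l0)%VS ->
  proper A -> proper B -> incident A B ->
  exists2 s, (size s <= 12)%N & cone_filling p0 l0 A B s.
Proof.
move=> dp dl pl pA pB /andP[ne /orP[AB|BA]]; first exact: cone_fill.
have [|s hs /cone_filling_sym] := cone_fill dp dl pl pB pA BA; last by exists s.
by rewrite eq_sym.
Qed.

Definition mxact (a : 'M[k]_4) U : {vspace vT} := (linfun (mulmx a) @: U)%VS.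

Lemma mxactM a b U : mxact (a *m b) U = mxact a (mxact b U).
Proof.
rewrite /mxact -limg_comp; congr (_ @: _)%VS.
by apply/lfunP => u; rewrite comp_lfunE !lfunE /= mulmxA.
Qed.

Lemma mxact1 U : mxact 1%:M U = U.
Proof.
rewrite /mxact -[RHS]lim1g; congr (_ @: _)%VS.
by apply/lfunP => u; rewrite !lfunE /= mul1mx.
Qed.

Lemma mxactK a : a \in unitmx -> cancel (mxact a) (mxact (invmx a)).
Proof. by move=> ua U; rewrite -mxactM mulVmx // mxact1. Qed.

Lemma mxactKV a : a \in unitmx -> cancel (mxact (invmx a)) (mxact a).
Proof. by move=> ua U; rewrite -mxactM mulmxV // mxact1. Qed.

Lemma mxact_sub a U W : a \in unitmx -> (mxact a U <= mxact a W)%VS = (U <= W)%VS.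
Proof.
move=> ua; apply/idP/idP => [|/limgS->//].
by move/(limgS (linfun (mulmx (invmx a)))); rewrite -!/(mxact _ _) !mxactK.
Qed.

Lemma mxact_dim a U : a \in unitmx -> \dim (mxact a U) = \dim U.
Proof.
move=> ua; have le (f : 'End(vT)) W : (\dim (f @: W) <= \dim W)%N.
  by rewrite -(limg_ker_dim f W) leq_addl.
by apply/eqP; rewrite eqn_leq le -{1}(mxactK ua U) le.
Qed.

Lemma mxact_eq a U W : a \in unitmx -> (mxact a U == mxact a W) = (U == W).
Proof. by move=> ua; rewrite (can_eq (mxactK ua)). Qed.

Lemma mxact_flag a A B C : a \in unitmx ->
  flag (mxact a A) (mxact a B) (mxact a C) = flag A B C.
Proof.
by move=> ua; rewrite /flag /incident /proper !mxact_dim // !mxact_sub // !mxact_eq.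
Qed.

Definition std_vec (j : 'I_4) : vT := delta_mx j 0.
Definition std_line : {vspace vT} := <[std_vec 0%R]>%VS.
Definition std_plane : {vspace vT} := (std_line + <[std_vec 1%R]>)%VS.
Definition std_solid : {vspace vT} := (std_plane + <[std_vec 2%R]>)%VS.

Lemma mxact_line a (u : vT) : mxact a <[u]> = <[a *m u]>%VS.
Proof. by rewrite /mxact limg_line lfunE. Qed.

Lemma mxactD a U W : mxact a (U + W) = (mxact a U + mxact a W)%VS.
Proof. exact: limgD. Qed.

Lemma span_add_line X Y : (X <= Y)%VS -> \dim Y = (\dim X).+1 ->
  exists v, Y = (X + <[v]>)%VS.
Proof.
move=> XY dY; have [|v vY vX] := @exists_notin k X Y; first by rewrite dY.
exists v; apply/esym/sub_dim_eq; first by rewrite subv_add XY -memvE.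
by rewrite dim_add_line // dY.
Qed.

(** The columns of [b] form a basis adapted to the flag; [b] is invertible because its image is the
    whole space. *)
Lemma flag_transitive X Y Z : \dim X = 1%N -> \dim Y = 2%N -> \dim Z = 3%N ->
  (X <= Y)%VS -> (Y <= Z)%VS -> exists2 b, b \in unitmx &
    [/\ X = mxact b std_line, Y = mxact b std_plane & Z = mxact b std_solid].
Proof.
move=> dX dY dZ XY YZ.
have [|v0 e0] := @span_add_line 0 X (sub0v _); first by rewrite dimv0.
have [|v1 e1] := span_add_line XY; first by rewrite dX.
have [|v2 e2] := span_add_line YZ; first by rewrite dY.
have [|v3 e3] := @span_add_line Z {:vT}%VS (subvf _); first by rewrite dim_full dZ.
pose b : 'M[k]_4 := \matrix_(i, j) nth 0 [:: v0; v1; v2; v3] j i 0.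
have bE (j : 'I_4) : b *m std_vec j = nth 0 [:: v0; v1; v2; v3] j.
  by rewrite -colE; apply/matrixP => i c; rewrite !mxE ord1.
have eX : mxact b std_line = X by rewrite mxact_line bE e0 add0v.
have eY : mxact b std_plane = Y by rewrite mxactD eX mxact_line bE e1.
have eZ : mxact b std_solid = Z by rewrite mxactD eY mxact_line bE e2.
exists b; last by rewrite eX eY eZ.
have full : mxact b {:vT} = {:vT}%VS.
  apply/eqP; rewrite eqEsubv subvf [X in (X <= _)%VS]e3 subv_add -{1}eZ limgS ?subvf //=.
  have -> : v3 = b *m std_vec 3 by rewrite bE.
  by rewrite -mxact_line limgS ?subvf.
have inv (j : 'I_4) : exists u : vT, b *m u = std_vec j.
  have : std_vec j \in mxact b {:vT} by rewrite full memvf.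
  by case/memv_imgP => u _ ->; exists u; rewrite lfunE.
have /fin_all_exists[u hu] := inv.
suff : b *m (\matrix_(i, j) u j i 0) = 1%:M by case/mulmx1_unit.
apply/matrixP => i j; rewrite !mxE.
have /matrixP/(_ i 0) := hu j; rewrite !mxE eqxx andbT => <-.
by apply: eq_bigr => l _; rewrite !mxE.
Qed.

Variable R : realType.

Section Averaging.
Variable f : {vspace vT} -> {vspace vT} -> bool.
Hypothesis f_sym : forall X Y, f X Y = f Y X.

Let pull (a : 'M[k]_4) X Y := f (mxact a X) (mxact a Y).
Let defect X Y Z : bool := f X Y (+) f X Z (+) f Y Z.
Let orbit_sum X Y Z : R :=
  \sum_(a : 'M[k]_4 | a \in unitmx) (defect (mxact a X) (mxact a Y) (mxact a Z))%:R.

Lemma defect01 X Y Z : defect X Y Z = defect Y X Z.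
Proof. by rewrite /defect (f_sym Y X); case: (f X Y) (f X Z) (f Y Z) => -[] []. Qed.

Lemma defect12 X Y Z : defect X Y Z = defect X Z Y.
Proof. by rewrite /defect (f_sym Z Y); case: (f X Y) (f X Z) (f Y Z) => -[] []. Qed.

Lemma orbit_sum01 X Y Z : orbit_sum X Y Z = orbit_sum Y X Z.
Proof. by apply: eq_bigr => a _; rewrite defect01. Qed.

Lemma orbit_sum12 X Y Z : orbit_sum X Y Z = orbit_sum X Z Y.
Proof. by apply: eq_bigr => a _; rewrite defect12. Qed.

(** The symmetry of the defect allows the flag to be sorted by dimension; a right translation of the
    group then carries it to the standard one. *)
Lemma orbit_sum_const X Y Z : flag X Y Z ->
  orbit_sum X Y Z = orbit_sum std_line std_plane std_solid.
Proof.
wlog XY : X Y Z / (\dim X < \dim Y)%N => [th h|].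
  have := h => /and5P[_ _ _ iXY _]; move: iXY; rewrite incidentE => /orP[|] /andP[_ d].
    exact: th.
  by rewrite orbit_sum01; apply: th; rewrite // flag01.
wlog XZ : X Y Z XY / (\dim X < \dim Z)%N => [th h|].
  have := h => /and5P[_ _ _ _ /andP[iXZ _]]; move: iXZ.
  rewrite incidentE => /orP[|] /andP[_ d]; first exact: th.
  rewrite orbit_sum12 orbit_sum01; apply: th; rewrite // ?(ltn_trans d XY) //.
  by rewrite flag01 flag12.
wlog YZ : X Y Z XY XZ / (\dim Y < \dim Z)%N => [th h|].
  have := h => /and5P[_ _ _ _ /andP[_ iYZ]]; move: iYZ.
  rewrite incidentE => /orP[|] /andP[_ d]; first exact: th.
  by rewrite orbit_sum12; apply: th; rewrite // flag12.
move=> /and5P[/andP[pX _] pY /andP[_ pZ] iXY /andP[_ iYZ]].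
have sXY : (X <= Y)%VS.
  by move: iXY; rewrite incidentE => /orP[/andP[]//|/andP[_]]; rewrite ltnNge ltnW.
have sYZ : (Y <= Z)%VS.
  by move: iYZ; rewrite incidentE => /orP[/andP[]//|/andP[_]]; rewrite ltnNge ltnW.
have [dX dY dZ] : [/\ \dim X = 1%N, \dim Y = 2%N & \dim Z = 3%N].
  move: pX pZ XY YZ; move: (\dim X) (\dim Y) (\dim Z); clear => x y z; split; lia.
have [b ub [-> -> ->]] := flag_transitive dX dY dZ sXY sYZ.
rewrite /orbit_sum [RHS](reindex (fun a => a *m b)) /=; last first.
  exists (fun a => a *m invmx b) => a _; first by rewrite mulmxK.
  by rewrite mulmxKV.
apply: eq_big => [a|a _]; first by rewrite unitmx_mul ub andbT.
by rewrite !mxactM.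
Qed.

Let units : R := \sum_(a : 'M[k]_4 | a \in unitmx) 1.
Let flags : R := \sum_(X : {vspace vT}) \sum_(Y : {vspace vT}) \sum_(Z : {vspace vT}) flagw R X Y Z.
Let defects : R := \sum_(X : {vspace vT}) \sum_(Y : {vspace vT}) \sum_(Z : {vspace vT}) flagw R X Y Z * (defect X Y Z)%:R.

Lemma sum_flag_act (F : {vspace vT} -> {vspace vT} -> {vspace vT} -> R) a : a \in unitmx ->
  \sum_(X : {vspace vT}) \sum_(Y : {vspace vT}) \sum_(Z : {vspace vT}) F (mxact a X) (mxact a Y) (mxact a Z) = \sum_(X : {vspace vT}) \sum_(Y : {vspace vT}) \sum_(Z : {vspace vT}) F X Y Z.
Proof.
move=> ua; have bij : bijective (mxact a) by exists (mxact (invmx a)); [exact: mxactK|exact: mxactKV].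
have on P : {on P, bijective (mxact a)} by exact: onW_bij.
rewrite [RHS](reindex (mxact a)) //; apply: eq_bigr => X _.
rewrite [RHS](reindex (mxact a)) //; apply: eq_bigr => Y _.
by rewrite [RHS](reindex (mxact a)).
Qed.

(** Double counting of pairs of a group element and a flag, as each group element permutes the
    flags. *)
Lemma orbit_sum_total :
  flags * orbit_sum std_line std_plane std_solid = units * defects.
Proof.
transitivity (\sum_(X : {vspace vT}) \sum_(Y : {vspace vT}) \sum_(Z : {vspace vT}) flagw R X Y Z * orbit_sum X Y Z).
  rewrite /flags mulr_suml; apply: eq_bigr => X _; rewrite mulr_suml.
  apply: eq_bigr => Y _; rewrite mulr_suml; apply: eq_bigr => Z _.
  by rewrite /flagw; case: (boolP (flag X Y Z)) => [/orbit_sum_const ->|_]; rewrite ?mul0r.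
transitivity (\sum_(a : 'M[k]_4 | a \in unitmx)
  \sum_(X : {vspace vT}) \sum_(Y : {vspace vT}) \sum_(Z : {vspace vT}) flagw R X Y Z * (defect (mxact a X) (mxact a Y) (mxact a Z))%:R).
  rewrite [RHS]exchange_big; apply: eq_bigr => X _.
  rewrite [RHS]exchange_big; apply: eq_bigr => Y _.
  by rewrite [RHS]exchange_big; apply: eq_bigr => Z _; rewrite /orbit_sum mulr_sumr.
rewrite /units mulr_suml; apply: eq_bigr => a ua; rewrite mul1r -[RHS](sum_flag_act _ ua).
do 3! (apply: eq_bigr => ? _); by rewrite /flagw mxact_flag.
Qed.

Hypothesis f_min : forall g : {vspace vT} -> bool,
  \sum_(X : {vspace vT}) \sum_(Y : {vspace vT}) edgew R X Y * (f X Y)%:R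
    <= \sum_(X : {vspace vT}) \sum_(Y : {vspace vT}) edgew R X Y * (f X Y (+) g X (+) g Y)%:R.

Lemma chain_defect_sum X Y Z : chain X Y Z ->
  \sum_(a : 'M[k]_4 | a \in unitmx) (chain_defect (pull a) X Y Z)%:R
    <= orbit_sum std_line std_plane std_solid.
Proof.
move=> /and5P[pX pY pZ XY YZ].
have os0 : 0 <= orbit_sum std_line std_plane std_solid by apply: sumr_ge0 => a _.
have [->|nXY] := eqVneq X Y.
  rewrite big1 // => a _; rewrite /chain_defect /degen eqxx /=.
  by case: (Y != Z); case: (pull a Y Z).
have [->|nYZ] := eqVneq Y Z.
  rewrite big1 // => a _; rewrite /chain_defect /degen eqxx /=.
  by case: (X != Z); case: (pull a X Z).
have nXZ : X != Z by apply: contraNneq nXY => e; rewrite eqEsubv XY e YZ.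
have fl : flag X Y Z.
  by rewrite /flag /incident pX pY pZ nXY nXZ nYZ XY YZ (subv_trans XY YZ).
rewrite -(orbit_sum_const fl); apply: ler_sum => a _.
rewrite /chain_defect !degen_neq // /defect -/(pull a X Y) -/(pull a X Z) -/(pull a Y Z).
by rewrite [X in (nat_of_bool X)%:R <= _]addbAC.
Qed.

Lemma edgew_act a X Y : a \in unitmx -> edgew R (mxact a X) (mxact a Y) = edgew R X Y.
Proof.
move=> ua; have bij : bijective (mxact a) by exists (mxact (invmx a)); [exact: mxactK|exact: mxactKV].
rewrite /edgew [LHS](reindex (mxact a)); last exact: onW_bij.
by apply: eq_bigr => Z _; rewrite /flagw mxact_flag.
Qed.

Lemma edgew_ge0 X Y : 0 <= edgew R X Y.
Proof. by apply: sumr_ge0 => Z _; exact: flagw_ge0. Qed.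

Let base : {vspace vT} := std_line.
Let axis : {vspace vT} := std_plane.

Lemma std_dims : \dim base = 1%N /\ \dim axis = 2%N.
Proof.
have ne j : std_vec j != 0.
  by apply/eqP => /matrixP/(_ j 0); rewrite !mxE !eqxx => /eqP; rewrite oner_eq0.
have d1 : \dim base = 1%N by rewrite dim_vline ne.
split=> //; rewrite dim_add_line ?d1 //.
apply/negP => /vlineP[c /matrixP/(_ 1 0)]; rewrite !mxE !eqxx /= mulr0 => /eqP.
by rewrite oner_eq0.
Qed.

(** Union bound: if the cone fails on X Y for the function pulled back by [a], one of at most 12
    chains has odd defect there, and each chain does so for at most [orbit_sum] many [a]. *)
Lemma cone_orbit_bound X Y :
  \sum_(a : 'M[k]_4 | a \in unitmx) edgew R X Y *
     (pull a X Y (+) cone base axis (pull a) X (+) cone base axis (pull a) Y)%:R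
  <= edgew R X Y * (12 * orbit_sum std_line std_plane std_solid).
Proof.
set N := orbit_sum _ _ _.
have N0 : 0 <= N by apply: sumr_ge0 => a _.
have [->|e0] := eqVneq (edgew R X Y) 0.
  by rewrite mul0r big1 // => a _; rewrite mul0r.
rewrite -mulr_sumr ler_wpM2l ?edgew_ge0 //.
have [Z /and5P[pX pY _ iXY _]] : exists Z, flag X Y Z.
  apply: contrapT => nf; move/eqP: e0; apply; apply: big1 => Z _.
  by rewrite /flagw; case: (boolP (flag X Y Z)) => // h; case: nf; exists Z.
have [db da] := std_dims.
have [s hs [sc sf]] := cone_fill_incident db da (addvSl _ _) pX pY iXY.
apply: le_trans (_ : \sum_(t <- s) N <= _); last first.
  by rewrite big_const_seq count_predT iter_addr_0 -[leLHS]mulr_natl ler_wpM2r // ler_nat.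
apply: le_trans (_ : \sum_(t <- s) \sum_(a : 'M[k]_4 | a \in unitmx)
   (chain_defect (pull a) t.1.1 t.1.2 t.2)%:R <= _); last first.
  rewrite big_seq [leRHS]big_seq; apply: ler_sum => t ts.
  by apply: chain_defect_sum; move/allP: sc => /(_ t ts).
rewrite exchange_big; apply: ler_sum => a _ /=.
have psym U W : pull a U W = pull a W U by exact: f_sym.
have [/(sf (pull a) psym) ->|] := boolP (all (fun t => ~~ chain_defect (pull a) t.1.1 t.1.2 t.2) s).
  by apply: sumr_ge0.
rewrite -has_predC => /hasP[t ts /=]; rewrite negbK => ht.
rewrite (big_rem t) //= ht; apply: le_trans (_ : 1 <= _).
  by rewrite lern1 leq_b1.
by rewrite lerDl; apply: sumr_ge0.
Qed.

(** No good position of the cone is selected: minimality compares [f] with the coboundary of every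
    translated cone, and the comparisons are summed over the group. *)
Lemma flag_coboundary_expansion :
  \sum_(X : {vspace vT}) \sum_(Y : {vspace vT}) edgew R X Y * (f X Y)%:R <= 12 * defects.
Proof.
have units0 : 0 < units.
  rewrite /units sumr_const ltr0n; apply/card_gt0P; exists 1%:M; exact: unitmx1.
rewrite -(ler_pM2l units0) mulrCA -orbit_sum_total mulrCA.
set LHS := \sum_X \sum_Y _.
apply: le_trans (_ : \sum_(a : 'M[k]_4 | a \in unitmx) \sum_(X : {vspace vT}) \sum_(Y : {vspace vT})
  edgew R X Y * (pull a X Y (+) cone base axis (pull a) X (+) cone base axis (pull a) Y)%:R <= _).
  rewrite /units mulr_suml; apply: ler_sum => a ua; rewrite mul1r.
  (* The potential of the pulled back function, carried back by the inverse of [a], is that of the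
     cone with apex and axis moved by [a]. *)
  apply: le_trans (f_min (fun X => cone base axis (pull a) (mxact (invmx a) X))) _.
  have bij : bijective (mxact a) by exists (mxact (invmx a)); [exact: mxactK|exact: mxactKV].
  rewrite [leLHS](reindex (mxact a)); last exact: onW_bij.
  apply: ler_sum => X _; rewrite [leLHS](reindex (mxact a)); last exact: onW_bij.
  by apply: ler_sum => Y _; rewrite edgew_act // !mxactK.
rewrite exchange_big /flags mulr_suml; apply: ler_sum => X _.
rewrite exchange_big mulr_suml; apply: ler_sum => Y _.
exact: cone_orbit_bound.
Qed.
End Averaging.
End FlagExpansion.

(** * Residue field and lattices *)

Section Valuation.
Variables (F : fieldType) (v : F -> int) (q : nat).
Hypothesis hF : local_field v q.

Lemma val1 : v 1 = 0.
Proof.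
have h : v (1 * 1) = v 1 + v 1 := val_mul hF (oner_neq0 F) (oner_neq0 F).
by move: h; rewrite mulr1; lia.
Qed.

Lemma valN1 : v (-1) = 0.
Proof.
have n0 : (-1 : F) != 0 by rewrite oppr_eq0 oner_neq0.
by have := val_mul hF n0 n0; rewrite mulrNN mulr1 val1; lia.
Qed.

Lemma valN x : v (- x) = v x.
Proof.
have [->|x0] := eqVneq x 0; first by rewrite oppr0.
rewrite -mulN1r (val_mul hF) ?valN1 ?add0r // oppr_eq0; exact: oner_neq0.
Qed.

Lemma valV x : x != 0 -> v x^-1 = - v x.
Proof.
move=> x0; have := val_mul hF x0 (invr_neq0 x0); rewrite divff // val1; lia.
Qed.

Lemma valX x n : x != 0 -> v (x ^+ n) = v x *+ n.
Proof.
move=> x0; elim: n => [|n IH]; first by rewrite val1.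
by rewrite exprS (val_mul hF) ?expf_neq0 // IH mulrS.
Qed.

Lemma val_geE n x : (x \in val_ge v n) = (x == 0) || (n <= v x).
Proof. by []. Qed.

Lemma val_ge0 n : 0 \in val_ge v n.
Proof. by rewrite val_geE eqxx. Qed.

Lemma val_geD n x y : x \in val_ge v n -> y \in val_ge v n -> x + y \in val_ge v n.
Proof.
rewrite !val_geE; have [->|x0] := eqVneq x 0; first by rewrite add0r.
have [->|y0] := eqVneq y 0; first by rewrite addr0 (negPf x0).
have [//|s0] := eqVneq (x + y) 0 => /= hx hy.
by apply: le_trans (val_add hF x0 y0 s0); rewrite le_min hx.
Qed.

Lemma val_geN n x : (- x \in val_ge v n) = (x \in val_ge v n).
Proof. by rewrite !val_geE oppr_eq0 valN. Qed.

Lemma val_geB n x y : x \in val_ge v n -> y \in val_ge v n -> x - y \in val_ge v n.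
Proof. by move=> hx hy; rewrite val_geD // val_geN. Qed.

Lemma val_geM m n x y : x \in val_ge v m -> y \in val_ge v n -> x * y \in val_ge v (m + n).
Proof.
rewrite !val_geE; have [->|x0] := eqVneq x 0; first by rewrite mul0r eqxx.
have [->|y0] := eqVneq y 0; first by rewrite mulr0 eqxx.
by rewrite (val_mul hF) //= => hx hy; rewrite lerD // orbT.
Qed.

Lemma val_ge_le m n x : m <= n -> x \in val_ge v n -> x \in val_ge v m.
Proof. by move=> mn; rewrite !val_geE => /orP[->//|h]; rewrite (le_trans mn h) orbT. Qed.

Lemma val_ge_sum n (I : finType) (f : I -> F) :
  (forall i, f i \in val_ge v n) -> \sum_i f i \in val_ge v n.
Proof. by move=> h; elim/big_ind: _ => // *; [exact: val_ge0|exact: val_geD]. Qed.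

Lemma val_ring1 : 1 \in valring v.
Proof. by rewrite val_geE val1 lexx orbT. Qed.

Lemma val_ringM x y : x \in valring v -> y \in valring v -> x * y \in valring v.
Proof. by move=> hx hy; have := val_geM hx hy; rewrite addr0. Qed.

Lemma val_ring_ideal n x y : x \in valring v -> y \in val_ge v n -> x * y \in val_ge v n.
Proof. by move=> hx hy; have := val_geM hx hy; rewrite add0r. Qed.

Local Notation O := (valring v).
Local Notation M := (val_ge v 1).

Lemma residue_class_eq x y : x \in O -> y \in O ->
  (residue_class v x = residue_class v y) <-> x - y \in M.
Proof.
move=> hx hy; split=> [e|h].
  have : residue_class v x x by rewrite /residue_class /= subrr val_ge0.
  by rewrite e.
apply/seteqP; split=> z; rewrite /residue_class /= => hz.
  have -> : z - y = (z - x) + (x - y) by ring.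
  exact: val_geD.
have -> : z - x = (z - y) - (x - y) by ring.
exact: val_geB.
Qed.

(* The carrier is 'I_q, identified with the set of residue classes through a
   chosen bijection, so that finiteness comes for free. *)
Definition resfield of local_field v q : Type := 'I_q.
Local Notation k := (resfield hF).
HB.instance Definition _ := Finite.on k.

Fact residue_bij : exists f : set F -> nat, set_bij (residue_field v) `I_q f.
Proof. by apply/card_set_bijP; exact: residue_card hF. Qed.

Let f := projT1 (cid residue_bij).
Let f_bij : set_bij (residue_field v) `I_q f := projT2 (cid residue_bij).

(** Makes [residue] total: elements outside O receive the class of 0. *)
Let trunc x := if x \in O then x else 0.

Lemma trunc_O x : trunc x \in O.
Proof. by rewrite /trunc; case: ifP => // _; exact: val_ge0. Qed.

Fact residue_lt x : (f (residue_class v (trunc x)) < q)%N.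
Proof.
by case: f_bij => + _ _; apply; exists (trunc x); [exact: trunc_O|].
Qed.

Definition residue x : k := Ordinal (residue_lt x).

Lemma residueP x y : x \in O -> y \in O -> (residue x = residue y) <-> x - y \in M.
Proof.
move=> hx hy; rewrite -residue_class_eq //.
have tx z : z \in O -> trunc z = z by rewrite /trunc => ->.
split=> [/(congr1 val) /=|e]; last by apply: val_inj; rewrite /= !tx // e.
rewrite !tx //; case: f_bij => _ inj _; apply: inj; rewrite inE.
  by exists x.
by exists y.
Qed.

Lemma residue_surj (c : k) : exists2 x, x \in O & residue x = c.
Proof.
case: f_bij => _ _ /(_ (val c) (ltn_ord c)) [_ [x hx <-] e].
by exists x => //; apply: val_inj; rewrite /= /trunc hx.
Qed.

Definition lift (c : k) : F := projT1 (cid2 (residue_surj c)).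

Lemma lift_O c : lift c \in O.
Proof. by rewrite /lift; case: cid2. Qed.

Lemma liftK c : residue (lift c) = c.
Proof. by rewrite /lift; case: cid2. Qed.

Lemma lift_residue x : x \in O -> lift (residue x) - x \in M.
Proof. by move=> hx; apply/(residueP (lift_O _) hx); rewrite liftK. Qed.

(** The operations are computed on chosen lifts; [kaddE] and [kmulE] show that any representatives
    in O may be used, and the ring laws descend from F. *)
Definition kadd (c d : k) := residue (lift c + lift d).
Definition kmul (c d : k) := residue (lift c * lift d).
Definition kopp (c : k) := residue (- lift c).
Definition kinv (c : k) := if c == residue 0 then residue 0 else residue (lift c)^-1.

Lemma kaddE x y : x \in O -> y \in O -> kadd (residue x) (residue y) = residue (x + y).
Proof.
move=> hx hy; apply/(residueP (val_geD (lift_O _) (lift_O _)) (val_geD hx hy)).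
rewrite (_ : _ - _ = (lift (residue x) - x) + (lift (residue y) - y)); last by ring.
by rewrite val_geD ?lift_residue.
Qed.

Lemma kmulE x y : x \in O -> y \in O -> kmul (residue x) (residue y) = residue (x * y).
Proof.
move=> hx hy; apply/(residueP (val_ringM (lift_O _) (lift_O _)) (val_ringM hx hy)).
rewrite (_ : _ - _ = lift (residue y) * (lift (residue x) - x)
  + x * (lift (residue y) - y)); last by ring.
by rewrite val_geD // val_ring_ideal ?lift_residue ?lift_O.
Qed.

Lemma koppE x : x \in O -> kopp (residue x) = residue (- x).
Proof.
move=> hx; apply/residueP; rewrite ?(val_geN 0) ?lift_O //.
by rewrite -opprD val_geN lift_residue.
Qed.

Let Oadd x y := @val_geD 0 x y.

Lemma kaddA : associative kadd.
Proof.
move=> a b c; rewrite -(liftK a) -(liftK b) -(liftK c) !kaddE ?Oadd ?lift_O //.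
by rewrite addrA.
Qed.
Lemma kaddC : commutative kadd.
Proof. by move=> a b; rewrite /kadd addrC. Qed.
Lemma kadd0 : left_id (residue 0) kadd.
Proof. by move=> a; rewrite -(liftK a) kaddE ?val_ge0 ?lift_O // add0r. Qed.
Lemma kaddN : left_inverse (residue 0) kopp kadd.
Proof. by move=> a; rewrite -(liftK a) koppE ?kaddE ?val_geN ?lift_O // addNr. Qed.

HB.instance Definition _ := GRing.isZmodule.Build k kaddA kaddC kadd0 kaddN.

Lemma kmulA : associative kmul.
Proof.
move=> a b c; rewrite -(liftK a) -(liftK b) -(liftK c) !kmulE ?val_ringM ?lift_O //.
by rewrite mulrA.
Qed.
Lemma kmulC : commutative kmul.
Proof. by move=> a b; rewrite /kmul mulrC. Qed.
Lemma kmul1 : left_id (residue 1) kmul.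
Proof. by move=> a; rewrite -(liftK a) kmulE ?val_ring1 ?lift_O // mul1r. Qed.
Lemma kmulD : left_distributive kmul kadd.
Proof.
move=> a b c; rewrite -(liftK a) -(liftK b) -(liftK c).
by rewrite !(kaddE, kmulE) ?Oadd ?val_ringM ?lift_O // mulrDl.
Qed.

Lemma residue_eq0 x : x \in O -> (residue x == residue 0) = (x \in M).
Proof.
move=> hx; apply/eqP/idP => [/residueP|h]; first by rewrite subr0 => ->//; exact: val_ge0.
by apply/residueP; rewrite ?subr0 ?val_ge0.
Qed.

Lemma kone : residue 1 != residue 0.
Proof. by rewrite residue_eq0 ?val_ring1 // val_geE oner_eq0 val1. Qed.

HB.instance Definition _ := GRing.Zmodule_isComNzRing.Build k kmulA kmulC kmul1 kmulD kone.

Lemma unit_val x : x \in O -> x \notin M -> [/\ x != 0, v x = 0 & x^-1 \in O].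
Proof.
rewrite !val_geE negb_or => /orP[/eqP->|h]; first by rewrite eqxx.
move=> /andP[x0 h1]; have e : v x = 0 by lia.
by split=> //; rewrite valV // e oppr0 lexx orbT.
Qed.

Lemma kmulV (c : k) : c != 0 -> kinv c * c = 1.
Proof.
move=> c0; rewrite /kinv (negPf c0) -[c in _ * c]liftK.
have [] := unit_val (lift_O c).
  by apply: contra c0 => h; rewrite -(liftK c) residue_eq0 ?lift_O.
move=> l0 _ hV; rewrite [LHS]kmulE ?lift_O // mulVf //.
Qed.

Lemma kinv0 : kinv 0 = 0.
Proof. by rewrite /kinv eqxx. Qed.

HB.instance Definition _ := GRing.ComNzRing_isField.Build k kmulV kinv0.

Lemma residueD x y : x \in O -> y \in O -> residue (x + y) = residue x + residue y.
Proof. by move=> hx hy; rewrite [RHS]kaddE. Qed.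
Lemma residueM x y : x \in O -> y \in O -> residue (x * y) = residue x * residue y.
Proof. by move=> hx hy; rewrite [RHS]kmulE. Qed.
Lemma residue0 : residue 0 = 0. Proof. by []. Qed.
Lemma residue1 : residue 1 = 1. Proof. by []. Qed.
Lemma residue_zero x : x \in O -> (residue x == 0) = (x \in M).
Proof. exact: residue_eq0. Qed.

Lemma card_resfield : #|{: k}| = q.
Proof. exact: card_ord. Qed.

End Valuation.

(** * Lattices between pi L and L as subspaces over the residue field *)

Section Lattices.
Local Open Scope classical_set_scope.
Local Open Scope ring_scope.
Variables (F : fieldType) (v : F -> int) (q : nat).
Hypothesis hF : local_field v q.
Local Notation O := (valring v).
Local Notation M := (val_ge v 1).
Local Notation k := (resfield hF).
Local Notation res := (residue hF).
Implicit Types (g h : 'M[F]_4) (U W : {vspace 'cV[k]_4}) (L N : set 'cV[F]_4).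

Lemma residue_sum (I : finType) (P : pred I) (f : I -> F) : (forall i, f i \in O) ->
  res (\sum_(i | P i) f i) = \sum_(i | P i) res (f i).
Proof.
move=> h.
suff [] : \sum_(i | P i) f i \in O /\ res (\sum_(i | P i) f i) = \sum_(i | P i) res (f i) by [].
apply: (big_rec2 (fun x y => x \in O /\ res x = y)) => [|i y x _ [hx <-]].
  by split; [exact: val_ge0|].
by split; [exact: (val_geD hF)|rewrite residueD].
Qed.

Lemma residue_prod (I : finType) (P : pred I) (f : I -> F) : (forall i, f i \in O) ->
  \prod_(i | P i) f i \in O /\ res (\prod_(i | P i) f i) = \prod_(i | P i) res (f i).
Proof.
move=> h.
apply: (big_rec2 (fun x y => x \in O /\ res x = y)) => [|i y x _ [hx <-]].
  by split; [exact: val_ring1 hF|].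
by split; [exact: (val_ringM hF)|rewrite residueM].
Qed.

Lemma residueN x : x \in O -> res (- x) = - res x.
Proof.
move=> hx; apply/eqP; rewrite -subr_eq0 opprK -residueD ?(val_geN hF) // addNr.
exact: eqxx.
Qed.

Lemma sign_O (b : bool) : (-1) ^+ b \in O /\ res ((-1) ^+ b) = (-1) ^+ b.
Proof.
case: b; last by split; [exact: val_ring1 hF|].
by rewrite expr1 residueN ?(val_ring1 hF) //; split=> //; rewrite (val_geN hF) (val_ring1 hF).
Qed.

Lemma residue_det n (A : 'M[F]_n) : (forall i j, A i j \in O) ->
  \det A \in O /\ res (\det A) = \det (map_mx res A).
Proof.
move=> h.
have t (s : {perm 'I_n}) : (-1) ^+ s * \prod_i A i (s i) \in O
    /\ res ((-1) ^+ s * \prod_i A i (s i)) = (-1) ^+ s * \prod_i map_mx res A i (s i).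
  have [s1 s2] := sign_O s.
  have [p1 p2] := @residue_prod _ predT (fun i => A i (s i)) (fun i => h _ _).
  split; first exact: (val_ringM hF).
  rewrite residueM // s2 p2; congr (_ * _); by apply: eq_bigr => i _; rewrite mxE.
split; first by apply: (val_ge_sum hF) => s; case: (t s).
rewrite /determinant residue_sum => [|s]; last by case: (t s).
by apply: eq_bigr => s _; case: (t s).
Qed.

(** The determinant has nonzero residue, hence is a unit of O, and the inverse is the adjugate
    divided by it. *)
Lemma mxO_unit n (A : 'M[F]_n) : (forall i j, A i j \in O) -> map_mx res A \in unitmx ->
  A \in unitmx /\ forall i j, invmx A i j \in O.
Proof.
move=> h; have [d1 d2] := residue_det h; rewrite unitmxE -d2 unitfE => d3.
have [] := unit_val hF d1; first by rewrite -(residue_zero hF d1).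
move=> d0 _ dV; have uA : A \in unitmx by rewrite unitmxE unitfE.
split=> // i j; rewrite /invmx uA !mxE (val_ringM hF) //.
rewrite /cofactor (val_ringM hF) //.
  by have [] := sign_O (odd (j + i)); rewrite signr_odd.
by have [] := @residue_det _ (row' j (col' i A)) (fun a b => ltac:(by rewrite !mxE; apply: h)).
Qed.

Lemma mxO_mul m n p (A : 'M[F]_(m, n)) (B : 'M[F]_(n, p)) :
  (forall i j, A i j \in O) -> (forall i j, B i j \in O) -> forall i j, (A *m B) i j \in O.
Proof.
by move=> hA hB i j; rewrite mxE; apply: (val_ge_sum hF) => l; exact: (val_ringM hF).
Qed.

Lemma residue_mul m n p (A : 'M[F]_(m, n)) (B : 'M[F]_(n, p)) :
  (forall i j, A i j \in O) -> (forall i j, B i j \in O) ->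
  map_mx res (A *m B) = map_mx res A *m map_mx res B.
Proof.
move=> hA hB; apply/matrixP => i j; rewrite !mxE residue_sum => [|l]; last exact: (val_ringM hF).
by apply: eq_bigr => l _; rewrite residueM // !mxE.
Qed.

Lemma lift_mx m n (A : 'M[k]_(m, n)) :
  (forall i j, map_mx (lift (hF := hF)) A i j \in O) /\
  map_mx res (map_mx (lift (hF := hF)) A) = A.
Proof.
split=> [i j|]; first by rewrite mxE lift_O.
by apply/matrixP => i j; rewrite !mxE liftK.
Qed.

(* U <-> mid g U matches the subspaces of k^4 with the lattices between
   pi (g O^4) and g O^4. *)
Definition mid g U : set 'cV[F]_4 :=
  [set g *m u | u in [set u | u \is a mxOver O /\ map_mx res u \in U]].

Definition osub N : Prop :=
  (forall x y, N x -> N y -> N (x + y)) /\ (forall a x, a \in O -> N x -> N (a *: x)).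

Lemma mxOverO m n (A : 'M[F]_(m, n)) : (A \is a mxOver O) <-> (forall i j, A i j \in O).
Proof. by split=> [/mxOverP//|h]; apply/mxOverP. Qed.

Lemma mid_full g : mid g fullv = lattice_of v g.
Proof.
apply/seteqP; split=> _ [u hu <-]; exists u => //; first by case: hu.
by split=> //; rewrite memvf.
Qed.

Lemma osub_mid g U : osub (mid g U).
Proof.
split=> [_ _ [x [/mxOverO hx Ux] <-] [y [/mxOverO hy Uy] <-]|a _ ha [x [/mxOverO hx Ux] <-]].
  exists (x + y); last by rewrite mulmxDr.
  split; first by apply/mxOverO => i j; rewrite mxE (val_geD hF).
  have -> : map_mx res (x + y) = map_mx res x + map_mx res y.
    by apply/matrixP => i j; rewrite !mxE residueD.
  exact: memvD.
exists (a *: x); last by rewrite -scalemxAr.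
split; first by apply/mxOverO => i j; rewrite mxE (val_ringM hF).
have -> : map_mx res (a *: x) = res a *: map_mx res x.
  by apply/matrixP => i j; rewrite !mxE residueM.
exact: memvZ.
Qed.

Variable pi : F.
Hypothesis hpi : uniformizer v pi.

Lemma pi_neq0 : pi != 0. Proof. by case: hpi. Qed.
Lemma val_pi : v pi = 1. Proof. by case: hpi. Qed.

Lemma val_ge1P x : (x \in M) = (x / pi \in O).
Proof.
rewrite /valring !val_geE; have [->|x0] := eqVneq x 0; first by rewrite mul0r eqxx.
rewrite mulf_eq0 invr_eq0 (negPf x0) (negPf pi_neq0) /=.
rewrite (val_mul hF) ?invr_neq0 ?pi_neq0 // (valV hF) ?pi_neq0 // val_pi; lia.
Qed.

Lemma mid_zero g : mid g 0%VS = scale_lattice pi (lattice_of v g).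
Proof.
apply/seteqP; split=> [_ [u [/mxOverO hu u0'] <-]|_ [_ [u /mxOverO hu <-] <-]].
  move: u0'; rewrite memv0 => /eqP /matrixP u0.
  exists (g *m (pi^-1 *: u)); last by rewrite -scalemxAr scalerA divff ?pi_neq0 // scale1r.
  exists (pi^-1 *: u) => //; apply/mxOverO => i j; rewrite mxE mulrC -val_ge1P.
  by have := u0 i j; rewrite !mxE -(residue_zero hF (hu i j)) => ->.
exists (pi *: u); last by rewrite -scalemxAr.
have h i j : pi * u i j \in M by rewrite mulrC val_ge1P mulfK ?pi_neq0.
have h2 i j : pi * u i j \in O by apply: val_ge_le (h i j).
split; first by apply/mxOverO => i j; rewrite mxE h2.
rewrite memv0; apply/eqP/matrixP => i j; rewrite !mxE; apply/eqP.
by rewrite residue_zero.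
Qed.

Lemma mid_sub g U W : g \in unitmx -> (mid g U `<=` mid g W) <-> (U <= W)%VS.
Proof.
move=> ug; split=> [h|/subvP h _ [u [hu Uu] <-]]; last by exists u => //; split=> //; exact: h.
apply/subvP => c Uc; have [l1 l2] := lift_mx c.
have : mid g U (g *m map_mx (lift (hF := hF)) c).
  by exists (map_mx (lift (hF := hF)) c) => //; split; [apply/mxOverO|rewrite l2].
move/h => [u' [_ hu'] /(can_inj (mulKmx ug)) e].
by rewrite -l2 -e.
Qed.

Lemma mid_inj g U W : g \in unitmx -> mid g U = mid g W -> U = W.
Proof.
move=> ug e; apply/eqP; rewrite eqEsubv; apply/andP.
by split; apply/(mid_sub _ _ ug); rewrite e.
Qed.

(** Let [B] in GL_4(O) lift a basis of k^4 whose first r vectors span U. Then the columns of g B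
    diag(1, ..., 1, pi, ..., pi), with r ones, are a basis of [mid g U]. *)
Lemma lattice_mid g U : g \in unitmx -> lattice v (mid g U).
Proof.
move=> ug.
(* The matrix of a projection onto U; its [col_ebase] is the adapted basis. *)
pose A : 'M[k]_4 := \matrix_(i, j) (projv U (delta_mx j 0)) i 0.
have AE (x : 'cV[k]_4) : A *m x = projv U x.
  rewrite [x in projv U x](_ : x = \sum_j x j 0 *: delta_mx j 0); last first.
    apply/matrixP => i j; rewrite summxE (bigD1 i) //= !mxE !eqxx ord1 mulr1 big1 ?addr0 //.
    by move=> l ne; rewrite !mxE eq_sym (negPf ne) mulr0.
  rewrite linear_sum; apply/matrixP => i j; rewrite mxE summxE ord1.
  by apply: eq_bigr => l _; rewrite linearZ !mxE mulrC.
pose b := col_ebase A; pose r := \rank A.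
have ub : b \in unitmx by exact: col_ebase_unit.
have memU x : x \in U <-> forall i : 'I_4, (r <= i)%N -> (invmx b *m x) i 0 = 0.
  split=> [Ux i ri|h].
    have : A *m x = x by rewrite AE projv_id.
    rewrite -{1}(mulmx_ebase A) -!mulmxA => <-; rewrite mulKmx //.
    rewrite mxE big1 // => j _; rewrite mxE.
    by rewrite ltnNge ri andbF mul0r.
  have -> : x = A *m (invmx (row_ebase A) *m (invmx b *m x)).
    rewrite -{1}(mulmx_ebase A) -!mulmxA [row_ebase A *m _]mulmxA mulmxV ?row_ebase_unit //.
    rewrite mul1mx -[LHS](mulKVmx ub); congr (_ *m _).
    apply/matrixP => i j; rewrite ord1 [RHS]mxE (bigD1 i) //= big1 ?addr0; last first.
      move=> l ne; rewrite mxE (_ : (i == l :> nat) = false) ?mul0r //.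
      by apply/negbTE; rewrite eq_sym.
    rewrite [pid_mx _ _ _]mxE eqxx /=.
    by case: (ltnP i r) => ir; rewrite ?mul1r // h // mulr0.
  by rewrite AE memv_proj.
pose B : 'M[F]_4 := map_mx (lift (hF := hF)) b.
have [BO Bb] := lift_mx b.
have [uB BV] : B \in unitmx /\ forall i j, invmx B i j \in O by apply: mxO_unit; rewrite // Bb.
pose d i : F := if (i < r)%N then 1 else pi.
pose D : 'M[F]_4 := diag_mx (\row_i d i).
have d0 i : d i != 0 by rewrite /d; case: ifP; rewrite ?oner_neq0 ?pi_neq0.
have DE (y : 'cV[F]_4) i j : (D *m y) i j = d i * y i j.
  by rewrite mul_diag_mx !mxE.
have redV : map_mx res (invmx B) = invmx b.
  apply: (can_inj (mulKmx ub)); rewrite mulmxV // -{1}Bb -residue_mul // mulmxV //.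
  by apply/matrixP => i j; rewrite !mxE; case: eqP => _; rewrite ?residue1 ?residue0.
exists (g *m B *m D).
  rewrite !unitmx_mul ug uB /= unitmxE det_diag unitfE.
  by apply/prodf_neq0 => i _; rewrite mxE d0.
apply/seteqP; split=> _ [u hu' <-].
  move: hu' => [/mxOverO hu /memU hU].
  pose y : 'cV[F]_4 := \matrix_(i, j) ((invmx B *m u) i j / d i).
  exists y.
    apply/mxOverO => i j; rewrite mxE /d.
    have wO := mxO_mul BV hu i j.
    case: ltnP => ri; first by rewrite divr1.
    rewrite -val_ge1P -(residue_zero hF wO); move: (hU i ri).
    by rewrite -redV -residue_mul // mxE ord1 => ->.
  rewrite -!mulmxA; congr (_ *m _).
  rewrite -[RHS](mulKVmx uB); congr (_ *m _); apply/matrixP => i j.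
  by rewrite DE [y i j]mxE mulrC divfK.
move: hu' => /mxOverO hu; exists (B *m (D *m u)); last by rewrite !mulmxA.
have dO i : d i \in O.
  rewrite /d; case: ifP => _; first exact: val_ring1 hF.
  by rewrite val_geE val_pi orbT.
have DuO i j : (D *m u) i j \in O by rewrite DE (val_ringM hF).
split; first by apply/mxOverO; exact: mxO_mul.
apply/memU => i ri; rewrite residue_mul // Bb mulKmx // mxE DE; apply/eqP.
rewrite residue_zero; last by rewrite (val_ringM hF).
by rewrite /d ltnNge ri /= mulrC val_ge1P mulfK ?pi_neq0.
Qed.

(** U collects the residues of the coordinates of elements of N. Since N contains pi L, membership
    in N depends only on the residue. *)
Lemma mid_of_osub g N : g \in unitmx -> osub N ->
  scale_lattice pi (lattice_of v g) `<=` N -> N `<=` lattice_of v g ->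
  exists U, N = mid g U.
Proof.
move=> ug [ND NZ] piN NL.
pose good (c : 'cV[k]_4) := exists u, [/\ u \is a mxOver O, N (g *m u) & map_mx res u = c].
have good0 : good 0.
  exists 0; split; first by apply/mxOverO => i j; rewrite mxE val_ge0.
    apply: piN; exists (g *m 0); last by rewrite mulmx0 scaler0.
    by exists 0 => //; apply/mxOverO => i j; rewrite mxE val_ge0.
  by apply/matrixP => i j; rewrite !mxE.
have goodD c d : good c -> good d -> good (c + d).
  move=> [x [/mxOverO xO Nx <-]] [y [/mxOverO yO Ny <-]]; exists (x + y); split.
  - by apply/mxOverO => i j; rewrite mxE (val_geD hF).
  - by rewrite mulmxDr; exact: ND.
  - by apply/matrixP => i j; rewrite !mxE residueD.
have goodZ a c : good c -> good (a *: c).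
  move=> [x [/mxOverO xO Nx <-]]; exists (lift a *: x); split.
  - by apply/mxOverO => i j; rewrite mxE (val_ringM hF) // lift_O.
  - by rewrite -scalemxAr; apply: NZ; rewrite ?lift_O.
  - by apply/matrixP => i j; rewrite !mxE residueM ?lift_O // liftK.
(* k^4 is finite, so the good residues can be listed; being closed under sums and multiples, they
   exhaust their span. *)
pose X := [seq c <- enum {: 'cV[k]_4} | `[< good c >]].
have goodX c : c \in <<X>>%VS -> good c.
  move=> cX; rewrite (coord_span (X := in_tuple X) cX); elim/big_ind: _ => // i _.
  apply: goodZ; have : (in_tuple X)`_i \in X by apply: mem_nth.
  by rewrite mem_filter => /andP[/asboolP].
exists <<X>>%VS; apply/seteqP; split=> [x Nx|_ [u [uO /goodX [u' [u'O Nu' e]]] <-]].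
  have [u uO e] := NL x Nx; exists u => //; split=> //; apply: memv_span.
  by rewrite mem_filter mem_enum andbT; apply/asboolP; exists u; rewrite e.
rewrite (_ : g *m u = g *m u' + g *m (u - u')); last by rewrite mulmxBr addrC subrK.
apply: ND => //; apply: piN; rewrite -mid_zero; exists (u - u') => //.
move: uO u'O => /mxOverO uO /mxOverO u'O.
split; first by apply/mxOverO => i j; rewrite !mxE (val_geB hF).
rewrite memv0; apply/eqP/matrixP => i j; move/matrixP: e => /(_ i j).
by rewrite !mxE residueD ?(val_geN hF) // residueN // => ->; rewrite subrr.
Qed.

Lemma scale_mid c g U : scale_lattice c (mid g U) = mid (c *: g) U.
Proof.
apply/seteqP; split=> [_ [_ [u hu <-] <-]|_ [u hu <-]].
  by exists u => //; rewrite scalemxAl.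
by exists (g *m u); [exists u|rewrite scalemxAl].
Qed.

Lemma scale_scale a b L : scale_lattice a (scale_lattice b L) = scale_lattice (a * b) L.
Proof.
apply/seteqP; split=> [_ [_ [u hu <-] <-]|_ [u hu <-]].
  by exists u => //; rewrite scalerA.
by exists (b *: u); [exists u|rewrite scalerA].
Qed.

Lemma scale1 L : scale_lattice 1 L = L.
Proof.
apply/seteqP; split=> [_ [u hu <-]|u hu]; first by rewrite scale1r.
by exists u => //; rewrite scale1r.
Qed.

Lemma scale_sub c L N : L `<=` N -> scale_lattice c L `<=` scale_lattice c N.
Proof. by move=> h _ [u /h hu <-]; exists u. Qed.

Lemma mem_homothety L : homothety_class L L.
Proof. by exists 1 => /=; [rewrite oner_neq0|rewrite scale1]. Qed.

Lemma homothety_scale c L : c != 0 -> homothety_class (scale_lattice c L) = homothety_class L.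
Proof.
move=> c0; apply/seteqP; split=> _ [a a0 <-].
  by exists (a * c); [rewrite /= mulf_neq0|rewrite scale_scale].
exists (a / c); first by rewrite /= mulf_neq0 ?invr_neq0.
by rewrite scale_scale divfK.
Qed.

Lemma homothety_eq L N : homothety_class L = homothety_class N ->
  exists2 c, c != 0 & N = scale_lattice c L.
Proof. by move=> e; have := mem_homothety N; rewrite -e => -[c c0 <-]; exists c. Qed.

Lemma unitmxZ_F c g : c != 0 -> g \in unitmx -> c *: g \in unitmx.
Proof. by move=> c0; rewrite !unitmxE detZ !unitfE => h; rewrite mulf_neq0 ?expf_neq0. Qed.

Lemma scale_osub c N : c != 0 -> v c = 0 -> osub N -> scale_lattice c N = N.
Proof.
move=> c0 vc [_ NZ]; apply/seteqP; split=> [_ [u Nu <-]|u Nu].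
  by apply: NZ => //; rewrite /valring val_geE vc lexx orbT.
exists (c^-1 *: u); last by rewrite scalerA divff // scale1r.
by apply: NZ => //; rewrite /valring val_geE (valV hF) // vc oppr0 lexx orbT.
Qed.

Lemma scale_mid_sub0 c g U : 1 <= v c -> scale_lattice c (mid g U) `<=` mid g 0%VS.
Proof.
move=> vc _ [_ [u [/mxOverO uO _] <-] <-]; exists (c *: u); last by rewrite -scalemxAr.
have cM : c \in M by rewrite val_geE vc orbT.
have h i j : c * u i j \in M by rewrite mulrC (val_ring_ideal hF).
have h2 i j : c * u i j \in O by apply: val_ge_le (h i j).
split; first by apply/mxOverO => i j; rewrite mxE h2.
rewrite memv0; apply/eqP/matrixP => i j; rewrite !mxE; apply/eqP.
by rewrite residue_zero.
Qed.

(** A factor of positive valuation would push a lattice into [mid g 0], so the two lattices differ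
    by a unit, which fixes every O-module. The subspace 0 is excluded because its lattice is
    homothetic to that of [fullv]. *)
Lemma mid_class_inj g U W : g \in unitmx -> U != 0%VS -> W != 0%VS ->
  homothety_class (mid g U) = homothety_class (mid g W) -> U = W.
Proof.
move=> ug U0 W0 /homothety_eq[c c0 e].
have [vc|vc] := ltP (v c) 0.
  have e' : mid g U = scale_lattice c^-1 (mid g W).
    by rewrite e scale_scale mulVf // scale1.
  have : mid g U `<=` mid g 0%VS.
    by rewrite e'; apply: scale_mid_sub0; rewrite (valV hF) //; lia.
  by move/(mid_sub _ _ ug); rewrite subv0 (negPf U0).
have [vc0|vc0] := eqVneq (v c) 0.
  by apply: (mid_inj ug); rewrite e scale_osub //; exact: osub_mid.
have : mid g W `<=` mid g 0%VS by rewrite e; apply: scale_mid_sub0; lia.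
by move/(mid_sub _ _ ug); rewrite subv0 (negPf W0).
Qed.

Lemma lattice_basis L : lattice v L -> exists2 g, g \in unitmx & L = mid g fullv.
Proof. by move=> [g ug ->]; exists g; rewrite ?mid_full. Qed.

Lemma exists_vertex L : lattice v L -> exists x : bvertex v, set_val x = homothety_class L.
Proof.
move=> hL; have h : bvertices v (homothety_class L) by exists L.
by exists (SigSub (mem_set h)).
Qed.

Lemma mul_mid h g U : [set h *m u | u in mid g U] = mid (h *m g) U.
Proof.
apply/seteqP; split=> [_ [_ [u hu <-] <-]|_ [u hu <-]].
  by exists u => //; rewrite mulmxA.
by exists (g *m u); [exists u|rewrite mulmxA].
Qed.

Lemma mul_homothety h L :
  [set [set h *m u | u in N] | N in homothety_class L] = homothety_class [set h *m u | u in L].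
Proof.
have e c : [set h *m u | u in scale_lattice c L] = scale_lattice c [set h *m u | u in L].
  apply/seteqP; split=> [_ [_ [u hu <-] <-]|_ [_ [u hu <-] <-]].
    by exists (h *m u); [exists u|rewrite scalemxAr].
  by exists (c *: u); [exists u|rewrite scalemxAr].
apply/seteqP; split=> [_ [_ [c c0 <-] <-]|_ [c c0 <-]].
  by exists c; rewrite // e.
by exists (scale_lattice c L); [exists c|].
Qed.

Lemma translate_mid c g U (x y : bvertex v) : set_val x = homothety_class (mid g U) ->
  translate c x y <-> set_val y = homothety_class (mid (c *m g) U).
Proof. by move=> ex; rewrite /translate ex mul_homothety mul_mid. Qed.

Lemma bbasisP (x : bvertex v) : bbasis x \in unitmx /\
  set_val x = homothety_class (mid (bbasis x) fullv).
Proof.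
rewrite /bbasis mid_full; case: xgetP => [g _ [ug ex]//|no].
have [L [g ug ->] ex] := set_valP x.
by case: (no g); split.
Qed.

End Lattices.

(** * Links of the quotient complex *)

Section Quotient.
Local Open Scope classical_set_scope.
Local Open Scope ring_scope.
Variables (F : fieldType) (v : F -> int) (q : nat).
Hypothesis hF : local_field v q.
Variable pi : F.
Hypothesis hpi : uniformizer v pi.
Variables (Gam : set 'M[F]_4) (V : finType) (p : bvertex v -> V) (X : {set {set V}}).
Hypothesis hX : quotient_complex Gam p X.
Local Notation k := (resfield hF).
Local Notation S4 := {vspace 'cV[k]_4}.
Local Notation hclass := homothety_class.
Implicit Types (U W A B C : S4) (x y : bvertex v) (u w : V) (L N : set 'cV[F]_4).

(** Proper U give neighbours of x and [fullv] gives x itself, in the coordinates of the chosen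
    [bbasis x]. *)
Definition nb x U : bvertex v :=
  projT1 (cid (exists_vertex (lattice_mid hpi U (proj1 (bbasisP hF x))))).

Lemma nbE x U : set_val (nb x U) = hclass (mid (bbasis x) U).
Proof. by rewrite /nb; case: cid. Qed.

Lemma nb_eq x y U : set_val y = hclass (mid (bbasis x) U) -> y = nb x U.
Proof. by move=> e; apply: val_inj; apply: (etrans e); rewrite -nbE. Qed.

Lemma nb_full x : nb x fullv = x.
Proof. by apply/esym/nb_eq; case: (bbasisP hF x). Qed.

Lemma bcell_chain g (W : nat -> S4) i : g \in unitmx ->
  (forall j, (j < i)%N -> (W j.+1 <= W j)%VS && (W j.+1 != W j)) -> W i != 0%VS ->
  bcell i [set x : bvertex v | exists2 j, (j <= i)%N & set_val x = hclass (mid g (W j))].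
Proof.
move=> ug hW Wi; exists pi, (fun j => mid g (W j)); split=> //.
- by move=> j _; exact: (lattice_mid hpi).
- have sub0 : scale_lattice pi (mid g (W 0%N)) `<=` mid g (0%VS : S4).
    by apply: scale_mid_sub0; rewrite (val_pi hpi).
  split; first by apply: subset_trans sub0 _; apply/mid_sub; rewrite ?sub0v.
  by move=> /subset_trans /(_ sub0) /(mid_sub _ _ ug); rewrite subv0; apply/negP.
- move=> j ji; have /andP[sW nW] := hW j ji; split; first by apply/mid_sub.
  by move=> /(mid_sub _ _ ug) h; move/eqP: nW; apply; apply/eqP; rewrite eqEsubv sW.
Qed.

Lemma nb_adj x U : U != 0%VS -> U != fullv -> badj x (nb x U).
Proof.
move=> U0 Uf; have [ug _] := bbasisP hF x.
have := @bcell_chain (bbasis x) (fun j => if j is 0%N then fullv else U) 1 ug.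
move=> /(_ _ U0) h; rewrite /badj.
have -> : [set x; nb x U] = [set y : bvertex v | exists2 j, (j <= 1)%N &
   set_val y = hclass (mid (bbasis x) (if j is 0%N then fullv else U))].
  apply/seteqP; split=> y /=.
    by case=> ->; [exists 0%N => //; case: (bbasisP hF x)|exists 1%N => //; rewrite nbE].
  case=> -[|[|//]] _; first by move/nb_eq => ->; left; rewrite nb_full.
  by move/nb_eq => ->; right.
by apply: h => -[|//] _; rewrite subvf.
Qed.

Lemma badj_sym x y : badj x y -> badj y x.
Proof. by rewrite /badj setUC. Qed.

(** An element of Gam carrying y to x moves it by at most 2, hence is scalar, and scalars fix every
    homothety class. *)
Lemma far_inj x y : bdist_le 2 x y -> p x = p y -> x = y.
Proof.
move=> hd /esym e; have [g hg ht] := (quo_orbit hX y x).1 e.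
have [gU _ _ _] := quo_subgroup hX.
have [sc|/(quo_far hX) far] := boolP (is_scalar_mx g); last by case: (far y x hg ht).
move/is_scalar_mxP: sc => [c gE].
have c0 : c != 0.
  by have := gU g hg; rewrite gE unitmxE det_scalar unitfE expf_eq0.
have [_ ey] := bbasisP hF y; apply: val_inj.
move/(translate_mid _ _ ey): ht => ht; apply: (etrans ht).
by rewrite gE mul_scalar_mx -scale_mid homothety_scale // -ey.
Qed.

Lemma nb_inj x U W : U != 0%VS -> W != 0%VS -> p (nb x U) = p (nb x W) -> U = W.
Proof.
move=> U0 W0 e; have [ug _] := bbasisP hF x.
suff e2 : nb x U = nb x W.
  by apply: (mid_class_inj ug U0 W0); rewrite -!nbE e2.
apply: far_inj => //; exists x.
  by have [->|Uf] := eqVneq U fullv; [left; rewrite nb_full|right; apply: badj_sym; exact: nb_adj].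
exists (nb x W) => //.
by have [->|Wf] := eqVneq W fullv; [left; rewrite nb_full|right; exact: nb_adj].
Qed.

Definition rep u : bvertex v := projT1 (cid (quo_surj hX u)).

Lemma repK u : p (rep u) = u.
Proof. by rewrite /rep; case: cid. Qed.

(** Chart of the neighbourhood of [u] by subspaces of k^4, read off at one chosen vertex of the
    building above [u]. *)
Definition star u U : V := p (nb (rep u) U).

Lemma star_full u : star u fullv = u.
Proof. by rewrite /star nb_full repK. Qed.

Lemma star_inj u U W : U != 0%VS -> W != 0%VS -> star u U = star u W -> U = W.
Proof. exact: nb_inj. Qed.

(** An element of Gam carries the chosen vertex above [p x] to x and its basis along; a rescaling
    makes the frame span L. Thus the chart can be read off at any lift and any lattice in its
    class. *)
Lemma star_frame x L : set_val x = hclass L ->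
  exists g, [/\ g \in unitmx, mid g (fullv : S4) = L &
    forall W y, set_val y = hclass (mid g W) -> p y = star (p x) W].
Proof.
move=> ex; have /(quo_orbit hX)[c hc ht] : p (rep (p x)) = p x by rewrite repK.
have [gU _ _ _] := quo_subgroup hX.
have [ug e0] := bbasisP hF (rep (p x)).
move/(translate_mid _ _ e0): (ht); rewrite ex => /esym /homothety_eq[s s0 eL].
exists (s *: (c *m bbasis (rep (p x)))); split.
- by rewrite unitmxZ_F // unitmx_mul ug gU.
- by rewrite -scale_mid -eL.
move=> W y; rewrite -scale_mid homothety_scale // => ey; apply/esym.
apply/(quo_orbit hX); exists c => //.
by apply/(translate_mid _ _ (nbE _ _)).
Qed.

Definition cell4 (u x y z : V) := uniq [:: u; x; y; z] && ([set u; x; y; z]%SET \in X).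

Lemma star_cell (W : nat -> S4) i u : W 0%N = fullv ->
  (forall j, (j < i)%N -> (W j.+1 <= W j)%VS && (W j.+1 != W j)) -> W i != 0%VS ->
  [set star u (W (val j)) | j : 'I_i.+1]%SET \in X.
Proof.
move=> W0 hW Wi; have [ug _] := bbasisP hF (rep u).
apply/(quo_cells hX); right; exists i; eexists; split; first exact: bcell_chain ug hW Wi.
apply/seteqP; split=> [w /= /imsetP[j _ ->]|_ [x [j ji /nb_eq ->] <-]] /=.
  exists (nb (rep u) (W (val j))) => //; exists (val j); rewrite ?nbE //.
  by rewrite -ltnS ltn_ord.
by apply/imsetP; exists (Ordinal (ji : (j < i.+1)%N)).
Qed.

Lemma cell4P_star u A B C : flag A B C -> cell4 u (star u A) (star u B) (star u C).
Proof.
have perm01 (x y z : V) : cell4 u x y z = cell4 u y x z.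
  rewrite /cell4 (_ : [set u; x; y; z]%SET = [set u; y; x; z]%SET); last first.
    by apply/setP => w; rewrite !inE -!orbA; congr (_ || _); rewrite orbCA.
  congr (_ && _); rewrite /= !inE (eq_sym y x).
  by case: (u == x); case: (u == y); case: (u == z); case: (x == y); case: (x == z); case: (y == z).
have perm12 (x y z : V) : cell4 u x y z = cell4 u x z y.
  rewrite /cell4 (_ : [set u; x; y; z]%SET = [set u; x; z; y]%SET); last first.
    by apply/setP => w; rewrite !inE -!orbA; do 2! congr (_ || _); rewrite orbC.
  congr (_ && _); rewrite /= !inE (eq_sym z y).
  by case: (u == x); case: (u == y); case: (u == z); case: (x == y); case: (x == z); case: (y == z).
wlog AB : A B C / (\dim B < \dim A)%N => [th h|].
  have := h => /and5P[_ _ _ iXY _]; move: iXY; rewrite incidentE => /orP[|] /andP[_ d].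
    by rewrite perm01; apply: th; rewrite // flag01.
  exact: th.
wlog AC : A B C AB / (\dim C < \dim A)%N => [th h|].
  have := h => /and5P[_ _ _ _ /andP[iXZ _]]; move: iXZ.
  rewrite incidentE => /orP[|] /andP[_ d]; last exact: th.
  rewrite perm12 perm01; apply: th; rewrite // ?(ltn_trans AB d) //.
  by rewrite flag01 flag12.
wlog BC : A B C AB AC / (\dim C < \dim B)%N => [th h|].
  have := h => /and5P[_ _ _ _ /andP[_ iYZ]]; move: iYZ.
  rewrite incidentE => /orP[|] /andP[_ d]; last exact: th.
  by rewrite perm12; apply: th; rewrite // flag12.
move=> /and5P[pA pB pC iAB /andP[iAC iBC]].
have dec (U U' : S4) : incident U U' -> (\dim U' < \dim U)%N -> (U' <= U)%VS && (U' != U).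
  rewrite /incident eq_sym => /andP[-> /orP[/dimvS|-> //]] h1 h2.
  by move: h2; rewrite ltnNge h1.
have n0 (U : S4) : proper U -> U != 0%VS by case/andP => h _; rewrite -dimv_eq0 -lt0n.
have nf (U : S4) : proper U -> (U <= fullv)%VS && (U != fullv).
  case/andP => _ h; rewrite subvf; apply: contraTneq h => ->.
  by rewrite dim_full.
have f0 : (fullv : S4) != 0%VS by rewrite -dimv_eq0 dim_full.
pose W (j : nat) : S4 := nth 0%VS [:: fullv; A; B; C] j.
have := @star_cell W 3 u erefl _ (n0 _ pC); rewrite /cell4 => hc.
apply/andP; split; last first.
  rewrite (_ : [set _; _; _; _]%SET = [set star u (W (val j)) | j : 'I_4]%SET).
    by apply: hc => -[|[|[|//]]] _; rewrite /W /=; [exact: nf|exact: dec|exact: dec].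
  apply/setP => w; rewrite !inE; apply/idP/imsetP => [|[j _ ->]].
    rewrite -!orbA => /or4P[] /eqP ->.
    - by exists 0; rewrite // /W /= star_full.
    - by exists (@Ordinal 4 1 isT).
    - by exists (@Ordinal 4 2 isT).
    - by exists (@Ordinal 4 3 isT).
  by case: j => -[|[|[|[|//]]]] h; rewrite /W /= ?star_full eqxx ?orbT.
have inj (U U' : S4) : U != 0%VS -> U' != 0%VS -> U' != U -> star u U != star u U'.
  by move=> h1 h2; apply: contraNneq => /star_inj ->.
rewrite -{1}(star_full u) /= !inE !negb_or.
have /andP[_ a1] := nf A pA; have /andP[_ a2] := nf B pB; have /andP[_ a3] := nf C pC.
have /andP[_ b1] := dec _ _ iAB AB; have /andP[_ b2] := dec _ _ iAC AC.
have /andP[_ b3] := dec _ _ iBC BC.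
by rewrite !inj // n0.
Qed.

(** Converse of [star_cell]: a lift of the cell is a chain of lattices, and those other than the one
    above [u] can be scaled to lie between it and pi times it. The clause on [W w == 0] covers pi
    times that lattice, which has the same class. *)
Lemma cell_frame u s : s \in X -> u \in s -> exists W : V -> S4,
  (forall w, w \in s -> w = star u (W w) /\ (W w == 0%VS -> w = u)) /\
  (forall w w', w \in s -> w' \in s -> (W w <= W w')%VS || (W w' <= W w)%VS).
Proof.
move=> /(quo_cells hX)[->|[i [S [[pi' [L [hpi' hL piL Ldec hS]] sS]]]]].
  by rewrite inE.
have inS w : w \in s -> exists m y, [/\ (m <= i)%N, set_val y = hclass (L m) & p y = w].
  move=> ws; have : [set` s] w by [].
  by rewrite sS hS => -[y [m mi ym] pyw]; exists m, y.
move=> us; have [j [x [ji xj pxu]]] := inS u us.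
have Lmono a b : (a <= b)%N -> (b <= i)%N -> L b `<=` L a.
  elim: b => [|b IH]; first by rewrite leqn0 => /eqP -> _ t.
  rewrite leq_eqVlt => /orP[/eqP-> _ t //|]; rewrite ltnS => ab bi.
  by apply: subset_trans (IH ab (ltnW bi)); case: (Ldec b bi).
have [g [ug gL hp]] := star_frame xj.
(* The chain rotated so as to start at L j. *)
pose N m := if (j <= m)%N then L m else scale_lattice pi' (L m).
have piLL a b : (a <= i)%N -> (b <= i)%N -> scale_lattice pi' (L a) `<=` L b.
  move=> ai bi; apply: subset_trans (Lmono b i bi (leqnn _)).
  apply: subset_trans (proj1 piL); apply: scale_sub; exact: Lmono.
have Ncmp a b : (a <= i)%N -> (b <= i)%N -> N a `<=` N b \/ N b `<=` N a.
  move=> ai bi; rewrite /N; case: (leqP j a) => ja; case: (leqP j b) => jb.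
  - by case: (leqP a b) => ab; [right|left]; apply: Lmono => //; exact: ltnW.
  - by right; exact: piLL.
  - by left; exact: piLL.
  - case: (leqP a b) => ab; [right|left]; apply: scale_sub; apply: Lmono => //; exact: ltnW.
have NW m : exists W : S4, (m <= i)%N -> N m = mid g W.
  have [mi|//] := boolP (m <= i)%N; last by exists 0%VS.
  suff [W hW] : exists W : S4, N m = mid g W by exists W.
  have [gm ugm Lm] := lattice_basis hF (hL m mi).
  apply: (mid_of_osub hF hpi' ug).
  - rewrite /N Lm; case: ifP => _; first exact: osub_mid.
    rewrite scale_mid; exact: osub_mid.
  - rewrite -(mid_full hF) gL /N; case: leqP => jm; first exact: piLL.
    by apply: scale_sub; apply: Lmono => //; exact: ltnW.
  - rewrite -(mid_full hF) gL /N; case: leqP => jm; first exact: Lmono.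
    exact: piLL.
have /choice[Wm hWm] := NW.
have /choice[m hm] : forall w, exists m, w \in s ->
    exists y, [/\ (m <= i)%N, set_val y = hclass (L m) & p y = w].
  move=> w; have [ws|nws] := boolP (w \in s); last by exists 0%N.
  by have [m hm] := inS w ws; exists m.
have pi0 : pi' != 0 by case: hpi'.
exists (fun w => Wm (m w)); split=> [w ws|w w' ws ws'].
  have [y [mi ey pyw]] := hm w ws.
  have eN : set_val y = hclass (mid g (Wm (m w))).
    by rewrite -hWm // ey /N; case: ifP => _ //; rewrite homothety_scale.
  split; first by rewrite -{1}pyw -pxu; exact: hp.
  move=> /eqP W0; rewrite -pyw -pxu; congr (p _); apply: val_inj.
  apply: (etrans eN); apply: (etrans _ (esym xj)).
  by rewrite W0 (mid_zero hF hpi') -(mid_full hF) gL homothety_scale.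
have [y [mi _ _]] := hm w ws; have [y' [mi' _ _]] := hm w' ws'.
by apply/orP; case: (Ncmp _ _ mi mi'); rewrite !hWm // => /(mid_sub _ _ ug); [left|right].
Qed.

Lemma cell4E u (x y z : V) : cell4 u x y z <->
  exists A B C, [/\ flag A B C, x = star u A, y = star u B & z = star u C].
Proof.
split=> [/andP[un sX]|[A [B [C [fl -> -> ->]]]]]; last exact: cell4P_star.
have [|W [hW cmp]] := @cell_frame u _ sX; first by rewrite !inE eqxx.
have xs : x \in [set u; x; y; z]%SET by rewrite !inE eqxx !orbT.
have ys : y \in [set u; x; y; z]%SET by rewrite !inE eqxx !orbT.
have zs : z \in [set u; x; y; z]%SET by rewrite !inE eqxx !orbT.
move: un; rewrite /= !inE !negb_or => /and4P[/and3P[ux uy uz] /andP[xy xz] yz _].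
have prop w : w \in [set u; x; y; z]%SET -> u != w -> proper (W w).
  move=> ws uw; have [ew e0] := hW w ws.
  rewrite /proper lt0n dimv_eq0; apply/andP; split.
    by apply: contra uw => /e0 ->.
  rewrite ltn_neqAle; have := dimvS (subvf (W w)); rewrite dim_full => ->; rewrite andbT.
  apply: contra uw => /eqP d; apply/eqP; rewrite ew.
  have -> : W w = fullv by apply: sub_dim_eq; rewrite ?subvf // dim_full d.
  by rewrite star_full.
have inc w w' : w \in [set u; x; y; z]%SET -> w' \in [set u; x; y; z]%SET -> w != w' ->
    incident (W w) (W w').
  move=> ws ws' ww'; rewrite /incident cmp // andbT; apply: contra ww' => /eqP e.
  by rewrite (proj1 (hW w ws)) e -(proj1 (hW w' ws')).
exists (W x), (W y), (W z); split; try by case: (hW _ _).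
  by rewrite /flag !prop //= !inc.
- by case: (hW x xs).
- by case: (hW y ys).
- by case: (hW z zs).
Qed.

(** A face lifts to a subchain of the lattices; [js] lists the indices that are kept, in increasing
    order. *)
Lemma cells_down (s t : {set V}) : s \in X -> t \subset s -> t \in X.
Proof.
move=> sX ts; have [->|[w0 w0t]] := set_0Vmem t; first by apply/(quo_cells hX); left.
move: sX => /(quo_cells hX)[s0|[i [S [[pi' [L [hpi' hL piL Ldec hS]] sS]]]]].
  by move: (fintype.subsetP ts w0 w0t); rewrite s0 inE.
have Lmono a b : (a <= b)%N -> (b <= i)%N -> L b `<=` L a.
  elim: b => [|b IH]; first by rewrite leqn0 => /eqP -> _ z.
  rewrite leq_eqVlt => /orP[/eqP-> _ z //|]; rewrite ltnS => ab bi.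
  by apply: subset_trans (IH ab (ltnW bi)); case: (Ldec b bi).
pose good m := `[< exists y, set_val y = hclass (L m) /\ p y \in t >].
pose js := [seq m <- iota 0 i.+1 | good m].
have jsP m : (m \in js) = good m && (m <= i)%N.
  by rewrite mem_filter mem_iota add0n ltnS.
have js_in w : w \in t -> exists m y, [/\ m \in js, set_val y = hclass (L m) & p y = w].
  move=> wt; have : [set` s] w by exact: (fintype.subsetP ts).
  rewrite sS hS => -[y [m mi ym] pyw]; exists m, y; split=> //.
  by rewrite jsP mi andbT; apply/asboolP; exists y; rewrite pyw.
have [m0 [_ [m0js _ _]]] := js_in w0 w0t.
have sz : (0 < size js)%N by rewrite lt0n size_eq0; apply: contraTneq m0js => ->.
have nth_js a : (a <= (size js).-1)%N -> nth 0%N js a \in js.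
  by move=> ha; rewrite mem_nth // (leq_ltn_trans ha) // prednK.
have nth_le a : (a <= (size js).-1)%N -> (nth 0%N js a <= i)%N.
  by move=> /nth_js; rewrite jsP => /andP[].
have js_sorted : sorted ltn js by apply: sorted_filter (iota_ltn_sorted _ _); exact: ltn_trans.
have Lstrict a b : (a < b)%N -> (b <= i)%N -> L b `<` L a.
  move=> ab bi; have [h1 h2] := Ldec a (leq_trans ab bi).
  split; first exact: subset_trans (Lmono _ _ ab bi) h1.
  by move=> h3; apply: h2; apply: subset_trans h3 (Lmono _ _ ab bi).
apply/(quo_cells hX); right; exists (size js).-1.
exists [set x | exists2 a, (a <= (size js).-1)%N & set_val x = hclass (L (nth 0%N js a))].
split.
  exists pi', (fun a => L (nth 0%N js a)); split=> //.
  - by move=> a ha; apply: hL; exact: nth_le.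
  - have h0 : scale_lattice pi' (L (nth 0%N js 0)) `<=` scale_lattice pi' (L 0%N).
      by apply: scale_sub; apply: Lmono => //; exact: nth_le.
    have h1 : L i `<=` L (nth 0%N js (size js).-1) by apply: Lmono => //; exact: nth_le.
    case: piL => piL1 piL2; split.
      exact: subset_trans h0 (subset_trans piL1 h1).
    by move=> h; apply: piL2; exact: subset_trans h1 (subset_trans h h0).
  - move=> a ha; apply: Lstrict; last exact: nth_le.
    have ha' : (a.+1 < size js)%N by rewrite -ltn_predRL.
    by apply: (sorted_ltn_nth ltn_trans 0%N js_sorted); rewrite ?inE // ltnW.
apply/seteqP; split=> [w wt|_ [y [a ha ey] <-]] /=.
  have [m [y [mjs ey <-]]] := js_in w wt; exists y => //.
  exists (index m js); last by rewrite nth_index.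
  by rewrite -ltnS prednK // index_mem.
move: (nth_js a ha); rewrite jsP => /andP[/asboolP[y' [ey' hy']] _].
suff -> : y = y' by [].
by apply: val_inj; apply: (etrans ey); apply: esym.
Qed.

(** * Connectedness of the quotient *)

Section Connectivity.
Variable P : V -> Prop.
Hypothesis P_star : forall u (U : S4), proper U -> P u -> P (star u U).

Lemma P_adjacent L N x y : lattice v L -> osub v N ->
  scale_lattice pi L `<=` N -> N `<=` L ->
  set_val x = hclass L -> set_val y = hclass N -> P (p x) -> P (p y).
Proof.
move=> hL hN piN NL ex ey Px; have [g [ug gL hp]] := star_frame ex.
have [U NU] : exists U : S4, N = mid g U.
  by apply: (mid_of_osub hF hpi ug); rewrite // -(mid_full hF) gL.
have same : hclass N = hclass L -> P (p y).
  move=> e; suff -> : y = x by [].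
  by apply: val_inj; apply: (etrans ey); rewrite e; exact: esym.
have [U0|U0] := eqVneq U 0%VS.
  by apply: same; rewrite NU U0 (mid_zero hF hpi) -(mid_full hF) gL homothety_scale // (pi_neq0 hpi).
have [Uf|Uf] := eqVneq U fullv; first by apply: same; rewrite NU Uf gL.
rewrite (hp U y); last by rewrite ey NU.
apply: P_star => //; rewrite /proper lt0n dimv_eq0 U0 /= ltn_neqAle.
have := dimvS (subvf U); rewrite dim_full => ->; rewrite andbT.
by apply: contra Uf => /eqP d; apply/eqP/sub_dim_eq; rewrite ?subvf // dim_full d.
Qed.

Lemma P_sublattice n L N x y : lattice v L -> lattice v N ->
  scale_lattice (pi ^+ n) L `<=` N -> N `<=` L ->
  set_val x = hclass L -> set_val y = hclass N -> P (p x) -> P (p y).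
Proof.
elim: n L x => [|n IH] L x hL hN piN NL ex ey Px.
  rewrite expr0 scale1 in piN.
  suff -> : y = x by [].
  apply: val_inj; apply: (etrans ey); apply: (etrans _ (esym ex)).
  by congr hclass; apply/seteqP.
(* M = pi L + N is a neighbour of L, one step closer to N. *)
pose M := [set a + b | a in scale_lattice pi L & b in N].
have [gL ugL eL] := lattice_basis hF hL; have [gN ugN eN] := lattice_basis hF hN.
have oL : osub v L by rewrite eL; exact: osub_mid.
have oN : osub v N by rewrite eN; exact: osub_mid.
have opL : osub v (scale_lattice pi L) by rewrite eL scale_mid; exact: osub_mid.
have z0 (Q : S4) g : mid g Q 0.
  have [g0 gZ] := osub_mid g Q.
  exists 0; last by rewrite mulmx0.
  split; first by apply/mxOverP => i j; rewrite mxE val_ge0.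
  suff -> : map_mx (residue hF) 0 = 0 :> 'cV[k]_4 by rewrite mem0v.
  by apply/matrixP => i j; rewrite !mxE.
have pM : scale_lattice pi L `<=` M.
  by move=> a pa; exists a => //; exists 0; rewrite ?addr0 // eN; exact: z0.
have NM : N `<=` M.
  by move=> b Nb; exists 0; [rewrite eL scale_mid; exact: z0|exists b; rewrite ?add0r].
have piLL : scale_lattice pi L `<=` L.
  move=> _ [a La <-]; apply: oL.2 => //.
  by rewrite /valring val_geE (val_pi hpi) orbT.
have ML : M `<=` L by move=> _ [a pa [b Nb <-]]; apply: oL.1; [exact: piLL|exact: NL].
have oM : osub v M.
  split=> [_ _ [a pa [b Nb <-]] [a' pa' [b' Nb' <-]]|c _ hc [a pa [b Nb <-]]].
    exists (a + a'); first exact: opL.1.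
    by exists (b + b'); [exact: oN.1|rewrite addrACA].
  exists (c *: a); first exact: opL.2.
  by exists (c *: b); [exact: oN.2|rewrite scalerDr].
have hM : lattice v M.
  have [U ->] : exists U : S4, M = mid gL U.
    by apply: (mid_of_osub hF hpi ugL oM); rewrite -(mid_full hF) -eL.
  exact: (lattice_mid hpi).
have [z ez] := exists_vertex hM.
have Pz : P (p z) by apply: (P_adjacent hL oM pM ML ex ez Px).
apply: (IH M z hM hN _ NM ez ey Pz) => _ [_ [a [a' La' <-] [b Nb <-]] <-].
rewrite scalerDr; apply: oN.1; last first.
  apply: oN.2 => //; rewrite /valring val_geE (valX hF) ?(pi_neq0 hpi) // (val_pi hpi).
  by rewrite orbC ler0n.
by rewrite scalerA -exprSr; apply: piN; exists a'.
Qed.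

(** Multiplied by a power of pi, the lattice of y lies inside that of x and contains pi^b times it,
    which is the situation of [P_sublattice]. *)
Lemma star_connected u w : P u -> P w.
Proof.
have [x <-] := quo_surj hX u; have [y <-] := quo_surj hX w => Px.
have [ugx ex] := bbasisP hF x; have [ugy ey] := bbasisP hF y.
set gx := bbasis x in ugx ex; set gy := bbasis y in ugy ey.
have bound (A : 'M[F]_4) : exists n : nat, forall i j, pi ^+ n * A i j \in valring v.
  have b1 (a : F) : exists n : nat, forall m, (n <= m)%N -> pi ^+ m * a \in valring v.
    have [->|a0] := eqVneq a 0; first by exists 0%N => m _; rewrite mulr0 val_ge0.
    exists `|v a|%N => m hm; rewrite /valring val_geE (val_mul hF) ?expf_neq0 ?(pi_neq0 hpi) //.
    rewrite (valX hF) ?(pi_neq0 hpi) // (val_pi hpi) natz; apply/orP; right; lia.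
  have /fin_all_exists[n hn] (ij : 'I_4 * 'I_4) := b1 (A ij.1 ij.2).
  exists (\max_ij n ij)%N => i j; apply: (hn (i, j)); exact: leq_bigmax.
have [a ha] := bound (invmx gx *m gy); have [b hb] := bound (pi ^- a *: (invmx gy *m gx)).
have pX m : pi ^+ m != 0 by rewrite expf_neq0 ?(pi_neq0 hpi).
have hN : lattice v (mid (pi ^+ a *: gy) (fullv : S4)).
  by apply: (lattice_mid hpi); rewrite unitmxZ_F.
apply: (P_sublattice (n := b) (lattice_mid hpi (fullv : S4) ugx) hN _ _ ex) => //; last first.
- by rewrite -scale_mid homothety_scale.
- rewrite !mid_full => _ [c /mxOverP hc <-].
  exists ((pi ^+ a *: (invmx gx *m gy)) *m c).
    apply/mxOverP; apply: (mxO_mul hF) => // i j; rewrite mxE; exact: ha.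
  by rewrite -scalemxAl -scalemxAr -mulmxA mulKVmx // scalemxAl.
rewrite scale_mid !mid_full => _ [c /mxOverP hc <-].
exists ((pi ^+ b *: (pi ^- a *: (invmx gy *m gx))) *m c).
  by apply/mxOverP; apply: (mxO_mul hF) => // i j; rewrite mxE; exact: hb.
rewrite -!scalemxAl -!scalemxAr -!mulmxA !scalemxAr mulKVmx //.
by rewrite !scalerA mulrAC divff // mul1r.
Qed.
End Connectivity.

End Quotient.

(** The hypothesis says that w' is the push-forward of w along h, so form, norm, sum and total for
    [f] under w' are those of its pullback under w. *)
Lemma spectral_gap_transport (R : realType) (I J : finType) (w : I -> I -> R)
    (w' : J -> J -> R) (h : I -> J) lam :
  (forall F : J -> J -> R, \sum_x \sum_y w' x y * F x y
     = \sum_A \sum_B w A B * F (h A) (h B)) ->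
  spectral_gap w lam -> spectral_gap w' lam.
Proof.
move=> e gap f; have := gap (f \o h).
have -> : wform w (f \o h) (f \o h) = wform w' f f.
  rewrite /wform; under [RHS]eq_bigr do under eq_bigr do rewrite -mulrA.
  rewrite (e (fun x y => f x * f y)).
  by apply: eq_bigr => x _; apply: eq_bigr => y _; rewrite mulrA.
have ed (G : J -> R) : \sum_x wdeg w' x * G x = \sum_A wdeg w A * G (h A).
  rewrite /wdeg; under eq_bigr do rewrite mulr_suml.
  by rewrite (e (fun x _ => G x)); apply: eq_bigr => A _; rewrite mulr_suml.
have -> : wip w (f \o h) (f \o h) = wip w' f f.
  rewrite /wip; under [RHS]eq_bigr do rewrite -mulrA.
  by rewrite (ed (fun x => f x * f x)); apply: eq_bigr => A _; rewrite mulrA.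
have -> : wsum w (f \o h) = wsum w' f by rewrite /wsum ed.
suff -> : wtot w = wtot w' by [].
rewrite /wtot; under eq_bigr do rewrite -[wdeg _ _]mulr1.
by under [RHS]eq_bigr do rewrite -[wdeg _ _]mulr1; rewrite (ed (fun=> 1)).
Qed.

(** The right side of the gap inequality grows with lam because wsum^2 / wtot is at most |f|^2, by
    Cauchy-Schwarz. *)
Lemma spectral_gap_mono (R : realType) (I : finType) (w : I -> I -> R) lam mu :
  (forall x y, 0 <= w x y) -> lam <= mu -> spectral_gap w lam -> spectral_gap w mu.
Proof.
move=> w0 lm gap f; apply: le_trans (gap f) _.
have t0 : 0 <= wtot w by exact: wtot_ge0.
suff : wsum w f ^+ 2 / wtot w <= wip w f f by nra.
have [->|tn] := eqVneq (wtot w) 0; first by rewrite invr0 mulr0 wip_ge0.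
pose c := wsum w f / wtot w.
have := wip_ge0 w0 (fun x => 1 * f x + (- c) * (fun=> 1) x).
rewrite wip_sqr -wsum_wip.
have -> : wip w (fun=> 1) (fun=> 1) = wtot w.
  by apply: eq_bigr => x _; rewrite !mulr1.
have -> : wsum w f ^+ 2 / wtot w = 2 * c * wsum w f - c ^+ 2 * wtot w by rewrite /c; field.
lra.
Qed.

Lemma trickle_bound (R : realFieldType) (lam : R) : 0 < lam -> lam <= 1 / 4 ->
  [/\ lam < 1 / 2, 0 < lam / (1 - lam) & lam / (1 - lam) <= 2 * lam].
Proof.
move=> l0 l4; split; first by lra.
  by rewrite divr_gt0 //; lra.
by rewrite ler_pdivrMr; [nra|lra].
Qed.

(** * Transfer of gaps and expansion from the flag complex to the quotient *)

Section QuotientExpansion.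
Variables (R : realType) (F : fieldType) (v : F -> int) (q : nat).
Hypothesis hF : local_field v q.
Variable pi : F.
Hypothesis hpi : uniformizer v pi.
Variables (Gam : set 'M[F]_4) (V : finType) (p : bvertex v -> V) (X : {set {set V}}).
Hypothesis hX : quotient_complex Gam p X.
Local Notation k := (resfield hF).
Local Notation S4 := {vspace 'cV[k]_4}.
Local Notation st := (star (hF := hF) hpi hX).
Local Notation T := (cell4w R X).
Implicit Types (A B C : S4) (u x y z : V).

Lemma proper_neq0 A : proper A -> A != 0%VS.
Proof. by case/andP => h _; rewrite -dimv_eq0 -lt0n. Qed.

(** The chart is a bijection from flags to ordered tetrahedra at [u]: injective by [star_inj], onto
    by [cell4E]. *)
Lemma star_sum3 u (G : V -> V -> V -> R) :
  \sum_x \sum_y \sum_z T u x y z * G x y z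
   = \sum_A \sum_B \sum_C flagw R A B C * G (st u A) (st u B) (st u C).
Proof.
pose h (i : S4 * S4 * S4) := (st u i.1.1, st u i.1.2, st u i.2).
pose Q := [set i : S4 * S4 * S4 | flag i.1.1 i.1.2 i.2]%SET.
have inj : {in Q &, injective h}.
  move=> [[A B] C] [[A' B'] C']; rewrite !inE /= => /and5P[pA pB pC _ _] /and5P[pA' pB' pC' _ _].
  case=> eA eB eC; congr (_, _, _); [move: eA|move: eB|move: eC];
    by apply: star_inj; exact: proper_neq0.
have im : h @: Q = [set j : V * V * V | cell4 X u j.1.1 j.1.2 j.2]%SET.
  apply/setP => -[[x y] z]; rewrite inE /=; apply/imsetP/idP.
    by move=> [[[A B] C]]; rewrite inE /= => fl [-> -> ->]; exact: cell4P_star.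
  move=> /(cell4E hF hpi hX)[A [B [C [fl -> -> ->]]]].
  by exists (A, B, C); rewrite ?inE.
rewrite pair_bigA pair_bigA /= [RHS]pair_bigA [RHS]pair_bigA /=.
transitivity (\sum_(j in [set j : V * V * V | cell4 X u j.1.1 j.1.2 j.2]%SET) G j.1.1 j.1.2 j.2).
  rewrite [RHS]big_mkcond; apply: eq_bigr => -[[x y] z] _; rewrite inE /= /cell4w -/(cell4 X u x y z).
  by case: ifP; rewrite ?mul1r ?mul0r.
rewrite -im big_imset //= [LHS]big_mkcond; apply: eq_bigr => -[[A B] C] _.
by rewrite inE /flagw /=; case: ifP; rewrite ?mul1r ?mul0r.
Qed.

Lemma star_sum2 u (G : V -> V -> R) :
  \sum_x \sum_y marg3 T u x y * G x y
   = \sum_A \sum_B edgew R A B * G (st u A) (st u B).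
Proof.
transitivity (\sum_x \sum_y \sum_z T u x y z * G x y).
  by do 2! (apply: eq_bigr => ? _); rewrite mulr_suml.
rewrite (star_sum3 u (fun x y _ => G x y)).
by do 2! (apply: eq_bigr => ? _); rewrite mulr_suml.
Qed.

Variable lam : R.
Hypothesis lam0 : 0 < lam.
Hypothesis lam4 : lam <= 1 / 4.
Hypothesis lam'4 : lam / (1 - lam) <= 1 / 4.
Hypothesis lam_q : q%:R <= (lam * q.+1%:R) ^+ 2.

Let lam_k : #|(k : finFieldType)|%:R <= (lam * #|(k : finFieldType)|.+1%:R) ^+ 2.
Proof. by rewrite (card_resfield hF). Qed.

Lemma quotient_edge_gap u x : spectral_gap (T u x) lam.
Proof.
have [[A [pA ->]]|nA] := pselect (exists A, proper A /\ x = st u A); last first.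
  apply: spectral_gap0 => y z; rewrite /cell4w -/(cell4 X u x y z).
  case: (boolP (cell4 X u x y z)) => // /(cell4E hF hpi hX)[A [B [C [fl e _ _]]]].
  by case: nA; exists A; case/and5P: fl.
apply: (spectral_gap_transport (w := flagw R A) (h := st u)) => [G|]; last exact: flag_gap.
(* The indicator of x = st u A writes one slice as a triple sum, the form to which [star_sum3]
   applies. *)
transitivity (\sum_x \sum_y \sum_z T u x y z * ((x == st u A)%:R * G y z)).
  rewrite [RHS](bigD1 (st u A)) //= [X in _ + X]big1 ?addr0 => [|x' ne].
    by apply: eq_bigr => y _; apply: eq_bigr => z _; rewrite eqxx mul1r.
  by rewrite big1 // => y _; rewrite big1 // => z _; rewrite (negPf ne) mul0r mulr0.
rewrite (star_sum3 u (fun x y z => (x == st u A)%:R * G y z)).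
rewrite (bigD1 A) //= [X in _ + X]big1 ?addr0 => [|A' ne].
  by apply: eq_bigr => y _; apply: eq_bigr => z _; rewrite eqxx mul1r.
rewrite big1 // => B _; rewrite big1 // => C _.
rewrite /flagw; case: (boolP (flag A' B C)) => [/and5P[pA' _ _ _ _]|]; last by rewrite mul0r.
case: eqP => [/star_inj e|]; last by rewrite mul0r mulr0.
by move: ne; rewrite e ?proper_neq0 // eqxx.
Qed.

Lemma quotient_vertex_gap u : spectral_gap (marg3 T u) (lam / (1 - lam)).
Proof.
apply: (spectral_gap_transport (w := edgew R (k := k)) (h := st u)) => [G|].
  exact: star_sum2.
by apply: (edgew_gap lam0 lam_k); case: (trickle_bound lam0 lam4).
Qed.

Lemma exists_incident A : proper A -> exists2 B, proper B & incident A B.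
Proof.
move=> pA; have [d1|d1] := eqVneq (\dim A) 1%N.
  have [|x _ xA] := @exists_notin k A fullv; first by rewrite d1 dim_full.
  exists (A + <[x]>)%VS; first by rewrite /proper dim_add_line // d1.
  by rewrite incidentE addvSl dim_add_line // ltnSn.
have [B BA dB] := exists_point pA; exists B; first by rewrite /proper dB.
rewrite incidentE BA dB /= orbC ltn_neqAle eq_sym d1 /=.
by case/andP: pA => ->.
Qed.

Lemma quotient_connected : wconnected (marg2 T).
Proof.
move=> P hP x y _ _; apply: (star_connected (hF := hF) (hpi := hpi) (hX := hX)) => u A pA.
apply: hP; have [B pB iAB] := exists_incident pA; have [C fl] := flag_extend pA pB iAB.
have c := cell4P_star hpi hX u fl.
rewrite /marg2 psumr_eq0 => [|y' _]; last by apply: sumr_ge0 => z _; exact: T_ge0.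
apply/allPn; exists (st u B); rewrite ?mem_index_enum //.
rewrite /marg3 psumr_eq0 => [|z _]; last exact: T_ge0.
apply/allPn; exists (st u C); rewrite ?mem_index_enum //= /cell4w.
by rewrite -/(cell4 X u (st u A) (st u B) (st u C)) c oner_neq0.
Qed.

Lemma quotient_gap :
  spectral_gap (marg2 T) (lam / (1 - lam) / (1 - lam / (1 - lam))).
Proof.
have [_ l0 _] := trickle_bound lam0 lam4; have [l1 _ _] := trickle_bound l0 lam'4.
apply: (trickling_down_links (w3 := marg3 T)).
- by move=> x y z; apply: sumr_ge0 => t _; exact: T_ge0.
- by move=> x y z; apply: eq_bigr => t _; rewrite T01.
- by move=> x y z; apply: eq_bigr => t _; rewrite T12.
- exact: ltW.
- exact: l1.
- exact: quotient_connected.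
- exact: quotient_vertex_gap.
Qed.

Lemma star_coboundary_expansion u (f : V -> V -> bool) :
  (forall x y, f x y = f y x) ->
  (forall g : V -> bool, \sum_x \sum_y marg3 T u x y * (f x y)%:R
     <= \sum_x \sum_y marg3 T u x y * (f x y (+) g x (+) g y)%:R) ->
  \sum_x \sum_y marg3 T u x y * (f x y)%:R <=
    12 * \sum_x \sum_y \sum_z T u x y z * (f x y (+) f x z (+) f y z)%:R.
Proof.
move=> fs fmin; rewrite (star_sum2 u (fun x y => (f x y)%:R)).
rewrite (star_sum3 u (fun x y z => (f x y (+) f x z (+) f y z)%:R)).
apply: (flag_coboundary_expansion (f := fun A B => f (st u A) (st u B))) => // g.
(* The test function carried to the link; [gE] holds because the chart is injective on proper
   subspaces. *)
pose g' x : bool := `[< exists A, [/\ proper A, x = st u A & g A] >].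
have gE A : proper A -> g' (st u A) = g A.
  move=> pA; apply/asboolP/idP => [[B [pB /star_inj e gB]]|gA]; last by exists A.
  by rewrite e ?proper_neq0.
have := fmin g'; rewrite (star_sum2 u (fun x y => (f x y)%:R)).
rewrite (star_sum2 u (fun x y => (f x y (+) g' x (+) g' y)%:R)).
move/le_trans; apply; rewrite le_eqVlt; apply/orP; left; apply/eqP.
apply: eq_bigr => A _; apply: eq_bigr => B _.
have [e|/eqP e] := eqVneq (edgew R A B) 0; first by rewrite e !mul0r.
have [C /and5P[pA pB _ _ _]] : exists C, flag A B C.
  apply: contrapT => nf; apply: e; apply: big1 => C _.
  by rewrite /flagw; case: (boolP (flag A B C)) => // h; case: nf; exists C.
by rewrite !gE.
Qed.

End QuotientExpansion.

(** * Conclusion *)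

(** If q >= lam^-2 then (lam (q + 1))^2 >= lam^2 q^2 >= q. *)
Lemma large_order (R : realType) (lam : R) : 0 < lam ->
  exists q0 : nat, forall q : nat, (q0 <= q)%N -> q%:R <= (lam * q.+1%:R) ^+ 2.
Proof.
move=> l0; have l2 : 0 < lam ^+ 2 by rewrite exprn_gt0.
exists (Num.bound (lam ^- 2)) => q hq.
have h : lam ^- 2 <= q%:R.
  apply: le_trans (ltW (archi_boundP _)) _; first by rewrite invr_ge0 ltW.
  by rewrite ler_nat.
have h1 : 1 <= lam ^+ 2 * q%:R by rewrite -(ler_pM2l l2) mulfV ?gt_eqF // in h.
rewrite exprMn -natr1; have q1 : 0 <= q%:R :> R by exact: ler0n.
apply: le_trans (_ : lam ^+ 2 * (q%:R * q%:R) <= _).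
  by rewrite mulrA ler_peMl.
rewrite ler_wpM2l ?(ltW l2) // expr2; apply: ler_pM => //; rewrite lerDl //.
Qed.

(** Each of the two trickling steps at most doubles a gap that is at most 1/4, hence the factor
    4. *)
Lemma trickle_bounds (R : realFieldType) (lam L : R) :
  0 < lam -> lam <= 1 / 4 -> lam / (1 - lam) <= 1 / 4 -> 4 * lam <= L ->
  [/\ 0 <= L, lam <= L, lam / (1 - lam) <= L
    & lam / (1 - lam) / (1 - lam / (1 - lam)) <= L].
Proof.
move=> h0 h4 h4' hL.
have [h1 h2 h3] := trickle_bound h0 h4; have [h4'' h5 h6] := trickle_bound h2 h4'.
split; lra.
Qed.

Section Main.
Variables (R : realType) (F : fieldType) (v : F -> int) (q : nat).
Hypothesis hF : local_field v q.
Variables (Gam : set 'M[F]_4) (V : finType) (p : bvertex v -> V) (X : {set {set V}}).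
Hypothesis hX : quotient_complex Gam p X.
Local Notation T := (cell4w R X).
Local Notation n24 := ((24 * #|cells X 4|)%N%:R : R).

Variables (lam L : R).
Hypothesis lam0 : 0 < lam.
Hypothesis lam4 : lam <= 1 / 4.
Hypothesis lam'4 : lam / (1 - lam) <= 1 / 4.
Hypothesis lam_q : q%:R <= (lam * q.+1%:R) ^+ 2.
Hypothesis lam_L : 4 * lam <= L.

Lemma quotient_gaps : [/\ 0 <= L, spectral_gap (marg2 T) L,
  (forall u, spectral_gap (marg3 T u) L) & (forall u w, spectral_gap (T u w) L)].
Proof.
have [pi hpi] := val_normalized hF.
have [L0 l1 l2 l3] := trickle_bounds lam0 lam4 lam'4 lam_L.
have Tge := T_ge0 R X.
split=> //.
- apply: spectral_gap_mono l3 (quotient_gap hF hpi hX lam0 lam4 lam'4 lam_q).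
  by move=> x y; exact: (marg2_ge0 Tge).
- move=> u; apply: spectral_gap_mono l2 (quotient_vertex_gap hF hpi hX lam0 lam4 lam_q u).
  by move=> x y; exact: (marg3_ge0 Tge).
- move=> u w; apply: spectral_gap_mono l1 (quotient_edge_gap hF hpi hX lam0 lam_q u w).
  by move=> x y; exact: Tge.
Qed.

Let Xdown (s t : {set V}) : s \in X -> t \subset s -> t \in X.
Proof. exact: (cells_down hX). Qed.

Let sub2 x y z t : [set x; y; z; t]%SET \in X -> [set x; y]%SET \in X.
Proof.
move=> h; apply: (Xdown h); apply/fintype.subsetP => w; rewrite !inE.
by move=> /orP[] ->; rewrite ?orbT.
Qed.

Let sub3 x y z t : [set x; y; z; t]%SET \in X -> [set x; y; z]%SET \in X.
Proof.
move=> h; apply: (Xdown h); apply/fintype.subsetP => w; rewrite !inE.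
by move=> /orP[/orP[]|] ->; rewrite ?orbT.
Qed.

Let uniq2 (x y z t : V) : uniq [:: x; y; z; t] -> x != y.
Proof. by rewrite /= !inE !negb_or => /and4P[/and3P[]]. Qed.

Let uniq3 (x y z t : V) : uniq [:: x; y; z; t] -> uniq [:: x; y; z].
Proof. by rewrite (cat_uniq [:: x; y; z] [:: t]) => /andP[]. Qed.

Implicit Types a : {ffun {set V} -> 'F_2}.

Lemma expand_vertices a : L <= 1 / 4 ->
  n24 * cnorm R X 3 1 a <= 1 / 4 * n24 ->
  n24 * cnorm R X 3 1 a <= n24 * cnorm R X 3 2 (coboundary X 1 a).
Proof.
have [L0 g2 g1 g0] := quotient_gaps; move=> L4.
rewrite (cell4w_cnorm1 R Xdown) (cell4w_cnorm2 R Xdown) -(cell4w_total R Xdown) => hA.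
apply: le_trans (expansion0 (T_ge0 R X) (T01 R X) L0 g2 L4 hA) _.
rewrite le_eqVlt; apply/orP; left; apply/eqP; apply: eq_tsum_cells => x y z t u4 sX.
rewrite (cobound1 Xdown) ?(uniq2 u4) ?(sub2 sX) // F2_add_neq0.
by rewrite addbC.
Qed.

Lemma expand_edges a : L <= (1 / 100) ^+ 2 -> locally_minimal R X 3 2 a ->
  n24 * cnorm R X 3 2 a <= (1 / 100) ^+ 3 * n24 ->
  n24 * cnorm R X 3 2 a <= n24 * cnorm R X 3 3 (coboundary X 2 a).
Proof.
have [L0 g2 g1 g0] := quotient_gaps; move=> L4 amin.
rewrite (cell4w_cnorm2 R Xdown) (cell4w_cnorm3 R Xdown) -(cell4w_total R Xdown) => hA.
have asym x y : (a [set x; y]%SET != 0) = (a [set y; x]%SET != 0) by rewrite finset.setUC.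
have hmin u := link_min1 Xdown u amin.
apply: le_trans (expansion1 (T_ge0 R X) (T01 R X) (T12 R X) L0 g2 g1 asym L4 hmin hA) _.
rewrite le_eqVlt; apply/orP; left; apply/eqP; apply: eq_tsum_cells => x y z t u4 sX.
rewrite (cobound2 Xdown) ?(uniq3 u4) ?(sub3 sX) // !F2_add_neq0.
by case: (_ != 0); case: (_ != 0); case: (_ != 0).
Qed.

Lemma expand_triangles a (eta := (1 / 100) * (1 / 20) : R) :
  L <= eta ^+ 5 -> locally_minimal R X 3 3 a ->
  n24 * cnorm R X 3 3 a <= eta ^+ 8 * n24 ->
  1 / 1000 * (n24 * cnorm R X 3 3 a) <= n24 * cnorm R X 3 4 (coboundary X 3 a).
Proof.
have [L0 g2 g1 g0] := quotient_gaps; move=> L4 amin.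
have [pi hpi] := val_normalized hF.
rewrite (cell4w_cnorm3 R Xdown) (cell4w_cnorm4 R Xdown) -(cell4w_total R Xdown) => hA.
pose f (x y z : V) := a [set x; y; z]%SET != 0.
have s1 x y z : f x y z = f y x z by rewrite /f (finset.setUC [set x]%SET).
have s2 x y z : f x y z = f x z y by rewrite /f finset.setUAC.
have hmin u w := edge_min Xdown u w amin.
have hcob u : \sum_x \sum_y marg3 T u x y * (f u x y)%:R <=
    12 * \sum_x \sum_y \sum_z T u x y z * (f u x y (+) f u x z (+) f u y z)%:R.
  apply: (star_coboundary_expansion hF hpi hX (f := f u)) => // g.
  exact: link_min2.
apply: le_trans (expansion2 (T_ge0 R X) (T01 R X) (T12 R X) (T23 R X) L0 g2 g1 g0
  s1 s2 L4 hmin hcob hA) _.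
rewrite le_eqVlt; apply/orP; left; apply/eqP; apply: eq_tsum_cells => x y z t u4 sX.
rewrite (cobound3 Xdown) // !F2_add_neq0 /f.
by case: (_ != 0); case: (_ != 0); case: (_ != 0); case: (_ != 0).
Qed.

End Main.

Theorem theorem1p8 (R : realType) :
  exists q0 : nat, forall q : nat, (q0 <= q)%N -> prime_power q ->
  forall (F : fieldType) (v : F -> int), local_field v q ->
  exists eta eps : 'I_3 -> R,
    (forall i, 0 < eta i /\ 0 < eps i) /\
    forall (Gam : set 'M[F]_4) (V : finType) (p : bvertex v -> V)
           (X : {set {set V}}),
      quotient_complex Gam p X -> nonpartite v Gam -> ramanujan R p ->
      forall (i : 'I_3) (a : {ffun {set V} -> 'F_2}),
        cochain X i.+1 a -> locally_minimal R X 3 i.+1 a ->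
        cnorm R X 3 i.+1 a <= eta i ->
        eps i * cnorm R X 3 i.+1 a <= cnorm R X 3 i.+2 (coboundary X i.+1 a).
Proof.
pose e : R := (1 / 100) * (1 / 20).
have e0 : 0 < e by rewrite /e; lra.
have e1 : e <= 1 / 100 by rewrite /e; lra.
have eX n m : (m <= n)%N -> e ^+ n <= e ^+ m.
  by move=> mn; rewrite ler_wiXn2l // ?(ltW e0) //; lra.
have e5 : e ^+ 5 <= (1 / 100) ^+ 2.
  by apply: le_trans (eX 5 2 isT) _; rewrite lerXn2r // nnegrE ?(ltW e0) //; lra.
have e8 : e ^+ 8 <= (1 / 100) ^+ 3.
  by apply: le_trans (eX 8 3 isT) _; rewrite lerXn2r // nnegrE ?(ltW e0) //; lra.
(* The triangle case is the most demanding and requires the gap e^5; the 4 pays for the two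
   trickling steps. *)
pose lam := e ^+ 5 / 4.
have lam0 : 0 < lam by rewrite divr_gt0 // exprn_gt0.
have lam4 : lam <= 1 / 4 by rewrite /lam; move: e5; rewrite expr2; lra.
have lam'4 : lam / (1 - lam) <= 1 / 4.
  have [_ _ h] := trickle_bound lam0 lam4; apply: le_trans h _.
  by rewrite /lam; move: e5; rewrite expr2; lra.
have lamL : 4 * lam <= e ^+ 5 by rewrite /lam mulrC divfK ?pnatr_eq0.
have [q0 hq0] := large_order lam0.
exists q0 => q /hq0 lam_q _ F v hF.
(* The constants of the triangle case serve all three degrees and depend neither on q nor on F. *)
exists (fun=> e ^+ 8), (fun=> 1 / 1000); split=> [i|].
  by split; [exact: exprn_gt0|lra].
move=> Gam V p X hX _ _ i a _ amin ha.
pose n : R := (24 * #|cells X 4|)%N%:R.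
have n0 : 0 <= n by exact: ler0n.
have c0 k b : 0 <= cnorm R X 3 k b by apply: sumr_ge0 => s _; rewrite divr_ge0.
(* Without tetrahedra the weights have denominator 0, so they and the norm are 0. *)
have [nz|nz] := eqVneq n 0.
  have X4 : #|cells X 4| = 0%N by move/eqP: nz; rewrite /n pnatr_eq0 => /eqP; lia.
  rewrite (_ : cnorm R X 3 i.+1 a = 0) ?mulr0 //; apply: big1 => s _.
  by rewrite /weight X4 muln0 invr0 mulr0.
have npos : 0 < n by rewrite lt_def nz.
have hA k b : cnorm R X 3 k b <= e ^+ 8 -> n * cnorm R X 3 k b <= e ^+ 8 * n.
  by move=> h; rewrite mulrC ler_wpM2r.
rewrite -(ler_pM2l npos) mulrCA.
have small (x y : R) : 0 <= x -> x <= y -> 1 / 1000 * x <= y by move=> *; lra.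
case: i amin ha => -[|[|[|//]]] ? /= amin ha.
- apply: small; first by rewrite mulr_ge0.
  apply: (expand_vertices hF hX lam0 lam4 lam'4 lam_q lamL).
    by move: e5; rewrite expr2; lra.
  apply: le_trans (hA _ _ ha) _; rewrite ler_wpM2r //.
  by move: e8; rewrite !exprS expr0; lra.
- apply: small; first by rewrite mulr_ge0.
  apply: (expand_edges hF hX lam0 lam4 lam'4 lam_q lamL) => //.
  by apply: le_trans (hA _ _ ha) _; rewrite ler_wpM2r.
- apply: (expand_triangles hF hX lam0 lam4 lam'4 lam_q lamL) => //.
  exact: hA.
Qed.
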